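(* Let $\theta>1$ and $\nu>-1$. The set of functions $f\in L^2(\mathbb{R}^+,x^{\nu}e^{-x}dx)$ (identified up to equality almost everywhere) whose Fourier–Laguerre coefficients $$f_k=\int_{0}^{\infty} f(x)\,\ell^{\nu}_k(x)\,x^{\nu}e^{-x}\,dx,\qquad k=0,1,2,\dots,$$ satisfy $$\sum_{k=0}^{\infty}|f_k|^2\theta^k<\infty$$ is exactly the set of restrictions to $\mathbb{R}^+$ of entire functions $F:\mathbb{C}\to\mathbb{C}$ such that $$\int_{\mathbb{C}}|F(z)|^2\exp\left(\frac{2\operatorname{Re} z}{\theta-1}\right)|z|^{\nu}K_{\nu}\left(\frac{2\sqrt{\theta}\,|z|}{\theta-1}\right)d\sigma(z)<\infty .$$
   Context: $\mathbb{R}^+=(0,\infty)$. $\ell^{\nu}_k$ denotes the $k$-th orthonormal Laguerre polynomial with parameter $\nu$, i.e. the polynomial of degree $k$ (unique up to sign) such that $\int_0^\infty \ell^{\nu}_k(x)\ell^{\nu}_m(x)x^{\nu}e^{-x}dx=\delta_{k,m}$. $K_\nu$ is the modified Bessel function of the second kind (Macdonald function). $d\sigma$ is Lebesgue area measure on $\mathbb{C}$. Saying that $f$ is the restriction of an entire function means that $f$ agrees with that restriction almost everywhere. *)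

(* Defs.v *)
From mathcomp Require Import all_boot all_order all_algebra.
From mathcomp Require Import all_classical all_reals all_analysis.
From mathcomp Require Export complex.

Set Implicit Arguments.
Unset Strict Implicit.
Unset Printing Implicit Defensive.

Import Order.TTheory GRing.Theory Num.Theory.
Import numFieldNormedType.Exports.

Local Open Scope classical_set_scope.
Local Open Scope ring_scope.
Local Open Scope complex_scope.

(* [Normc.normc z] is the modulus as an element of [R]; the norm [`|z|] of
   [z : R[i]] takes its values in [R[i]]. *)

(* Square-integrable functions are handled through Borel-measurable
   representatives [R -> R[i]], of which only the values on [D] matter. *)
Definition cmeasurable (R : realType) (D : set R) (f : R -> R[i]) : Prop :=
  measurable_fun D (fun x => complex.Re (f x)) /\
  measurable_fun D (fun x => complex.Im (f x)).

Definition cintegral (R : realType) (D : set R) (f : R -> R[i]) : R[i] :=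
  (\int[lebesgue_measure]_(x in D) complex.Re (f x))%R +i*
  (\int[lebesgue_measure]_(x in D) complex.Im (f x))%R.

Definition laguerre_weight (R : realType) (nu x : R) : R :=
  x `^ nu * expR (- x).

(* For [nu > -1] these conditions determine each [l k] up to sign. *)
Definition orthonormal_laguerre (R : realType) (nu : R)
    (l : nat -> {poly R}) : Prop :=
  (forall k, size (l k) = k.+1) /\
  (forall k m, (\int[lebesgue_measure]_(x in `]0%R, +oo[)
     ((l k).[x] * (l m).[x] * laguerre_weight nu x)%:E)%E
     = ((k == m)%:R : R)%:E).

Definition laguerre_L2 (R : realType) (nu : R) (f : R -> R[i]) : Prop :=
  cmeasurable `]0, +oo[ f /\
  (\int[lebesgue_measure]_(x in `]0%R, +oo[)
     (Normc.normc (f x) ^+ 2 * laguerre_weight nu x)%:E < +oo)%E.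

Definition laguerre_coef (R : realType) (nu : R) (l : nat -> {poly R})
    (f : R -> R[i]) (k : nat) : R[i] :=
  cintegral `]0, +oo[
    (fun x => f x * ((l k).[x])%:C * (laguerre_weight nu x)%:C).

Definition cosh (R : realType) (t : R) : R := (expR t + expR (- t)) / 2.

(* The Macdonald function K_nu(x), for real [nu] and [x > 0], by its classical
   integral K_nu(x) = int_0^oo exp(- x cosh t) cosh(nu t) dt.  For [x <= 0]
   the value is meaningless. *)
Definition besselK (R : realType) (nu x : R) : R :=
  (\int[lebesgue_measure]_(t in `[0%R, +oo[)
     (expR (- (x * cosh t)) * cosh (nu * t)))%R.

(* Complex differentiability at every point: the scalars are [R[i]]. *)
Definition entire (R : realType) (F : R[i] -> R[i]) : Prop :=
  forall z : R[i], derivable (F : (R[i])^o -> (R[i])^o) z 1.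

(* Integral of a nonnegative function against area measure on the complex
   plane, identified with [R * R] by real and imaginary parts. *)
Definition area_integral (R : realType) (g : R[i] -> R) : \bar R :=
  (\int[lebesgue_measure \x lebesgue_measure]_(p in [set: R * R])
     (g (p.1 +i* p.2))%:E)%E.

Definition macdonald_weight (R : realType) (theta nu : R) (z : R[i]) : R :=
  expR (2 * complex.Re z / (theta - 1)) * Normc.normc z `^ nu *
  besselK nu (2 * Num.sqrt theta * Normc.normc z / (theta - 1)).

(* Main.v *)
Require Import Defs.
From HB Require Import structures.
From mathcomp Require Import all_boot all_order all_algebra.
From mathcomp Require Import all_classical all_reals all_analysis.
From mathcomp Require Import measurable_realfun.
From mathcomp Require Import ring lra.

Set Implicit Arguments.
Unset Strict Implicit.
Unset Printing Implicit Defensive.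

Import Order.TTheory GRing.Theory Num.Theory.
Import numFieldNormedType.Exports.

Local Open Scope classical_set_scope.
Local Open Scope ring_scope.
Local Open Scope complex_scope.

(** Put [a = 1 / (theta - 1)], so that the weight factor [exp(2 Re z / (theta - 1))]
    is [|e^{az}|^2], and let [g_j] be the Taylor coefficients of [F(z) e^{az}].
    The Macdonald weight is a mixture of Gaussians, so averaging over rotations
    by roots of unity gives, up to a constant, [sum_j M_j |g_j|^2] for the planar
    integral, with
    [M_j = j! Gamma(nu + j + 1) ((theta - 1)^2 / theta)^j].

    On the other side there are polynomials [q_n] of degree [n], with leading
    coefficient [theta^n], such that, up to a constant, the [M]-pairing of a
    sequence [g] with the Taylor coefficients of [z^n e^{az}] is the integral of
    [(sum_j g_j x^j) e^{-ax} q_n(x)] against [x^nu e^{-x}].  The linear map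
    [z^n -> q_n] is triangular and symmetric for the Laguerre inner product;
    hence [l_n] is an eigenvector with eigenvalue [theta^n], and the Taylor
    coefficients of the [l_n e^{az}] are orthogonal in the [M]-weighted l^2 with
    squared norms proportional to [theta^n].  Bessel's inequality and the
    completeness of the [l_n] then identify [sum_j M_j |g_j|^2 < oo] with
    [sum_n theta^n |f_n|^2 < oo]. *)

(** Multiplying by e^{az} leaves a weight that depends on |z| alone, which makes monomials
    orthogonal. The price is that the [l n] are moved away from monomials, and the real work is to
    find the Gram matrix of the l_n e^{az}. No explicit formula, recurrence or generating function
    for Laguerre polynomials enters: degree and orthonormality pin down the eigenvectors of a
    triangular symmetric map, and symmetry costs nothing because that map represents a symmetric
    pairing. The constants are forced. From 1 + a = theta a come the leading coefficients theta^n,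
    and (theta - 1)^2 / theta equals 1 / (a (1 + a)), the rate at which Taylor coefficients of
    e^{az} match moments of e^{-ax}. Square integrability of the restrictions is a separate matter:
    it rests on integrating the reproducing kernel over the half line, where a ratio test has limit
    4 theta / (theta + 1)^2 < 1. The half-line analysis is real, since the [l n] have real
    coefficients; complex functions enter through real and imaginary parts. Finiteness and
    positivity of Gamma(nu + 1) are read off the normalisation of [l 0]. *)

Definition bounded_sums (R : realType) (u : nat -> R) : Prop :=
  exists B : R, forall n, \sum_(j < n) u j <= B.

(** * Real series controlled by their partial sums *)

Section Series.
Context {R : realType}.
Implicit Types u v : nat -> R.

Lemma seriesEordf u n : series u n = \sum_(j < n) u j.
Proof. by rewrite /series/= big_mkord. Qed.

Lemma bounded_sums_le u v : (forall j, u j <= v j) ->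
  bounded_sums v -> bounded_sums u.
Proof.
move=> uv [B hB]; exists B => n.
by apply: le_trans (hB n); apply: ler_sum => j _.
Qed.

Lemma bounded_sumsD u v : bounded_sums u -> bounded_sums v ->
  bounded_sums (fun j => u j + v j).
Proof.
move=> [B hB] [C hC]; exists (B + C) => n.
by rewrite big_split lerD.
Qed.

Lemma bounded_sumsZ (c : R) u : 0 <= c -> bounded_sums u ->
  bounded_sums (fun j => c * u j).
Proof.
move=> c0 [B hB]; exists (c * B) => n.
by rewrite -mulr_sumr ler_wpM2l.
Qed.

Lemma bounded_sums_cvg u : (forall j, 0 <= u j) -> bounded_sums u ->
  cvgn (series u).
Proof.
move=> u0 [B hB]; apply: nondecreasing_is_cvgn.
  by apply: nondecreasing_series => n _ _; exact: u0.
by exists B => _ [n _ <-]; rewrite seriesEordf.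
Qed.

Lemma bounded_sums_normr_cvg u v : (forall j, `|u j| <= v j) ->
  bounded_sums v -> cvgn (series u).
Proof.
move=> uv bv; apply: normed_cvg.
apply: bounded_sums_cvg => [j|]; first exact: normr_ge0.
exact: (@bounded_sums_le _ v).
Qed.

Lemma bounded_sums_sum_le_lim u n : (forall j, 0 <= u j) -> bounded_sums u ->
  \sum_(j < n) u j <= limn (series u).
Proof.
move=> u0 bu; rewrite -seriesEordf; apply: nondecreasing_cvgn_le.
  by apply: nondecreasing_series => k _ _; exact: u0.
exact: bounded_sums_cvg.
Qed.

Lemma nneseries_lty u : (forall j, 0 <= u j) ->
  ((\sum_(0 <= k <oo) (u k)%:E < +oo)%E) <-> bounded_sums u.
Proof.
move=> u0; split=> [uoo|bu].
  have fn : (\sum_(0 <= k <oo) (u k)%:E)%E \is a fin_num.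
    by rewrite ge0_fin_numE// nneseries_ge0// => k _ _; rewrite lee_fin.
  exists (fine (\sum_(0 <= k <oo) (u k)%:E)%E) => n.
  rewrite -lee_fin fineK// -sumEFin.
  rewrite -(big_mkord xpredT (fun j => (u j)%:E)).
  by apply: nneseries_lim_ge => k _ _; rewrite lee_fin.
have [B hB] := bu.
apply: (@le_lt_trans _ _ B%:E); last exact: ltry.
apply: lime_le.
  by apply: is_cvg_nneseries => k _ _; rewrite lee_fin.
apply: nearW => n; rewrite sumEFin lee_fin.
by rewrite (big_mkord xpredT).
Qed.

Lemma ratio_test_bounded u (q : R) N : (forall j, 0 <= u j) -> 0 <= q < 1 ->
  (forall j, (N <= j)%N -> u j.+1 <= q * u j) -> bounded_sums u.
Proof.
move=> u0 /andP[q0 q1] hq.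
have hg k : u (N + k)%N <= u N * q ^+ k.
  elim: k => [|k IH]; first by rewrite addn0 expr0 mulr1.
  rewrite addnS exprS mulrCA; apply: (le_trans (hq _ (leq_addr _ _))).
  by rewrite ler_wpM2l.
have q1' : 0 < 1 - q by rewrite subr_gt0.
have hs k : \sum_(j < k) u (N + j)%N <= u N * (1 - q)^-1.
  apply: (@le_trans _ _ (\sum_(j < k) u N * q ^+ j)); first exact: ler_sum.
  rewrite -mulr_sumr ler_wpM2l// -[leRHS]mul1r ler_pdivlMr// mulrC.
  have := subrX1 q k; rewrite -[LHS]opprK opprB -[q - 1]opprB mulNr => /oppr_inj <-.
  by rewrite gerBl exprn_ge0.
exists (\sum_(j < N) u j + u N * (1 - q)^-1) => n.
have nN : (n <= N + n)%N by rewrite leq_addl.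
apply: (@le_trans _ _ (\sum_(j < N + n) u j)).
  rewrite -!(big_mkord xpredT) (big_cat_nat (leq0n n) nN)//= lerDl.
  by apply: sumr_ge0 => j _; exact: u0.
by rewrite big_split_ord/= lerD2l; exact: hs.
Qed.

End Series.

(** * Tonelli's theorem on product subdomains *)

Section Tonelli.
Local Open Scope ereal_scope.
Context d1 d2 (T1 : measurableType d1) (T2 : measurableType d2) (R : realType).
Variables (m1 : {sigma_finite_measure set T1 -> \bar R})
  (m2 : {sigma_finite_measure set T2 -> \bar R}).

Lemma tonelli_on (D : set T1) (E : set T2) (f : T1 * T2 -> \bar R) :
  measurable D -> measurable E -> measurable_fun (D `*` E) f ->
  (forall x y, D x -> E y -> 0 <= f (x, y)) ->
  \int[m1]_(x in D) \int[m2]_(y in E) f (x, y) =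
  \int[m2]_(y in E) \int[m1]_(x in D) f (x, y).
Proof.
move=> mD mE mf f0; pose g := f \_ (D `*` E).
have mg : measurable_fun setT g.
  by apply/(measurable_restrictT _ (measurableX mD mE)).
have g0 p : 0 <= g p.
  rewrite /g patchE; case: ifPn => //; rewrite inE => -[Dx Ey].
  by case: p Dx Ey => x y /= Dx Ey; exact: f0.
have := @fubini_tonelli _ _ _ _ _ m1 m2 g mg g0.
rewrite [X in X = _ -> _](_ : _ = \int[m1]_(x in D) \int[m2]_(y in E) f (x, y)).
  move=> ->; rewrite [RHS]integral_mkcond; apply: eq_integral => y _.
  rewrite patchE; case: ifPn => yE.
    rewrite [RHS]integral_mkcond; apply: eq_integral => x _.
    rewrite /g !patchE; case: ifPn => [|xn].
      by rewrite inE => -[/= xD _]; rewrite ifT// inE.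
    rewrite ifF//; apply: contraNF xn; rewrite !inE => xD; split=> //.
    by rewrite inE in yE.
  rewrite integral0_eq// => x _; rewrite /g patchE ifF//.
  by apply: contraNF yE; rewrite !inE => -[].
rewrite [RHS]integral_mkcond; apply: eq_integral => x _.
rewrite patchE; case: ifPn => xD.
  rewrite [RHS]integral_mkcond; apply: eq_integral => y _.
  rewrite /g !patchE; case: ifPn => [|yn].
    by rewrite inE => -[/= _ yE]; rewrite ifT// inE.
  rewrite ifF//; apply: contraNF yn; rewrite !inE => yE; split=> //.
  by rewrite inE in xD.
rewrite integral0_eq// => y _; rewrite /g patchE ifF//.
by apply: contraNF xD; rewrite !inE => -[].
Qed.

End Tonelli.

(** * Affine changes of variable *)

Section Affine.
Context {R : realType}.
Local Notation mu := (@lebesgue_measure R).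

Let affine (al be : R) : R -> measurableTypeR R := fun x => al * x + be.

Let measurable_affine (al be : R) : measurable_fun setT (affine al be).
Proof. by apply: measurable_funD => //; apply: measurable_funM. Qed.

Let push (al be : R) : {measure set (measurableTypeR R) -> \bar R} :=
  measure_function_pushforward__canonical__measure_function_Measure mu
    (measurable_affine al be).

(** Lebesgue measure is determined by its values on half-open intervals, so it is enough to compare
    lengths there. *)
Let lebesgue_measure_affine (al be : R) (A : set R) : al != 0 ->
  measurable A ->
  mu A = mscale (NngNum (normr_ge0 al)) (push al be) A.
Proof.
move=> al0 mA; apply: lebesgue_measure_unique mA => _ [[a b]] _ <-.
rewrite /= /mscale/= /pushforward lebesgue_measure_itv/= lte_fin.
have [alp|aln] := ltP 0 al.
  rewrite (_ : _ @^-1` _ = `](a - be) / al, (b - be) / al]%classic); last first.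
    apply/seteqP; split=> x /=; rewrite !in_itv/= /affine.
      by rewrite ltr_pdivrMr// ler_pdivlMr// ltrBlDr lerBrDr mulrC.
    by rewrite ltr_pdivrMr// ler_pdivlMr// ltrBlDr lerBrDr mulrC.
  rewrite lebesgue_measure_itv/= lte_fin ltr_pM2r ?invr_gt0// ltrD2r.
  case: ifPn => _; last by rewrite mule0.
  by rewrite -!EFinB -EFinM gtr0_norm//; congr (_%:E); field.
have {}aln : al < 0 by rewrite lt_neqAle al0.
(* A negative slope reverses the interval, so the preimage is closed on the left and open on the
   right; its length is unaffected. *)
rewrite (_ : _ @^-1` _ = `[(b - be) / al, (a - be) / al[%classic); last first.
  apply/seteqP; split=> x /=; rewrite !in_itv/= /affine.
    by rewrite ltr_ndivlMr// ler_ndivrMr// ltrBlDr lerBrDr mulrC andbC.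
  by rewrite ltr_ndivlMr// ler_ndivrMr// ltrBlDr lerBrDr mulrC andbC.
rewrite lebesgue_measure_itv/= lte_fin ltr_nM2r ?invr_lt0// ltrD2r.
case: ifPn => _; last by rewrite mule0.
by rewrite -!EFinB -EFinM ltr0_norm//; congr (_%:E); field.
Qed.

Local Open Scope ereal_scope.

Lemma ge0_integral_affine (al be : R) (f : R -> \bar R) : (al != 0)%R ->
  measurable_fun setT f -> (forall x, 0 <= f x) ->
  \int[mu]_x f x = `|al|%:E * \int[mu]_x f (al * x + be)%R.
Proof.
move=> al0 mf f0.
transitivity (\int[mscale (NngNum (normr_ge0 al))
    (push al be)]_x f x).
  by apply: eq_measure_integral => A mA _; exact: lebesgue_measure_affine.
rewrite ge0_integral_mscale//=.
congr (_ * _).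
rewrite ge0_integral_pushforward//=; exact: measurable_affine.
Qed.

Lemma ge0_integral_scale_itv (s : R) (f : R -> \bar R) : (0 < s)%R ->
  measurable_fun (`]0%R, +oo[ : set R) f -> (forall x, (0 < x)%R -> 0 <= f x) ->
  \int[mu]_(x in `]0%R, +oo[) f x =
  s%:E * \int[mu]_(x in `]0%R, +oo[) f (s * x)%R.
Proof.
move=> s0 mf f0; rewrite integral_mkcond.
rewrite (@ge0_integral_affine s 0%R)//; first last.
- move=> x; rewrite patchE; case: ifPn => //; rewrite inE/= in_itv/= andbT.
  exact: f0.
- by apply/(measurable_restrictT _ (measurable_itv _)).
- exact: lt0r_neq0.
rewrite gtr0_norm//; congr (_ * _); rewrite [RHS]integral_mkcond.
apply: eq_integral => x _; rewrite !patchE addr0.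
have -> : ((s * x)%R \in `]0%R, +oo[%classic) = (x \in `]0%R, +oo[%classic).
  by apply/idP/idP; rewrite !inE/= !in_itv/= !andbT pmulr_rgt0.
by [].
Qed.

End Affine.

(** * Weighted integrals on the half line *)

Section GammaMoments.
Context {R : realType}.
Variable nu : R.
Local Notation mu := (@lebesgue_measure R).
Local Notation W := (laguerre_weight nu).

Lemma laguerre_weight_ge0 (x : R) : 0 <= W x.
Proof. by rewrite mulr_ge0 ?powR_ge0 ?expR_ge0. Qed.

Lemma laguerre_weight_gt0 (x : R) : 0 < x -> 0 < W x.
Proof. by move=> x0; rewrite mulr_gt0 ?powR_gt0 ?expR_gt0. Qed.

Lemma measurable_laguerre_weight (D : set R) : measurable_fun D W.
Proof.
apply: measurable_funTS; apply: measurable_funM.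
  exact: measurable_realfun.measurable_powR.
by apply: measurableT_comp => //; exact: measurable_expR.
Qed.

Lemma cvg_ln_pinfty : ln (x : R) @[x --> +oo] --> +oo.
Proof.
apply/cvgryPge => A; near=> x.
rewrite -[A]expRK ler_ln ?posrE ?expR_gt0//.
Unshelve. all: end_near. Qed.

Lemma integral_powR_tail (p : R) : 1 < p ->
  (\int[mu]_(s in `[1%R, +oo[) (s `^ (- p))%:E = ((p - 1)^-1)%:E)%E.
Proof.
move=> p1; have p1' : 0 < p - 1 by rewrite subr_gt0.
pose F (y : R) : R := - (p - 1)^-1 * y `^ (1 - p).
have d (x : R) : 0 < x -> is_derive x (1 : R) F (x `^ (- p)).
  move=> x0; have h := is_derive1_powR (1 - p) x0.
  apply: (is_derive_eq (is_deriveZ (- (p - 1)^-1) h)).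
  rewrite /GRing.scale/= mulrA.
  have -> : - (p - 1)^-1 * (1 - p) = 1 by field; exact: lt0r_neq0.
  by rewrite mul1r; congr (_ `^ _); ring.
have co (x : R) : 0 < x -> {for x, continuous (fun y : R => y `^ (- p))}.
  move=> x0; apply/differentiable_continuous/derivable1_diffP.
  by have [] := is_derive1_powR (- p) x0.
rewrite (@ge0_continuous_FTC2y _ _ F 1 0).
- by rewrite /F powR1 mulr1 sub0e -EFinN opprK.
- by move=> x _; exact: powR_ge0.
- apply: continuous_in_subspaceT => x; rewrite inE/= in_itv/= andbT => x1.
  by apply: co; exact: lt_le_trans x1.
- rewrite -[X in _ --> X](mulr0 (- (p - 1)^-1)).
  apply: cvgM; first exact: cvg_cst.
  have : expR (- ((p - 1) * ln (x : R))) @[x --> +oo] --> (0 : R).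
    apply: (@cvg_comp _ _ _ (fun x : R => (p - 1) * ln x) (fun y => expR (- y)) _ +oo).
      by apply: gt0_cvgMry => //; exact: cvg_ln_pinfty.
    exact: cvgr_expR.
  apply: cvg_trans; apply: near_eq_cvg; near=> x.
  rewrite -[in RHS](@lnK _ x) ?posrE.
    by rewrite -expRM; congr expR; ring.
  by near: x; apply: nbhs_pinfty_gt; exact: num_real.
- by move=> x x1; have [] := d _ (lt_trans ltr01 x1).
- apply: cvg_at_right_filter; apply: differentiable_continuous.
  by apply/derivable1_diffP; have [] := d _ ltr01.
- move=> x; rewrite in_itv/= andbT => x1.
  by rewrite derive1E; have [_ ->] := d _ (lt_trans ltr01 x1).
Unshelve. all: end_near. Qed.

(** Exhibits e^{-x} as a superposition of the faster exponentials e^{-sx}, s >= 1. Combined with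
    Tonelli and scaling it replaces integration by parts in the recurrences for the half-line and
    the planar moments. *)
Lemma integral_expR_tail (x : R) : 0 < x ->
  (\int[mu]_(s in `[1%R, +oo[) (x * expR (- (s * x)))%:E = (expR (- x))%:E)%E.
Proof.
move=> x0; pose F (s : R) : R := - expR (- (s * x)).
have d (s : R) : is_derive s (1 : R) F (x * expR (- (s * x))).
  rewrite /F; apply: is_derive_eq.
  by rewrite /GRing.scale/=; ring.
have co : continuous (fun s : R => x * expR (- (s * x))).
  move=> s; apply/differentiable_continuous/derivable1_diffP.
  exact: ex_derive.
rewrite (@ge0_continuous_FTC2y _ _ F 1 0).
- by rewrite /F mul1r sub0e -EFinN opprK.
- by move=> s _; rewrite mulr_ge0 ?ltW// expR_gt0.
- exact: continuous_subspaceT.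
- rewrite -oppr0; apply: cvgN.
  apply: (@cvg_comp _ _ _ (fun s : R => s * x) (fun y => expR (- y)) _ +oo).
    exact: gt0_cvgMly.
  exact: cvgr_expR.
- by move=> s _; have [] := d s.
- apply: cvg_at_right_filter; apply: differentiable_continuous.
  by apply/derivable1_diffP; have [] := d 1.
- by move=> s _; rewrite derive1E; have [_ ->] := d s.
Qed.

(** This is Gamma(nu + j + 1). It is kept in the extended reals because its finiteness is only
    obtained later, from the existence of an orthonormal system. *)
Definition gamma_moment (j : nat) : \bar R :=
  (\int[mu]_(x in [set` `]0%R, +oo[]) (x ^+ j * W x)%:E)%E.

Lemma gamma_moment_ge0 j : (0 <= gamma_moment j)%E.
Proof.
apply: integral_ge0 => x /=; rewrite in_itv/= andbT => x0.
by rewrite lee_fin mulr_ge0 ?laguerre_weight_ge0// exprn_ge0// ltW.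
Qed.

Lemma gamma_moment_scale (s : R) j : 0 < s ->
  (\int[mu]_(x in [set` `]0%R, +oo[])
    (x ^+ j * (x `^ nu * expR (- (s * x))))%:E =
  (s `^ (- (nu + j.+1%:R)))%:E * gamma_moment j)%E.
Proof.
move=> s0; rewrite /gamma_moment [in RHS](ge0_integral_scale_itv s0)//; first last.
- move=> x x0; rewrite lee_fin mulr_ge0 ?laguerre_weight_ge0//.
  by rewrite exprn_ge0// ltW.
- apply/measurable_EFinP; apply: measurable_funM => //.
  exact: measurable_laguerre_weight.
have -> : (\int[mu]_(x in [set` `]0%R, +oo[]) ((s * x) ^+ j * W (s * x))%:E =
  \int[mu]_(x in [set` `]0%R, +oo[]) ((s ^+ j * s `^ nu)%:E *
     (x ^+ j * (x `^ nu * expR (- (s * x))))%:E))%E.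
  apply: eq_integral => x; rewrite inE/= in_itv/= andbT => x0.
  rewrite -EFinM; congr (_%:E); rewrite /laguerre_weight exprMn powRM ?ltW//.
  by ring.
rewrite ge0_integralZl//; first last.
- by rewrite lee_fin mulr_ge0 ?powR_ge0// exprn_ge0// ltW.
- move=> x /=; rewrite in_itv/= andbT => x0; rewrite lee_fin mulr_ge0//.
    by rewrite exprn_ge0// ltW.
  by rewrite mulr_ge0 ?powR_ge0 ?expR_ge0.
- apply/measurable_EFinP; apply: measurable_funM => //.
  apply: measurable_funM.
    by apply: measurable_funTS; exact: measurable_realfun.measurable_powR.
  apply: measurableT_comp; first exact: measurable_expR.
  by apply: measurableT_comp => //; exact: measurable_funM.
rewrite !muleA -!EFinM.
rewrite [X in X%:E](_ : _ = 1) ?mul1e//.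
rewrite -powR_mulrn ?ltW//.
transitivity (s `^ (- (nu + j.+1%:R)) * s `^ 1 * (s `^ j%:R * s `^ nu)).
  by rewrite powRr1 ?ltW.
rewrite -!powRD ?lt0r_neq0 ?implybT//.
rewrite (_ : _ + _ = 0) ?powRr0//.
by rewrite -natr1; ring.
Qed.

(** Replace e^{-x} by the integral of x e^{-sx} over s >= 1 and exchange the integrals. By scaling,
    the inner one is s^{-(nu + j + 2)} times the next moment, and integrating that power of s gives
    1 / (nu + j + 1). The argument is valid in [0, +oo]. *)
Lemma gamma_moment_rec j : -1 < nu ->
  (gamma_moment j = (nu + j.+1%:R)^-1%:E * gamma_moment j.+1)%E.
Proof.
move=> hnu.
have p0 : 0 < nu + j.+1%:R.
  by rewrite -natr1 addrCA ltr_wpDl// -ltrBlDr sub0r.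
rewrite {1}/gamma_moment.
transitivity (\int[mu]_(x in [set` `]0%R, +oo[]) \int[mu]_(s in `[1%R, +oo[)
   (x ^+ j * (x `^ nu * (x * expR (- (s * x)))))%:E)%E.
  apply: eq_integral => x; rewrite inE/= in_itv/= andbT => x0.
  under [RHS]eq_integral do rewrite mulrA EFinM.
  rewrite ge0_integralZl//.
  - by rewrite integral_expR_tail// -EFinM mulrA.
  - apply/measurable_EFinP; apply: measurable_funM => //.
    apply: measurableT_comp; first exact: measurable_expR.
    by apply: measurableT_comp => //; exact: measurable_funM.
  - by move=> s _; rewrite lee_fin mulr_ge0 ?expR_ge0// ltW.
  - by rewrite lee_fin mulr_ge0 ?powR_ge0// exprn_ge0// ltW.
have mset : measurable_fun ([set` `]0%R, +oo[] `*` [set` `[1%R, +oo[] : set (R * R))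
   (fun p : R * R => (p.1 ^+ j * (p.1 `^ nu * (p.1 * expR (- (p.2 * p.1)))))%:E).
  apply/measurable_EFinP; apply: measurable_funTS.
  apply: measurable_funM; first exact: measurable_funX.
  apply: measurable_funM.
    by apply: (measurableT_comp (measurable_realfun.measurable_powR nu)).
  apply: measurable_funM => //.
  apply: measurableT_comp; first exact: measurable_expR.
  by apply: measurableT_comp => //; exact: measurable_funM.
have /= -> := @tonelli_on _ _ _ _ R mu mu _ _ _
  (measurable_itv _) (measurable_itv _) mset; last first.
  move=> x s; rewrite !in_itv/= !andbT => x0 s1; rewrite lee_fin.
  by rewrite !mulr_ge0 ?expR_ge0 ?powR_ge0 ?exprn_ge0 ?(ltW x0).
transitivity (\int[mu]_(s in `[1%R, +oo[)
   ((s `^ (- (nu + j.+2%:R)))%:E * gamma_moment j.+1))%E.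
  apply: eq_integral => s; rewrite inE/= in_itv/= andbT => s1.
  rewrite -gamma_moment_scale ?(lt_le_trans ltr01)//.
  apply: eq_integral => x _; congr (_%:E); rewrite exprSr; ring.
rewrite ge0_integralZr//.
- rewrite integral_powR_tail.
    congr (_%:E * _)%E; congr (_ ^-1); rewrite -[in LHS]natr1; ring.
  by rewrite -natr1 addrA ltrDr.
- apply/measurable_EFinP/measurable_funTS.
  exact: measurable_realfun.measurable_powR.
- by move=> s _; rewrite lee_fin powR_ge0.
- exact: gamma_moment_ge0.
Qed.

End GammaMoments.

Section WeightedIntegral.
Context {R : realType}.
Variable nu : R.
Local Notation mu := (@lebesgue_measure R).
Local Notation W := (laguerre_weight nu).
Local Notation Rp := ([set` `]0%R, +oo[] : set R).

Definition wint (f : R -> R) : R :=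
  (\int[mu]_(x in Rp) (f x * W x))%R.

Lemma wintE (f : R -> R) : wint f = (\int[mu]_(x in Rp) (f x * W x))%R.
Proof. by []. Qed.

Definition wintegrable (f : R -> R) : Prop :=
  mu.-integrable Rp (EFin \o (fun x => f x * W x)).

Implicit Types f g : R -> R.

Let mRp : measurable (Rp : set (measurableTypeR R)). Proof. exact: measurable_itv. Qed.

Lemma wint_EFin f : wintegrable f ->
  (\int[mu]_(x in Rp) (f x * W x)%:E = (wint f)%:E)%E.
Proof. by move=> fi; rewrite /wint /Rintegral fineK//; exact: integrable_fin_num. Qed.

Lemma eq_wint f g : (forall x, 0 < x -> f x = g x) -> wint f = wint g.
Proof.
move=> fg; apply: eq_Rintegral => x; rewrite inE/= in_itv/= andbT => x0.
by rewrite fg.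
Qed.

Lemma eq_wintegrable f g : (forall x, 0 < x -> f x = g x) ->
  wintegrable f -> wintegrable g.
Proof.
move=> fg; apply: eq_integrable => // x; rewrite inE/= in_itv/= andbT => x0.
by rewrite /= fg.
Qed.

Lemma wintegrableD f g : wintegrable f -> wintegrable g ->
  wintegrable (fun x => f x + g x).
Proof.
move=> fi gi; have := (integrableD mRp fi gi); apply: eq_integrable => //.
by move=> x _ /=; rewrite mulrDl EFinD.
Qed.

Lemma wintegrableZ c f : wintegrable f -> wintegrable (fun x => c * f x).
Proof.
move=> fi; have := (integrableZl mRp c fi); apply: eq_integrable => //.
by move=> x _ /=; rewrite -EFinM mulrA.
Qed.

Lemma wintegrableB f g : wintegrable f -> wintegrable g ->
  wintegrable (fun x => f x - g x).
Proof.
move=> fi gi; have := (integrableB mRp fi gi); apply: eq_integrable => //.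
by move=> x _ /=; rewrite mulrBl EFinB.
Qed.

Lemma wintegrable0 : wintegrable (fun=> 0).
Proof.
by have := integrable0 mu Rp; apply: eq_integrable => // x _ /=; rewrite mul0r.
Qed.

Lemma wintegrable_sum n (f : nat -> R -> R) : (forall i, wintegrable (f i)) ->
  wintegrable (fun x => \sum_(i < n) f i x).
Proof.
move=> fi; elim: n => [|n IH].
  by apply: eq_wintegrable wintegrable0 => x _; rewrite big_ord0.
apply: (eq_wintegrable _ (wintegrableD IH (fi n))) => x _.
by rewrite big_ord_recr.
Qed.

Lemma wintD f g : wintegrable f -> wintegrable g ->
  wint (fun x => f x + g x) = wint f + wint g.
Proof.
move=> fi gi; rewrite /wint -RintegralD//.
by apply: eq_Rintegral => x _; rewrite mulrDl.
Qed.

Lemma wintB f g : wintegrable f -> wintegrable g ->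
  wint (fun x => f x - g x) = wint f - wint g.
Proof.
move=> fi gi; rewrite /wint -RintegralB//.
by apply: eq_Rintegral => x _; rewrite mulrBl.
Qed.

Lemma wintZ c f : wintegrable f -> wint (fun x => c * f x) = c * wint f.
Proof.
move=> fi; rewrite /wint -RintegralZl//.
by apply: eq_Rintegral => x _; rewrite mulrA.
Qed.

Lemma wint0 : wint (fun=> 0) = 0.
Proof.
rewrite -[RHS](mul0r (wint (fun=> 0))) -wintZ; last exact: wintegrable0.
by apply: eq_wint => x _; rewrite mul0r.
Qed.

Lemma wint_sum n (f : nat -> R -> R) : (forall i, wintegrable (f i)) ->
  wint (fun x => \sum_(i < n) f i x) = \sum_(i < n) wint (f i).
Proof.
move=> fi; elim: n => [|n IH].
  by rewrite big_ord0 -[RHS]wint0; apply: eq_wint => x _; rewrite big_ord0.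
rewrite big_ord_recr/= -IH -wintD//; last exact: wintegrable_sum.
by apply: eq_wint => x _; rewrite big_ord_recr.
Qed.

Lemma wint_ge0 f : (forall x, 0 < x -> 0 <= f x) -> 0 <= wint f.
Proof.
move=> f0; apply: Rintegral_ge0 => x /=; rewrite in_itv/= andbT => x0.
by rewrite mulr_ge0 ?f0 ?laguerre_weight_ge0.
Qed.

Lemma le_wintegrable f g : measurable_fun Rp f ->
  (forall x, 0 < x -> `|f x| <= g x) -> wintegrable g -> wintegrable f.
Proof.
move=> mf fg; apply: le_integrable => //.
  apply/measurable_EFinP; apply: measurable_funM => //.
  exact: measurable_laguerre_weight.
move=> x /=; rewrite in_itv/= andbT => x0; rewrite lee_fin !normrM.
by rewrite ler_wpM2r// (le_trans (fg _ x0))// ler_norm.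
Qed.

Lemma wintegrable_mul f g : measurable_fun Rp f -> measurable_fun Rp g ->
  wintegrable (fun x => f x ^+ 2) -> wintegrable (fun x => g x ^+ 2) ->
  wintegrable (fun x => f x * g x).
Proof.
move=> mf mg fi gi.
apply: (@le_wintegrable _ (fun x => f x ^+ 2 + g x ^+ 2)).
- exact: measurable_funM.
- move=> x _; rewrite -!(real_normK (num_real (f x))) -!(real_normK (num_real (g x))).
  rewrite normrM; have := sqr_ge0 (`|f x| - `|g x|); nra.
- exact: wintegrableD.
Qed.

Lemma wintegrable_sqr f : measurable_fun Rp f ->
  wintegrable (fun x => f x ^+ 2) <->
  (\int[mu]_(x in Rp) (f x ^+ 2 * W x)%:E < +oo)%E.
Proof.
move=> mf; split=> [|flty].
  by move=> /integrable_fin_num => /(_ mRp); rewrite fin_numElt => /andP[].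
apply/integrableP; split.
  apply/measurable_EFinP; apply: measurable_funM.
    exact: measurable_funX.
  exact: measurable_laguerre_weight.
under eq_integral => x.
  move=> _; rewrite gee0_abs; last first.
    by rewrite lee_fin (mulr_ge0 (sqr_ge0 _) (laguerre_weight_ge0 _ _)).
  over.
by [].
Qed.

Hypothesis hnu : -1 < nu.
Hypothesis gamma0_fin : gamma_moment nu 0 \is a fin_num.
Hypothesis gamma0_gt0 : (0 < gamma_moment nu 0)%E.

Definition gam (j : nat) : R := fine (gamma_moment nu j).

Lemma nu_gt0 j : 0 < nu + j.+1%:R.
Proof. by rewrite -natr1 addrCA ltr_wpDl// -ltrBlDr sub0r. Qed.

Let gamma_momentS j :
  gamma_moment nu j.+1 = ((nu + j.+1%:R)%:E * gamma_moment nu j)%E.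
Proof.
rewrite (gamma_moment_rec j hnu) muleA -EFinM mulfV ?mul1e//.
exact/lt0r_neq0/nu_gt0.
Qed.

Lemma gamma_momentE j : gamma_moment nu j = (gam j)%:E.
Proof.
rewrite /gam; elim: j => [|j IH]; first by rewrite fineK.
by rewrite gamma_momentS IH -EFinM.
Qed.

Lemma gamS j : gam j.+1 = (nu + j.+1%:R) * gam j.
Proof. by rewrite {1}/gam gamma_momentS gamma_momentE. Qed.

Lemma gam_gt0 j : 0 < gam j.
Proof.
elim: j => [|j IH]; first by rewrite -lte_fin -gamma_momentE.
by rewrite gamS mulr_gt0// nu_gt0.
Qed.

Lemma integral_monomial_expR (s : R) j : -1 < s ->
  (\int[mu]_(x in Rp) (x ^+ j * expR (- (s * x)) * W x)%:E =
   ((1 + s) `^ (- (nu + j.+1%:R)) * gam j)%:E)%E.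
Proof.
move=> s1; have s0 : 0 < 1 + s by rewrite addrC -ltrBlDr sub0r.
have := gamma_moment_scale nu j s0; rewrite gamma_momentE -EFinM => <-.
apply: eq_integral => x _; congr (_%:E); rewrite /laguerre_weight.
rewrite mulrDl mul1r opprD expRD; ring.
Qed.

Lemma measurable_monomial_expR (s : R) j (D : set R) :
  measurable_fun D (fun x => x ^+ j * expR (- (s * x))).
Proof.
apply: measurable_funTS; apply: measurable_funM => //.
apply: measurableT_comp; first exact: measurable_expR.
by apply: measurableT_comp => //; exact: measurable_funM.
Qed.

Lemma wintegrable_monomial_expR (s : R) j : -1 < s ->
  wintegrable (fun x => x ^+ j * expR (- (s * x))).
Proof.
move=> s1; apply/integrableP; split.
  apply/measurable_EFinP; apply: measurable_funM.
    exact: measurable_monomial_expR.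
  exact: measurable_laguerre_weight.
rewrite [X in (X < _)%E](_ : _ =
    (\int[mu]_(x in Rp) (x ^+ j * expR (- (s * x)) * W x)%:E)%E).
  by rewrite integral_monomial_expR// ltry.
apply: eq_integral => x; rewrite inE/= in_itv/= andbT => x0.
rewrite ger0_norm// (mulr_ge0 _ (laguerre_weight_ge0 _ _))//.
by rewrite mulr_ge0 ?expR_ge0// exprn_ge0// ltW.
Qed.

Lemma wint_monomial_expR (s : R) j : -1 < s ->
  wint (fun x => x ^+ j * expR (- (s * x))) =
  (1 + s) `^ (- (nu + j.+1%:R)) * gam j.
Proof. by move=> s1; rewrite /wint /Rintegral integral_monomial_expR. Qed.

Lemma wintegrable_horner_expR (s : R) (p : {poly R}) : -1 < s ->
  wintegrable (fun x => p.[x] * expR (- (s * x))).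
Proof.
move=> s1; apply: (@eq_wintegrable
  (fun x => \sum_(i < size p) (p`_i * (x ^+ i * expR (- (s * x)))))).
  move=> x _; rewrite horner_coef mulr_suml.
  by apply: eq_bigr => i _; rewrite mulrA.
apply: (@wintegrable_sum _ (fun i x => p`_i * (x ^+ i * expR (- (s * x))))) => i.
exact/wintegrableZ/wintegrable_monomial_expR.
Qed.

Lemma wintegrable_horner (p : {poly R}) : wintegrable (horner p).
Proof.
have := @wintegrable_horner_expR 0 p; rewrite ltrN10 => /(_ isT).
by apply: eq_wintegrable => x _; rewrite mul0r oppr0 expR0 mulr1.
Qed.

(* One integration by parts against [x^nu e^{-(1+s)x}], expressed on moments. *)
Lemma wint_monomial_expR_rec (s : R) j : -1 < s ->
  (1 + s) * wint (fun x => x ^+ j.+1 * expR (- (s * x))) =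
  (nu + j.+1%:R) * wint (fun x => x ^+ j * expR (- (s * x))).
Proof.
move=> s1; rewrite !wint_monomial_expR// gamS !mulrA; congr (_ * _).
rewrite [RHS]mulrC; congr (_ * _).
have s0 : 0 < 1 + s by rewrite addrC -ltrBlDr sub0r.
rewrite -[X in X * _]powRr1 ?ltW// -powRD ?lt0r_neq0 ?implybT//; congr (_ `^ _).
rewrite -[in LHS]natr1; ring.
Qed.

End WeightedIntegral.

(** Cauchy-Schwarz by induction: the new cross term 2 C x y is bounded by A y^2 + x^2 B after
    squaring, using C^2 <= A B and the nonnegativity of (A y^2 - x^2 B)^2. *)
Lemma sum_mulr_sqr_le {R : rcfType} n (a b : nat -> R) :
  (\sum_(i < n) a i * b i) ^+ 2 <=
  (\sum_(i < n) a i ^+ 2) * (\sum_(i < n) b i ^+ 2).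
Proof.
elim: n => [|n IH]; first by rewrite !big_ord0 expr0n mul0r.
rewrite !big_ord_recr/=.
set A := \sum_(i < n) a i ^+ 2 in IH *; set B := \sum_(i < n) b i ^+ 2 in IH *.
set C := \sum_(i < n) a i * b i in IH *; set x := a n; set y := b n.
have A0 : 0 <= A by apply: sumr_ge0 => i _; exact: sqr_ge0.
have B0 : 0 <= B by apply: sumr_ge0 => i _; exact: sqr_ge0.
suff : 2 * C * (x * y) <= A * y ^+ 2 + x ^+ 2 * B by lra.
have h : (2 * C * (x * y)) ^+ 2 <= (A * y ^+ 2 + x ^+ 2 * B) ^+ 2.
  apply: (@le_trans _ _ (4 * (A * B) * (x * y) ^+ 2)).
    rewrite (_ : _ ^+ 2 = 4 * C ^+ 2 * (x * y) ^+ 2); last by ring.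
    by rewrite ler_wpM2r ?sqr_ge0// ler_wpM2l.
  have := sqr_ge0 (A * y ^+ 2 - x ^+ 2 * B).
  rewrite -subr_ge0 => h; rewrite -subr_ge0.
  by apply: le_trans h _; rewrite le_eqVlt; apply/orP; left; apply/eqP; ring.
have /ler_wsqrtr := h; rewrite !sqrtr_sqr.
move=> /(le_trans (ler_norm _)) /le_trans; apply.
rewrite ger0_norm//.
by apply: addr_ge0; apply: mulr_ge0 => //; exact: sqr_ge0.
Qed.

Lemma EFin_lim_series {R : realType} (u : nat -> R) : (forall j, 0 <= u j) ->
  cvgn (series u) -> (\sum_(0 <= j <oo) (u j)%:E = (limn (series u))%:E)%E.
Proof.
move=> u0 cu; rewrite -EFin_lim//; congr (limn _); apply/funext => n /=.
by rewrite sumEFin.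
Qed.

(** * Series [e^{-ax} sum_j g_j x^j] with [g] in the weighted l^2 *)

Section ExpSeries.
Context {R : realType}.
Variables nu theta : R.
Hypothesis hnu : -1 < nu.
Hypothesis htheta : 1 < theta.
Hypothesis gamma0_fin : gamma_moment nu 0 \is a fin_num.
Hypothesis gamma0_gt0 : (0 < gamma_moment nu 0)%E.
Local Notation mu := (@lebesgue_measure R).
Local Notation W := (laguerre_weight nu).
Local Notation Rp := ([set` `]0%R, +oo[] : set R).
Local Notation wint := (wint nu).
Local Notation wintegrable := (wintegrable nu).
Local Notation gam := (gam nu).

Definition rate : R := (theta - 1)^-1.
Definition radius : R := (theta - 1) ^+ 2 / theta.
Implicit Types g h : nat -> R.
Local Notation a := rate.
Local Notation beta := radius.

Lemma theta_gt0 : 0 < theta. Proof. exact: lt_trans htheta. Qed.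
Lemma rate_gt0 : 0 < a. Proof. by rewrite invr_gt0 subr_gt0. Qed.
Lemma radius_gt0 : 0 < beta.
Proof. by rewrite divr_gt0 ?theta_gt0// exprn_gt0// subr_gt0. Qed.

(** The source of theta^n: each step of [dual_poly] multiplies the leading coefficient by (1 + a) /
    a. *)
Lemma onerate : 1 + a = theta * a.
Proof. by rewrite /rate; field; rewrite gt_eqF// subr_gt0. Qed.

(** The identity that dictates [radius]: it turns the factor ([radius] a)^j, present in the weight
    times a Taylor coefficient of z^n e^{az}, into the (1 + a)^{-j} present in the moments of
    e^{-ax}. *)
Lemma radius_rate : beta * a * (1 + a) = 1.
Proof.
rewrite onerate /radius /rate; field.
by rewrite !gt_eqF ?theta_gt0 ?subr_gt0.
Qed.

Definition fock_weight (j : nat) : R := j`!%:R * gam j * beta ^+ j.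
Local Notation M := fock_weight.

Lemma fock_weight_gt0 j : 0 < M j.
Proof.
by rewrite !mulr_gt0 ?exprn_gt0 ?radius_gt0 ?gam_gt0// ltr0n fact_gt0.
Qed.

Lemma fock_weightS j :
  M j.+1 = j.+1%:R * (nu + j.+1%:R) * beta * M j.
Proof. by rewrite /fock_weight factS natrM gamS// exprS; ring. Qed.

(** Real sequences suffice, because a complex sequence lies in the weighted l^2 exactly when its
    real and imaginary parts do. *)
Definition fock (g : nat -> R) : Prop :=
  bounded_sums (fun j => M j * g j ^+ 2).

Lemma fockD g h : fock g -> fock h -> fock (fun j => g j + h j).
Proof.
move=> fg fh; apply: (@bounded_sums_le _ _
  (fun j => 2 * (M j * g j ^+ 2) + 2 * (M j * h j ^+ 2))).
  move=> j; have := sqr_ge0 (g j - h j); have := fock_weight_gt0 j; nra.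
by apply: bounded_sumsD; exact: bounded_sumsZ.
Qed.

Lemma fockZ c g : fock g -> fock (fun j => c * g j).
Proof.
move=> fg; apply: (@bounded_sums_le _ _ (fun j => c ^+ 2 * (M j * g j ^+ 2))).
  by move=> j; rewrite exprMn mulrCA.
exact: bounded_sumsZ (sqr_ge0 _) fg.
Qed.

Lemma fock0 : fock (fun=> 0).
Proof. by exists 0 => n; rewrite big1// => j _; rewrite expr0n mulr0. Qed.

Lemma fock_sum n (c : nat -> R) (g : nat -> nat -> R) : (forall i, fock (g i)) ->
  fock (fun j => \sum_(i < n) c i * g i j).
Proof.
move=> fg; elim: n => [|n IH].
  by apply: bounded_sums_le fock0 => j; rewrite big_ord0.
have := fockD IH (fockZ (c n) (fg n)).
by apply: bounded_sums_le => j; rewrite big_ord_recr.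
Qed.

(** By Cauchy-Schwarz this sum is the squared norm of evaluation at [x]. Consecutive terms have
    ratio x^2 / ((j + 1) (nu + j + 1) [radius]), which tends to 0. *)
Lemma evaluation_bounded (x : R) : bounded_sums (fun j => x ^+ (2 * j) / M j).
Proof.
have [N hN] : exists N, 2 * x ^+ 2 < N%:R * beta.
  exists (Num.bound (2 * x ^+ 2 / beta)).
  rewrite -ltr_pdivrMr ?radius_gt0//; apply: archi_boundP.
  by rewrite divr_ge0 ?(ltW radius_gt0)// mulr_ge0// sqr_ge0.
apply: (@ratio_test_bounded _ _ (2^-1) N.+1).
- move=> j; apply: divr_ge0; last exact/ltW/fock_weight_gt0.
  by rewrite mulnC exprM sqr_ge0.
- by lra.
move=> j Nj; rewrite mulnS exprD fock_weightS invfM mulrA [_ * (_ / _)]mulrA.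
rewrite ler_pM2r ?invr_gt0 ?fock_weight_gt0// mulrAC.
rewrite ler_wpM2r//; first by rewrite mulnC exprM sqr_ge0.
have j1 : 1 <= j.+1%:R :> R by rewrite ler1n.
have p0 : N%:R <= nu + j.+1%:R.
  have : N.+1%:R <= j%:R :> R by rewrite ler_nat.
  by have := hnu; rewrite -!natr1; lra.
have b0 := radius_gt0.
rewrite ler_pdivrMr; last first.
  by rewrite mulr_gt0// mulr_gt0 ?nu_gt0// ltr0n.
have h1 : N%:R * beta <= (nu + j.+1%:R) * beta by rewrite ler_wpM2r// ltW.
have h2 : (nu + j.+1%:R) * beta <= j.+1%:R * ((nu + j.+1%:R) * beta).
  by rewrite ler_peMl// mulr_ge0 ?ltW ?nu_gt0.
rewrite -mulrA; lra.
Qed.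

(** Integrating the evaluation norm, tilted by e^{-2ax}, against the Laguerre weight still gives a
    finite value. This is what makes the restriction of every function in the weighted space square
    integrable. *)
Lemma evaluation_norm_bounded :
  bounded_sums (fun j => wint (fun x => x ^+ (2 * j) * expR (- (2 * a * x))) / M j).
Proof.
have a0 := rate_gt0; have b0 := radius_gt0; have t0 := theta_gt0.
have s1 : -1 < 2 * a by apply: lt_trans (mulr_gt0 _ a0); lra.
have s0 : 0 < 1 + 2 * a by rewrite ltr_wpDr// mulr_ge0// ltW.
(* The limit of the ratios: the moments grow like (2j)^2 / (1 + 2a)^2 per step and the weights like
   [radius] j^2. The inequality k < 1 is (theta - 1)^2 > 0. *)
pose k := 4 * theta / (theta + 1) ^+ 2.
have t1 : 0 < (theta + 1) ^+ 2 by rewrite exprn_gt0// ltr_wpDr.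
have hk : k * (1 + 2 * a) ^+ 2 * beta = 4.
  rewrite /k /rate /radius; field.
  by rewrite !gt_eqF ?subr_gt0// addr_gt0.
(* The ratio is at most [k] as soon as (nu + 2j + 2) (nu + 2j + 1) <= 4 (j + 1) (nu + j + 1). The
   two sides differ by 2j + (nu + 1) (2 - nu), which is nonnegative once j >= (nu + 1) (nu + 2). *)
pose N := Num.bound ((nu + 1) * (nu + 2)).
have hN : (nu + 1) * (nu + 2) < N%:R.
  apply: archi_boundP; have nu1 : 0 <= nu + 1 by have := hnu; lra.
  by rewrite mulr_ge0// (le_trans nu1)// lerD2l ler1n.
apply: (@ratio_test_bounded _ _ k N).
- move=> j; apply: divr_ge0; last exact/ltW/fock_weight_gt0.
  by apply: wint_ge0 => x x0; rewrite mulr_ge0 ?expR_ge0// exprn_ge0// ltW.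
- apply/andP; split.
    by apply: divr_ge0; [apply: mulr_ge0 => //; exact: ltW | exact: ltW].
  rewrite ltr_pdivrMr// mul1r -subr_gt0.
  rewrite (_ : _ - _ = (theta - 1) ^+ 2); last by ring.
  by rewrite exprn_gt0// subr_gt0.
move=> j Nj; pose I := fun i : nat => wint (fun x => x ^+ i * expR (- (2 * a * x))).
rewrite -![wint _]/(I _).
have r1 := wint_monomial_expR_rec hnu gamma0_fin (2 * j).+1 s1.
have r2 := wint_monomial_expR_rec hnu gamma0_fin (2 * j) s1.
have -> : I (2 * j.+1)%N =
    (nu + (2 * j).+2%:R) * (nu + (2 * j).+1%:R) / (1 + 2 * a) ^+ 2 * I (2 * j)%N.
  rewrite mulnS /I.
  apply: (mulfI (x := (1 + 2 * a) ^+ 2)); first by rewrite gt_eqF// exprn_gt0.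
  change (2 + 2 * j)%N with (2 * j).+2.
  rewrite [in LHS]expr2 -[LHS]mulrA r1 mulrCA r2; field.
  by rewrite gt_eqF.
have I0 : 0 <= I (2 * j)%N.
  by apply: wint_ge0 => x x0; rewrite mulr_ge0 ?expR_ge0// exprn_ge0// ltW.
rewrite fock_weightS ler_pdivrMr; last first.
  apply: mulr_gt0 (fock_weight_gt0 _); apply: mulr_gt0 => //.
  by apply: mulr_gt0; [rewrite ltr0n | exact: nu_gt0].
have M0 := fock_weight_gt0 j.
rewrite (_ : k * (I (2 * j)%N / M j) * (j.+1%:R * (nu + j.+1%:R) * beta * M j)
  = (k * beta * (j.+1%:R * (nu + j.+1%:R))) * I (2 * j)%N); last first.
  by field; rewrite gt_eqF.
rewrite ler_wpM2r// ler_pdivrMr ?exprn_gt0//.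
rewrite (_ : _ * (1 + 2 * a) ^+ 2 = 4 * (j.+1%:R * (nu + j.+1%:R))); last first.
  by rewrite -hk; ring.
have {}Nj : (nu + 1) * (nu + 2) <= j%:R.
  by apply: le_trans (ltW hN) _; rewrite ler_nat.
rewrite -!natr1 natrM; have j0 : 0 <= j%:R :> R by [].
have := hnu; nra.
Qed.

Let bounded_sums_kernel (x : R) :
  cvgn (series (fun j => x ^+ (2 * j) / M j)).
Proof.
apply: bounded_sums_cvg (evaluation_bounded x) => j; apply: divr_ge0.
  by rewrite mulnC exprM sqr_ge0.
exact/ltW/fock_weight_gt0.
Qed.

(** The reproducing kernel on the diagonal, tilted by e^{-2ax}. It dominates the squares of all
    partial sums at once and so supplies the majorant for dominated convergence. *)
Definition fock_kernel (x : R) : R :=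
  limn (series (fun j => x ^+ (2 * j) / M j)) * expR (- (2 * a * x)).

Lemma fock_kernel_ge0 x : 0 <= fock_kernel x.
Proof.
rewrite mulr_ge0 ?expR_ge0// limr_ge//; apply: nearW => n.
rewrite seriesEordf sumr_ge0// => j _; apply: divr_ge0.
  by rewrite mulnC exprM sqr_ge0.
exact/ltW/fock_weight_gt0.
Qed.

(** All terms are nonnegative, so series and integral may be exchanged; what is left is
    [evaluation_norm_bounded]. *)
Lemma wintegrable_fock_kernel : wintegrable fock_kernel.
Proof.
have M0 := fock_weight_gt0.
pose f (j : nat) (x : R) : \bar R :=
  ((M j)^-1 * (x ^+ (2 * j) * expR (- (2 * a * x)) * W x))%:E.
have f0 j x : (0 <= f j x)%E.
  rewrite lee_fin mulr_ge0 ?invr_ge0 ?(ltW (M0 j))//.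
  rewrite (mulr_ge0 _ (laguerre_weight_ge0 _ _))// mulr_ge0 ?expR_ge0//.
  by rewrite mulnC exprM sqr_ge0.
have mf j : measurable_fun Rp (f j).
  apply/measurable_EFinP; apply: measurable_funM => //; apply: measurable_funM.
    exact: measurable_monomial_expR.
  exact: measurable_laguerre_weight.
have kE x : ((fock_kernel x * W x)%:E = \sum_(0 <= j <oo) f j x)%E.
  rewrite /f EFin_lim_series => [|j|]; last 2 first.
  - by have := f0 j x; rewrite lee_fin.
  - rewrite (_ : (fun j => _) =
      (expR (- (2 * a * x)) * W x) *: (fun j => x ^+ (2 * j) / M j)).
      exact: is_cvg_seriesZ.
    by apply/funext => j; rewrite fctE /GRing.scale/=; ring.
  congr (_%:E); rewrite (_ : (fun j => _) =
      (expR (- (2 * a * x)) * W x) *: (fun j => x ^+ (2 * j) / M j)).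
    by rewrite lim_seriesZ// /fock_kernel /GRing.scale/=; ring.
  by apply/funext => j; rewrite fctE /GRing.scale/=; ring.
have k0 x : 0 <= fock_kernel x * W x.
  by rewrite mulr_ge0 ?laguerre_weight_ge0// fock_kernel_ge0.
have mk : measurable_fun Rp (fun x => (fock_kernel x * W x)%:E).
  rewrite (_ : (fun x => _) = (fun x => \sum_(0 <= j <oo) f j x)%E); last first.
    by apply/funext => x; exact: kE.
  by apply: ge0_emeasurable_sum => // j x _ _; exact: f0.
apply/integrableP; split=> //.
rewrite [X in (X < _)%E](_ : _ =
  (\int[mu]_(x in Rp) (\sum_(0 <= j <oo) f j x))%E); last first.
  by apply: eq_integral => x _; rewrite -kE gee0_abs//= lee_fin.
rewrite integral_nneseries//.
have a1 : -1 < 2 * a.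
  by have := rate_gt0; lra.
rewrite (eq_eseriesr (g := fun j => (wint (fun x => x ^+ (2 * j) * expR (- (2 * a * x))) / M j)%:E)).
  apply/nneseries_lty; last exact: evaluation_norm_bounded.
  move=> j; rewrite divr_ge0 ?(ltW (M0 j))//.
  by apply: wint_ge0 => x x0; rewrite mulr_ge0 ?expR_ge0// exprn_ge0// ltW.
move=> j _; rewrite /f; under eq_integral do rewrite EFinM.
rewrite ge0_integralZl//.
- rewrite (wint_EFin (wintegrable_monomial_expR hnu gamma0_fin _ a1)).
  by rewrite -EFinM mulrC.
- apply/measurable_EFinP; apply: measurable_funM.
    exact: measurable_monomial_expR.
  exact: measurable_laguerre_weight.
- move=> x _; rewrite lee_fin (mulr_ge0 _ (laguerre_weight_ge0 _ _))//.
  by rewrite mulr_ge0 ?expR_ge0// mulnC exprM sqr_ge0.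
- by rewrite lee_fin invr_ge0 ltW.
Qed.

Lemma exp_series_cvg g x : fock g -> cvgn (series (fun j => g j * x ^+ j)).
Proof.
move=> fg; apply: (@bounded_sums_normr_cvg _ _
  (fun j => M j * g j ^+ 2 + x ^+ (2 * j) / M j)).
  move=> j; have M0 := fock_weight_gt0 j.
  rewrite mulnC exprM normrM -(real_normK (num_real (g j))).
  rewrite -[X in _ <= _ + X / _](real_normK (num_real (x ^+ j))).
  set u := `|g j|; set v := `|x ^+ j|.
  rewrite -subr_ge0 (_ : _ - _ =
    ((M j * u - v / 2) ^+ 2 + 3 / 4 * v ^+ 2) / M j); last by field; rewrite gt_eqF.
  by rewrite divr_ge0 ?(ltW M0)// addr_ge0 ?sqr_ge0// mulr_ge0// sqr_ge0.
by apply: bounded_sumsD => //; exact: evaluation_bounded.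
Qed.

Definition exp_series (g : nat -> R) (x : R) : R :=
  limn (series (fun j => g j * x ^+ j)) * expR (- (a * x)).

Lemma exp_seriesE g x : exp_series g x =
  limn (series (fun j => g j * x ^+ j)) * expR (- (a * x)).
Proof. by []. Qed.

(** Cauchy-Schwarz after splitting each term as sqrt(M_j) g_j times x^j / sqrt(M_j). *)
Lemma exp_partial_sqr_le g (B : R) n x :
  (forall n : nat, \sum_(j < n) M j * g j ^+ 2 <= B) ->
  (\sum_(j < n) g j * x ^+ j * expR (- (a * x))) ^+ 2 <= B * fock_kernel x.
Proof.
move=> hB; rewrite -mulr_suml exprMn.
have -> : expR (- (a * x)) ^+ 2 = expR (- (2 * a * x)).
  by rewrite expr2 -expRD; congr expR; ring.
rewrite /fock_kernel mulrA ler_wpM2r ?expR_ge0//.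
have M0 := fock_weight_gt0.
have := @sum_mulr_sqr_le _ n (fun j => Num.sqrt (M j) * g j)
   (fun j => x ^+ j / Num.sqrt (M j)).
rewrite [X in X ^+ 2 <= _](_ : _ = \sum_(j < n) g j * x ^+ j); last first.
  apply: eq_bigr => j _; field.
  by rewrite gt_eqF// sqrtr_gt0.
move=> /le_trans; apply; rewrite ler_pM//.
- by apply: sumr_ge0 => j _; exact: sqr_ge0.
- by apply: sumr_ge0 => j _; exact: sqr_ge0.
- by under eq_bigr do rewrite exprMn sqr_sqrtr ?(ltW (M0 _))//.
- under eq_bigr do rewrite expr_div_n sqr_sqrtr ?(ltW (M0 _))// -exprM mulnC.
  apply: bounded_sums_sum_le_lim (evaluation_bounded x) => j; apply: divr_ge0.
    by rewrite mulnC exprM sqr_ge0.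
  exact: ltW.
Qed.

Lemma exp_partial_cvg g x : fock g ->
  \sum_(j < n) g j * x ^+ j * expR (- (a * x)) @[n --> \oo] --> exp_series g x.
Proof.
move=> fg; rewrite /exp_series (_ : (fun n : nat => _) =
  (fun n => series (fun j => g j * x ^+ j) n * expR (- (a * x)))).
  by apply: cvgM; [exact: exp_series_cvg | exact: cvg_cst].
by apply/funext => n; rewrite -mulr_suml seriesEordf.
Qed.

Lemma measurable_exp_partial g n (D : set R) :
  measurable_fun D (fun x => \sum_(j < n) g j * x ^+ j * expR (- (a * x))).
Proof.
apply: measurable_sum => j; under eq_fun do rewrite -mulrA.
by apply: measurable_funM => //; exact: measurable_monomial_expR.
Qed.

Lemma measurable_exp_series g (D : set R) : measurable D -> fock g ->
  measurable_fun D (exp_series g).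
Proof.
move=> mD fg; apply: (@measurable_fun_cvg _ _ R D
  (fun n x => \sum_(j < n) g j * x ^+ j * expR (- (a * x)))).
- by move=> n; exact: measurable_exp_partial.
- by move=> x _; exact: exp_partial_cvg.
Qed.

Lemma exp_series_sqr_le g (B : R) x :
  (forall n : nat, \sum_(j < n) M j * g j ^+ 2 <= B) ->
  exp_series g x ^+ 2 <= B * fock_kernel x.
Proof.
move=> hB; have fg : fock g by exists B.
have h : (\sum_(j < n) g j * x ^+ j * expR (- (a * x))) ^+ 2 @[n --> \oo]
    --> exp_series g x ^+ 2.
  by apply: cvgM; exact: exp_partial_cvg.
rewrite -(cvg_lim _ h)//; apply: limr_le; first by apply/cvg_ex; eexists; exact: h.
by apply: nearW => n; exact: exp_partial_sqr_le.
Qed.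

Lemma wintegrable_exp_series_sqr g : fock g ->
  wintegrable (fun x => exp_series g x ^+ 2).
Proof.
move=> fg; have [B hB] := fg.
apply: (@le_wintegrable _ _ _ (fun x => B * fock_kernel x)).
- by apply: measurable_funX; exact: measurable_exp_series.
- by move=> x _; rewrite ger0_norm ?sqr_ge0//; exact: exp_series_sqr_le.
- exact/wintegrableZ/wintegrable_fock_kernel.
Qed.

(** Termwise integration against a square-integrable factor. The majorant comes from |s h| <= s^2 +
    h^2 and the kernel bound on s^2, uniform in the partial sum s. *)
Lemma wint_exp_series g (h : R -> R) : fock g -> measurable_fun Rp h ->
  wintegrable (fun x => h x ^+ 2) ->
  \sum_(j < n) g j * wint (fun x => x ^+ j * expR (- (a * x)) * h x) @[n --> \oo]
    --> wint (fun x => exp_series g x * h x).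
Proof.
move=> fg mh ih; have [B hB] := fg.
have a1 : -1 < 2 * a by have := rate_gt0; lra.
have im j : wintegrable (fun x => x ^+ j * expR (- (a * x)) * h x).
  apply: wintegrable_mul => //.
    exact: measurable_monomial_expR.
  have := wintegrable_monomial_expR hnu gamma0_fin (j * 2) a1.
  apply: eq_wintegrable => x _; rewrite exprMn -exprM; congr (_ * _).
  by rewrite expr2 -expRD; congr expR; ring.
pose f n x := (\sum_(j < n) g j * x ^+ j * expR (- (a * x))) * h x * W x.
have fE n : wint (fun x => (\sum_(j < n) g j * x ^+ j * expR (- (a * x))) * h x)
   = \sum_(j < n) g j * wint (fun x => x ^+ j * expR (- (a * x)) * h x).
  under [RHS]eq_bigr => j _ do rewrite -(wintZ (g j) (im j)).
  rewrite -(@wint_sum _ _ n (fun j x => g j * (x ^+ j * expR (- (a * x)) * h x))).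
    by apply: eq_wint => x _; rewrite mulr_suml; apply: eq_bigr => j _; ring.
  by move=> j; exact: wintegrableZ.
have := @dominated_convergence _ _ _ mu Rp (measurable_itv _)
  (fun n x => (f n x)%:E) (fun x => (exp_series g x * h x * W x)%:E)
  (fun x => ((B * fock_kernel x + h x ^+ 2) * W x)%:E).
case.
- move=> n; apply/measurable_EFinP; apply: measurable_funM; last first.
    exact: measurable_laguerre_weight.
  by apply: measurable_funM => //; exact: measurable_exp_partial.
- apply/measurable_EFinP; apply: measurable_funM; last first.
    exact: measurable_laguerre_weight.
  by apply: measurable_funM => //; exact: measurable_exp_series.
- apply: aeW => x _; apply: cvg_EFin; first exact: nearW.
  apply: cvgM; last exact: cvg_cst.
  by apply: cvgM; [exact: exp_partial_cvg | exact: cvg_cst].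
- apply: wintegrableD => //; exact/wintegrableZ/wintegrable_fock_kernel.
- apply: aeW => x n _; rewrite lee_fin normrM [`|W x|]ger0_norm ?laguerre_weight_ge0//.
  rewrite ler_wpM2r ?laguerre_weight_ge0// normrM.
  have := @exp_partial_sqr_le g B n x hB.
  set u := (\sum_(_ < _) _); rewrite -(real_normK (num_real u)) => hu.
  rewrite -(real_normK (num_real (h x))).
  have := sqr_ge0 (`|u| - `|h x|); have := sqr_ge0 (`|u|); have := sqr_ge0 (`|h x|).
  nra.
move=> iF _; rewrite (wint_EFin (f := fun x => exp_series g x * h x) iF).
move/fine_cvgP => [_ hc].
under eq_fun do rewrite -fE.
exact: hc.
Qed.

End ExpSeries.

Lemma quadratic_discriminant {R : realFieldType} (A B C : R) : 0 <= A ->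
  (forall t, 0 <= t ^+ 2 * A - 2 * t * C + B) -> C ^+ 2 <= A * B.
Proof.
rewrite le_eqVlt => /orP[/eqP <-|A0] h; last first.
  have := h (C / A); rewrite -(ler_pM2l A0) mulr0.
  have -> : A * ((C / A) ^+ 2 * A - 2 * (C / A) * C + B) = A * B - C ^+ 2.
    by field; rewrite gt_eqF.
  by rewrite subr_ge0.
have [->|C0] := eqVneq C 0; first by rewrite mul0r expr0n.
(* With A = 0 the expression is affine in t; this t makes it equal to -1, contradicting
   nonnegativity. *)
have := h ((B + 1) / (2 * C)).
rewrite mulr0 add0r (_ : 2 * _ * C = B + 1); last by field.
lra.
Qed.

Lemma cvg_sum_ord {R : realType} N (u : nat -> nat -> R) (b : nat -> R) :
  (forall n, u n k @[k --> \oo] --> b n) ->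
  \sum_(n < N) u n k @[k --> \oo] --> \sum_(n < N) b n.
Proof.
move=> h; elim: N => [|N IH].
  by under eq_fun do rewrite big_ord0; rewrite big_ord0; exact: cvg_cst.
under eq_fun do rewrite big_ord_recr/=; rewrite big_ord_recr/=.
exact: cvgD.
Qed.

(** * Orthogonality of the Taylor coefficients of [l_n e^{az}] *)

Section LaguerreSystem.
Context {R : realType}.
Variables nu theta : R.
Hypothesis hnu : -1 < nu.
Hypothesis htheta : 1 < theta.
Variable l : nat -> {poly R}.
Hypothesis hl : orthonormal_laguerre nu l.
Local Notation mu := (@lebesgue_measure R).
Local Notation W := (laguerre_weight nu).
Local Notation Rp := ([set` `]0%R, +oo[] : set R).
Local Notation wint := (wint nu).
Local Notation wintegrable := (wintegrable nu).
Local Notation gam := (gam nu).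
Local Notation a := (rate theta).
Local Notation M := (fock_weight nu theta).
Local Notation fock := (fock nu theta).
Local Notation exp_series := (exp_series theta).
Implicit Types (p r : {poly R}) (g : nat -> R).

(** [l 0] is a constant, so its normalisation reads l_0^2 Gamma(nu + 1) = 1. A product equal to 1
    forces the moment to be finite and positive. *)
Let l0_gamma : (((l 0)`_0 ^+ 2)%:E * gamma_moment nu 0 = 1%:E)%E.
Proof.
have [hs ho] := hl; have := ho 0 0; rewrite eqxx => <-.
rewrite /gamma_moment -ge0_integralZl//.
- apply: eq_integral => x _; rewrite -EFinM; congr (_%:E).
  by rewrite [l 0]size1_polyC ?hs// hornerC coefC/= expr0 mul1r expr2.
- apply/measurable_EFinP; apply: measurable_funM => //.
  exact: measurable_laguerre_weight.
- by move=> x _; rewrite lee_fin expr0 mul1r laguerre_weight_ge0.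
- by rewrite lee_fin sqr_ge0.
Qed.

Let l00 : 0 < (l 0)`_0 ^+ 2.
Proof.
rewrite lt_neqAle sqr_ge0 andbT; apply/eqP => h.
by have := l0_gamma; rewrite -h mul0e => /esym/eqP; rewrite eqe oner_eq0.
Qed.

Lemma gamma0_fin : gamma_moment nu 0 \is a fin_num.
Proof.
have := l0_gamma; have := gamma_moment_ge0 nu 0.
case: (gamma_moment nu 0) => //= _; rewrite gt0_muley ?lte_fin//.
Qed.

Lemma gamma0_gt0 : (0 < gamma_moment nu 0)%E.
Proof.
have := l0_gamma; have := gamma_moment_ge0 nu 0.
rewrite le_eqVlt => /orP[/eqP <-|//]; rewrite mule0 => /eqP.
by rewrite eqe eq_sym oner_eq0.
Qed.

Let a1 : -1 < a.
Proof. by apply: lt_trans (rate_gt0 htheta); rewrite ltrN10. Qed.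
Let tau0 : 0 < 1 + a.
Proof. by rewrite addr_gt0// rate_gt0. Qed.

Lemma wintegrable_poly p : wintegrable (horner p).
Proof. exact: wintegrable_horner gamma0_fin p. Qed.

Lemma wintegrable_polyM p r : wintegrable (fun x => p.[x] * r.[x]).
Proof.
apply: eq_wintegrable (wintegrable_poly (p * r)) => x _.
by rewrite hornerM.
Qed.

Lemma wintegrable_poly_sqr p : wintegrable (fun x => p.[x] ^+ 2).
Proof. exact: wintegrable_polyM. Qed.

Lemma measurable_horner p (D : set R) : measurable_fun D (horner p).
Proof. exact: measurable_poly. Qed.

Lemma wint_laguerre k m : wint (fun x => (l k).[x] * (l m).[x]) = (k == m)%:R.
Proof. by rewrite wintE /Rintegral; have [_ ->] := hl. Qed.

Definition tilted_moment (j : nat) (p : {poly R}) : R :=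
  wint (fun x => x ^+ j * expR (- (a * x)) * p.[x]).
Local Notation E := tilted_moment.

Let wintegrable_tilted j p :
  wintegrable (fun x => x ^+ j * expR (- (a * x)) * p.[x]).
Proof.
apply: eq_wintegrable (wintegrable_horner_expR hnu gamma0_fin ('X^j * p) a1).
by move=> x _; rewrite hornerM hornerXn; ring.
Qed.

Let tilted_momentD j p r : E j (p + r) = E j p + E j r.
Proof.
rewrite /E -wintD//; apply: eq_wint => x _.
by rewrite hornerD mulrDr.
Qed.

Let tilted_momentZ j c p : E j (c *: p) = c * E j p.
Proof. by rewrite /E -wintZ//; apply: eq_wint => x _; rewrite hornerZ; ring. Qed.

Let tilted_momentMX j p : E j (p * 'X) = E j.+1 p.
Proof. by apply: eq_wint => x _; rewrite hornerMX exprS; ring. Qed.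

Let tilted_momentB j p r : E j (p - r) = E j p - E j r.
Proof. by rewrite -scaleN1r tilted_momentD tilted_momentZ mulN1r. Qed.

Let tilted_moment1 j : E j 1 = wint (fun x => x ^+ j * expR (- (a * x))).
Proof. by apply: eq_wint => x _; rewrite hornerC mulr1. Qed.

Let tilted_momentX j : E j 'X = E j.+1 1.
Proof. by rewrite -tilted_momentMX mul1r. Qed.

(* [x d/dx] on the monomial [x^j], integrated by parts onto [p]. *)
Lemma tilted_moment_euler j p :
  E j ((1 + a) *: (p * 'X) - (nu + 1) *: p - p^`() * 'X) = j%:R * E j p.
Proof.
elim/poly_ind: p j => [|p c IH] j.
  rewrite mul0r deriv0 mul0r !scaler0 !subr0.
  by rewrite -(scale0r (0 : {poly R})) tilted_momentZ mul0r mulr0.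
have -> : (1 + a) *: ((p * 'X + c%:P) * 'X) - (nu + 1) *: (p * 'X + c%:P) -
    (p * 'X + c%:P)^`() * 'X =
  ((1 + a) *: (p * 'X) - (nu + 1) *: p - p^`() * 'X) * 'X - p * 'X +
  (((1 + a) * c) *: 'X - ((nu + 1) * c) *: 1).
  rewrite derivD derivM derivX derivC addr0 mulr1 -!mul_polyC !polyCM.
  by ring.
rewrite tilted_momentD tilted_momentB !tilted_momentMX IH tilted_momentB.
rewrite !tilted_momentZ tilted_momentX !tilted_moment1.
rewrite tilted_momentD -[c%:P]mulr1 mul_polyC tilted_momentZ tilted_moment1.
rewrite tilted_momentMX.
have := wint_monomial_expR_rec hnu gamma0_fin j a1.
set m0 := wint _; set m1 := wint _ => h.
rewrite -[j.+1%:R]natr1 in h *.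
rewrite (_ : (1 + a) * c * m0 = c * ((1 + a) * m0)); last by ring.
by rewrite h; ring.
Qed.

(* Chosen so that inserting [q_n] multiplies [int x^j e^{-ax} x^nu e^{-x} dx] by
   [j (j-1) ... (j-n+1) / a^n], which is the shape of [M_j] times the [j]-th
   Taylor coefficient of [z^n e^{az}]. *)
Fixpoint dual_poly (n : nat) : {poly R} :=
  if n is n'.+1 then
    let q := dual_poly n' in
    a^-1 *: ((1 + a) *: (q * 'X) - (nu + 1) *: q - q^`() * 'X - n'%:R *: q)
  else 1.
Local Notation q := dual_poly.

Lemma tilted_moment_dual j n :
  E j (q n) = a^-1 ^+ n * (j ^_ n)%:R * wint (fun x => x ^+ j * expR (- (a * x))).
Proof.
elim: n => [|n IH] /=; first by rewrite tilted_moment1 expr0 ffactn0 !mul1r.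
rewrite tilted_momentZ tilted_momentB tilted_moment_euler tilted_momentZ IH.
rewrite -mulrBl exprS ffactnSr natrM.
(* The recurrence produces the real number j - n while the falling factorial uses truncated
   subtraction; they disagree only for j < n, where the falling factorial already vanishes. *)
have [nj|jn] := leqP n j; first by rewrite natrB//; ring.
by rewrite ffact_small// !(mulr0, mul0r).
Qed.

(** Only the term with [q * 'X] raises the degree, since differentiating and multiplying by ['X]
    preserves it; its coefficient (1 + a) / a equals theta. *)
Lemma size_dual_poly n : (size (q n) <= n.+1)%N /\ (q n)`_n = theta ^+ n.
Proof.
elim: n => [|n [IHs IHc]]; first by rewrite /= size_poly1 coef1 expr0.
split=> /=.
  apply: leq_trans (size_scale_leq _ _) _.
  apply/leq_sizeP => -[//|i]; rewrite ltnS => ni.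
  rewrite !(coefZ, coefB, coefMX, coef_deriv)/=.
  have qi k : (n < k)%N -> (q n)`_k = 0 by move=> nk; rewrite nth_default// (leq_trans IHs).
  by rewrite !qi// ?mul0rn ?(mulr0, subr0)// ltnW.
rewrite !(coefZ, coefB, coefMX, coef_deriv)/=.
rewrite (nth_default _ IHs) IHc mul0rn !(mulr0, subr0) mulrA exprS; congr (_ * _).
by rewrite onerate// mulrCA mulVf ?mulr1// gt_eqF// rate_gt0.
Qed.

(* Taylor coefficients of [z^n e^{az}] *)
Definition exp_coef (n j : nat) : R :=
  if (n <= j)%N then a ^+ (j - n) / (j - n)`!%:R else 0.

(** The part of (1 + a)^{nu + j + 1} that does not depend on j; the remaining power is absorbed by
    [radius ^+ j]. *)
Let C : R := (1 + a) `^ (nu + 1).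
Let C_gt0 : 0 < C. Proof. exact: powR_gt0. Qed.

(** The bridge between the two sides: a weighted Taylor coefficient is an integral on the half line.
    The quotient j! / (j - n)! is the falling factorial produced by q_n, and [radius_rate] matches
    the powers of a and 1 + a. *)
Lemma fock_weight_exp_coef n j : M j * exp_coef n j = C * E j (q n).
Proof.
have a0 := rate_gt0 htheta; have an0 : a != 0 by rewrite gt_eqF.
rewrite tilted_moment_dual (wint_monomial_expR hnu gamma0_fin)//.
have -> : (1 + a) `^ (- (nu + j.+1%:R)) = C^-1 * (1 + a) ^- j.
  rewrite /C -powRN -powR_mulrn ?ltW// -powRN -powRD ?(gt_eqF tau0) ?implybT//.
  by congr (_ `^ _); rewrite -natr1; ring.
rewrite /exp_coef; case: leqP => [nj|jn]; last first.
  by rewrite ffact_small// !(mulr0, mul0r).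
rewrite /fock_weight -(ffact_fact nj) natrM.
have f0 : (j - n)`!%:R != 0 :> R by rewrite pnatr_eq0 -lt0n fact_gt0.
have -> : radius theta ^+ j = a ^- j * (1 + a) ^- j.
  rewrite -exprVn -[(1 + a) ^- _]exprVn -exprMn; congr (_ ^+ _).
  have := radius_rate htheta => /(congr1 (fun x => x / (a * (1 + a)))).
  rewrite -mulrA mulfK ?mulf_neq0 ?(gt_eqF tau0)// => ->.
  by rewrite mul1r invfM.
have -> : a ^+ (j - n) = a ^+ j / a ^+ n.
  by rewrite -{2}(subnK nj) exprD mulfK// expf_neq0.
rewrite exprVn; field.
by rewrite f0 !expf_neq0 ?(gt_eqF tau0) ?(gt_eqF C_gt0).
Qed.

Lemma wint_mulr_sqr_le (f g : R -> R) : measurable_fun Rp f ->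
  measurable_fun Rp g -> wintegrable (fun x => f x ^+ 2) ->
  wintegrable (fun x => g x ^+ 2) ->
  wint (fun x => f x * g x) ^+ 2 <=
  wint (fun x => f x ^+ 2) * wint (fun x => g x ^+ 2).
Proof.
move=> mf mg fi gi; have fgi := wintegrable_mul mf mg fi gi.
apply: quadratic_discriminant => [|t].
  by apply: wint_ge0 => x _; exact: sqr_ge0.
rewrite -wintZ// -wintZ// -wintB; [|exact: wintegrableZ..].
rewrite -wintD//; last by apply: wintegrableB; exact: wintegrableZ.
apply: wint_ge0 => x _.
rewrite (_ : _ + _ = (t * f x - g x) ^+ 2) ?sqr_ge0//; ring.
Qed.

Let wintegrable_monomial_sqr j :
  wintegrable (fun x => (x ^+ j * expR (- (a * x))) ^+ 2).
Proof.
have a2 : -1 < 2 * a by have := rate_gt0 htheta; lra.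
apply: eq_wintegrable (wintegrable_monomial_expR hnu gamma0_fin (2 * j) a2).
move=> x _; rewrite exprMn -exprM mulnC; congr (_ * _).
by rewrite expr2 -expRD; congr expR; ring.
Qed.

(** Through the bridge, M_j times the squared coefficient is C^2 E_j(q_n)^2 / M_j. Cauchy-Schwarz
    bounds it by the norm of q_n times the terms of [evaluation_norm_bounded]. *)
Lemma fock_exp_coef n : fock (exp_coef n).
Proof.
have M0 j : 0 < M j := fock_weight_gt0 hnu htheta gamma0_fin gamma0_gt0 j.
apply: (@bounded_sums_le _ _ (fun j => (C ^+ 2 * wint (fun x => (q n).[x] ^+ 2)) *
  (wint (fun x => x ^+ (2 * j) * expR (- (2 * a * x))) / M j))).
  move=> j.
  have -> : M j * exp_coef n j ^+ 2 = C ^+ 2 * E j (q n) ^+ 2 / M j.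
    rewrite -exprMn -fock_weight_exp_coef; field; exact: lt0r_neq0.
  rewrite mulrA ler_wpM2r ?invr_ge0 ?(ltW (M0 j))// -mulrA.
  rewrite ler_wpM2l ?sqr_ge0// mulrC.
  have -> : wint (fun x => x ^+ (2 * j) * expR (- (2 * a * x))) =
      wint (fun x => (x ^+ j * expR (- (a * x))) ^+ 2).
    apply: eq_wint => x _; rewrite exprMn -exprM mulnC; congr (_ * _).
    by rewrite expr2 -expRD; congr expR; ring.
  apply: wint_mulr_sqr_le => //.
  - exact: measurable_monomial_expR.
  - exact: measurable_horner.
  - exact: wintegrable_poly_sqr.
apply: bounded_sumsZ.
  by rewrite mulr_ge0 ?sqr_ge0//; apply: wint_ge0 => x _; exact: sqr_ge0.
exact: (evaluation_norm_bounded hnu htheta gamma0_fin gamma0_gt0).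
Qed.

Lemma exp_series_exp_coef n x : exp_series (exp_coef n) x = x ^+ n.
Proof.
rewrite exp_seriesE.
have h : series (fun j => exp_coef n j * x ^+ j) k @[k --> \oo]
    --> x ^+ n * expR (a * x).
  rewrite -(cvg_shiftn n) (_ : (fun k : nat => _) = (fun k => x ^+ n * series (exp_coeff (a * x)) k)).
    apply: cvgM; first exact: cvg_cst.
    exact: is_cvg_series_exp_coeff.
  apply/funext => k; rewrite !seriesEordf addnC big_split_ord/= big1 ?add0r; last first.
    by move=> i _; rewrite /exp_coef leqNgt ltn_ord mul0r.
  rewrite mulr_sumr; apply: eq_bigr => i _.
  rewrite /exp_coef leq_addr addKn exprD /exp_coeff/= exprMn; ring.
rewrite (cvg_lim _ h)// -mulrA -expRD addrN expR0 mulr1//.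
Qed.

Lemma exp_seriesD g h x : fock g -> fock h ->
  exp_series (fun j => g j + h j) x = exp_series g x + exp_series h x.
Proof.
move=> fg fh; have fgh := fockD hnu htheta gamma0_fin gamma0_gt0 fg fh.
have cvgp k (fk : fock k) :=
  @exp_partial_cvg _ _ _ hnu htheta gamma0_fin gamma0_gt0 k x fk.
rewrite -(cvg_lim _ (cvgp _ fgh))//; apply: cvg_lim => //.
rewrite (_ : (fun n : nat => _) = (fun n => \sum_(j < n) g j * x ^+ j * expR (- (a * x)) +
   \sum_(j < n) h j * x ^+ j * expR (- (a * x)))).
  by apply: cvgD; exact: cvgp.
apply/funext => n; rewrite -big_split; apply: eq_bigr => j _ /=; ring.
Qed.

Lemma exp_seriesZ c g x : fock g ->
  exp_series (fun j => c * g j) x = c * exp_series g x.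
Proof.
move=> fg; have fcg := fockZ c fg.
have cvgp k (fk : fock k) :=
  @exp_partial_cvg _ _ _ hnu htheta gamma0_fin gamma0_gt0 k x fk.
rewrite -(cvg_lim _ (cvgp _ fcg))//; apply: cvg_lim => //.
rewrite (_ : (fun n : nat => _) =
   (fun n => c * \sum_(j < n) g j * x ^+ j * expR (- (a * x)))).
  by apply: cvgM; [exact: cvg_cst | exact: cvgp].
apply/funext => n; rewrite mulr_sumr; apply: eq_bigr => j _ /=; ring.
Qed.

Lemma exp_series_sum n (c : nat -> R) (g : nat -> nat -> R) x :
  (forall i, fock (g i)) ->
  exp_series (fun j => \sum_(i < n) c i * g i j) x =
  \sum_(i < n) c i * exp_series (g i) x.
Proof.
move=> fg; elim: n => [|n IH].
  rewrite big_ord0 exp_seriesE (_ : (fun j => _) = (fun=> 0)).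
    rewrite (_ : series _ = fun=> 0) ?lim_cst ?mul0r//.
    by apply/funext => k; rewrite seriesEordf big1.
  by apply/funext => j; rewrite big_ord0 mul0r.
rewrite big_ord_recr/= -IH -exp_seriesZ// -exp_seriesD//.
- by congr (exp_series _ x); apply/funext => j; rewrite big_ord_recr.
- exact: (fock_sum hnu htheta gamma0_fin gamma0_gt0).
- exact: fockZ.
Qed.

(** Taylor coefficients at 0 of p(z) e^{az}. *)
Definition taylor (p : {poly R}) (j : nat) : R :=
  \sum_(i < size p) p`_i * exp_coef i j.

Definition dual_map (p : {poly R}) : {poly R} :=
  \sum_(i < size p) p`_i *: q i.

Lemma fock_taylor p : fock (taylor p).
Proof. apply: (fock_sum hnu htheta gamma0_fin gamma0_gt0) => i.
exact: fock_exp_coef. Qed.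

Lemma exp_series_taylor p x : exp_series (taylor p) x = p.[x].
Proof.
rewrite exp_series_sum; last exact: fock_exp_coef.
by rewrite horner_coef; apply: eq_bigr => i _; rewrite exp_series_exp_coef.
Qed.

Lemma fock_weight_taylor p j : M j * taylor p j = C * E j (dual_map p).
Proof.
have -> : E j (dual_map p) = \sum_(i < size p) p`_i * E j (q i).
  rewrite /dual_map; elim: (size p) => [|n IH].
    by rewrite !big_ord0 -(scale0r (0 : {poly R})) tilted_momentZ mul0r.
  by rewrite !big_ord_recr/= tilted_momentD tilted_momentZ IH.
rewrite /taylor !mulr_sumr; apply: eq_bigr => i _.
by rewrite mulrCA fock_weight_exp_coef mulrCA.
Qed.

Lemma taylor_pairing g p : fock g ->
  \sum_(j < n) M j * g j * taylor p j @[n --> \oo] -->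
  C * wint (fun x => exp_series g x * (dual_map p).[x]).
Proof.
move=> fg.
have h := wint_exp_series hnu htheta gamma0_fin gamma0_gt0 fg
  (@measurable_horner (dual_map p) Rp) (wintegrable_poly_sqr (dual_map p)).
rewrite (_ : (fun n : nat => _) = (fun n => C * \sum_(j < n) g j * E j (dual_map p))).
  by apply: cvgM; [exact: cvg_cst | exact: h].
apply/funext => n; rewrite mulr_sumr; apply: eq_bigr => j _.
by rewrite mulrAC fock_weight_taylor; ring.
Qed.

(** Up to the factor [C], both sides are the limit of the sums of M_j [taylor p j] [taylor r j], an
    expression symmetric in [p] and [r]. *)
Lemma dual_map_symmetric p r :
  wint (fun x => p.[x] * (dual_map r).[x]) =
  wint (fun x => (dual_map p).[x] * r.[x]).
Proof.
have hp := @taylor_pairing _ r (fock_taylor p).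
have hr := @taylor_pairing _ p (fock_taylor r).
apply: (mulfI (lt0r_neq0 C_gt0)).
transitivity (C * wint (fun x => exp_series (taylor p) x * (dual_map r).[x])).
  by congr (_ * _); apply: eq_wint => x _; rewrite exp_series_taylor.
transitivity (C * wint (fun x => exp_series (taylor r) x * (dual_map p).[x])).
  rewrite -(cvg_lim _ hp)//; apply: cvg_lim => //.
  rewrite (_ : (fun n : nat => _) = (fun n : nat => \sum_(j < n) M j * taylor r j * taylor p j)).
    exact: hr.
  by apply/funext => n; apply: eq_bigr => j _; rewrite mulrAC.
by congr (_ * _); apply: eq_wint => x _; rewrite exp_series_taylor mulrC.
Qed.

Lemma size_dual_map p : (size (dual_map p) <= size p)%N.
Proof.
apply: leq_trans (size_sum _ _ _) _; apply/bigmax_leqP => i _.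
apply: leq_trans (size_scale_leq _ _) _.
by apply: leq_trans (proj1 (size_dual_poly i)) _; exact: ltn_ord.
Qed.

Lemma coef_dual_map p n : size p = n.+1 ->
  (dual_map p)`_n = theta ^+ n * p`_n.
Proof.
move=> sp; rewrite /dual_map sp big_ord_recr/= coefD coefZ.
rewrite (proj2 (size_dual_poly n)) nth_default ?add0r 1?mulrC//.
apply: leq_trans (size_sum _ _ _) _; apply/bigmax_leqP => i _.
apply: leq_trans (size_scale_leq _ _) _.
by apply: leq_trans (proj1 (size_dual_poly i)) _; exact: ltn_ord.
Qed.

Lemma laguerre_basis n p : (size p <= n)%N ->
  exists c : nat -> R, p = \sum_(k < n) c k *: l k.
Proof.
have [hs _] := hl.
elim: n p => [|n IH] p sp.
  by exists (fun=> 0); rewrite big_ord0; apply/eqP; rewrite -size_poly_leq0.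
pose b := p`_n / (l n)`_n.
have ln0 : (l n)`_n != 0.
  have : lead_coef (l n) != 0 by rewrite lead_coef_eq0 -size_poly_eq0 hs.
  by rewrite lead_coefE hs.
have [c hc] : exists c : nat -> R, p - b *: l n = \sum_(k < n) c k *: l k.
  apply: IH; apply/leq_sizeP => i; rewrite leq_eqVlt => /orP[/eqP <-|ni].
    by rewrite coefB coefZ /b divfK// subrr.
  by rewrite coefB coefZ !nth_default ?mulr0 ?subr0// ?hs// (leq_trans sp).
exists (fun k => if k == n then b else c k).
rewrite big_ord_recr/= eqxx -[LHS](subrK (b *: l n)) hc; congr (_ + _).
by apply: eq_bigr => k _; rewrite ltn_eqF.
Qed.

Let wint_sum_laguerre n (c : nat -> R) k :
  wint (fun x => (\sum_(i < n) c i *: l i).[x] * (l k).[x]) =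
  if (k < n)%N then c k else 0.
Proof.
have -> : wint (fun x => (\sum_(i < n) c i *: l i).[x] * (l k).[x]) =
    \sum_(i < n) c i * (i == k :> nat)%:R.
  under [RHS]eq_bigr => i _.
    rewrite -wint_laguerre -wintZ; last exact: wintegrable_polyM.
    over.
  rewrite -(@wint_sum _ nu n (fun i x => c i * ((l i).[x] * (l k).[x]))).
    apply: eq_wint => x _; rewrite horner_sum mulr_suml.
    by apply: eq_bigr => i _; rewrite hornerZ mulrA.
  by move=> i; apply: wintegrableZ; exact: wintegrable_polyM.
case: ltnP => kn.
  rewrite (bigD1 (Ordinal kn))//= eqxx mulr1 big1 ?addr0// => i ik.
  rewrite (_ : (i == k :> nat) = false) ?mulr0//.
  by apply: contra_neqF ik => /eqP ik; exact: val_inj.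
rewrite big1// => i _; rewrite (_ : (i == k :> nat) = false) ?mulr0//.
by rewrite ltn_eqF// (leq_trans (ltn_ord i)).
Qed.

Lemma laguerre_orthogonal n p : (size p <= n)%N ->
  wint (fun x => p.[x] * (l n).[x]) = 0.
Proof.
by move=> /laguerre_basis[c ->]; rewrite wint_sum_laguerre ltnn.
Qed.

(** Leading coefficients agree, so the difference is a combination of the [l k] with k < n. By
    symmetry its k-th coefficient is the pairing of [dual_map (l k)], of degree at most k, with
    [l n], hence zero. *)
Lemma dual_map_laguerre n : dual_map (l n) = theta ^+ n *: l n.
Proof.
have [hs _] := hl; apply/eqP; rewrite -subr_eq0; apply/eqP.
set d := _ - _.
have sd : (size d <= n)%N.
  apply/leq_sizeP => i; rewrite leq_eqVlt /d coefB coefZ => /orP[/eqP <-|ni].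
    by rewrite coef_dual_map// subrr.
  rewrite !nth_default ?mulr0 ?subrr// ?hs//.
  by apply: leq_trans (size_dual_map _) _; rewrite hs.
have [c hc] := laguerre_basis sd.
have c0 k : (k < n)%N -> c k = 0.
  move=> kn; have := wint_sum_laguerre n c k; rewrite kn -hc => <-.
  transitivity (wint (fun x => (dual_map (l n)).[x] * (l k).[x]) -
      theta ^+ n * wint (fun x => (l n).[x] * (l k).[x])).
    rewrite -wintZ; last exact: wintegrable_polyM.
    rewrite -wintB; first by apply: eq_wint => x _; rewrite hornerD hornerN hornerZ; ring.
      exact: wintegrable_polyM.
    by apply: wintegrableZ; exact: wintegrable_polyM.
  rewrite wint_laguerre gtn_eqF// mulr0 subr0 -dual_map_symmetric.
  rewrite -[RHS](@laguerre_orthogonal n (dual_map (l k))).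
    by apply: eq_wint => x _; rewrite mulrC.
  by apply: leq_trans (size_dual_map _) _; rewrite hs.
by rewrite hc big1// => k _; rewrite c0// scale0r.
Qed.

Lemma laguerre_pairing g n : fock g ->
  \sum_(j < N) M j * g j * taylor (l n) j @[N --> \oo] -->
  C * (theta ^+ n * wint (fun x => exp_series g x * (l n).[x])).
Proof.
move=> fg; have := @taylor_pairing _ (l n) fg; rewrite dual_map_laguerre.
rewrite -[in X in _ -> _ --> C * X]wintZ.
  rewrite [X in C * X](_ : _ = wint (fun x => theta ^+ n * (exp_series g x * (l n).[x])))//.
  by apply: eq_wint => x _; rewrite hornerZ; ring.
apply: wintegrable_mul.
- exact: (measurable_exp_series hnu htheta gamma0_fin gamma0_gt0).
- exact: measurable_horner.
- exact: (wintegrable_exp_series_sqr hnu htheta gamma0_fin gamma0_gt0).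
- exact: wintegrable_poly_sqr.
Qed.

Lemma taylor_orthogonal m n :
  \sum_(j < N) M j * taylor (l m) j * taylor (l n) j @[N --> \oo] -->
  C * (theta ^+ n * (m == n)%:R).
Proof.
have := @laguerre_pairing _ n (fock_taylor (l m)).
rewrite (_ : wint _ = (m == n)%:R)// -wint_laguerre.
by apply: eq_wint => x _; rewrite exp_series_taylor.
Qed.

Local Notation v n := (taylor (l n)).

Let M_ge0 j (c : R) : 0 <= M j * c ^+ 2.
Proof.
by rewrite mulr_ge0 ?sqr_ge0// ltW//; exact: (fock_weight_gt0 hnu htheta gamma0_fin gamma0_gt0).
Qed.

Let combination_cvg N (c : nat -> R) :
  \sum_(j < J) M j * (\sum_(n < N) c n * v n j) ^+ 2 @[J --> \oo] -->
  C * \sum_(n < N) theta ^+ n * c n ^+ 2.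
Proof.
have -> : C * \sum_(n < N) theta ^+ n * c n ^+ 2 =
    \sum_(n < N) \sum_(m < N) c n * c m * (C * (theta ^+ m * (n == m :> nat)%:R)).
  rewrite mulr_sumr; apply: eq_bigr => n _.
  rewrite (bigD1 n)//= eqxx big1 ?addr0/=; first by rewrite mulr1; ring.
  move=> m mn; rewrite (_ : (n == m :> nat) = false) ?mulr0 ?mulr0//.
  by apply: contra_neqF mn => /eqP mn; exact/esym/val_inj.
rewrite (_ : (fun J : nat => _) = (fun J : nat => \sum_(n < N) \sum_(m < N)
    c n * c m * \sum_(j < J) M j * v n j * v m j)); last first.
  apply/funext => J.
  under eq_bigr => j _.
    rewrite expr2 mulr_suml mulr_sumr.
    under eq_bigr do rewrite mulr_sumr mulr_sumr.
    over.
  rewrite exchange_big/=; apply: eq_bigr => n _.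
  rewrite exchange_big/=; apply: eq_bigr => m _.
  by rewrite mulr_sumr; apply: eq_bigr => j _; ring.
apply: (@cvg_sum_ord _ N (fun n J => \sum_(m < N) c n * c m *
  \sum_(j < J) M j * v n j * v m j) (fun n => \sum_(m < N) c n * c m *
  (C * (theta ^+ m * (n == m :> nat)%:R)))) => n.
apply: (@cvg_sum_ord _ N (fun m J => c n * c m *
  \sum_(j < J) M j * v n j * v m j)
  (fun m => c n * c m * (C * (theta ^+ m * (n == m :> nat)%:R)))) => m.
by apply: cvgM; [exact: cvg_cst | exact: taylor_orthogonal].
Qed.

(** Orthogonality gives the right side as the limit in J; the truncated sums increase to it because
    their terms are nonnegative. *)
Lemma combination_le N (c : nat -> R) J :
  \sum_(j < J) M j * (\sum_(n < N) c n * v n j) ^+ 2 <=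
  C * \sum_(n < N) theta ^+ n * c n ^+ 2.
Proof.
have h := @combination_cvg N c.
rewrite -(cvg_lim _ h)//.
pose u j := M j * (\sum_(n < N) c n * v n j) ^+ 2.
have hu : series u k @[k --> \oo] --> C * \sum_(n < N) theta ^+ n * c n ^+ 2.
  by rewrite (_ : (fun k : nat => _) = (fun J : nat => \sum_(j < J) u j))//;
    apply/funext => k; rewrite seriesEordf.
rewrite (cvg_lim _ h)// -(cvg_lim _ hu)// -(seriesEordf u).
apply: nondecreasing_cvgn_le; last by apply/cvg_ex; eexists; exact: hu.
by apply: nondecreasing_series => k _ _; exact: M_ge0.
Qed.

(** Bessel's inequality for the vectors v_n: the pairing of g with v_n is C theta^n c_n and the
    squared norm of v_n is C theta^n, so the c_n are the projection coefficients. The nonnegative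
    square is expanded at a finite truncation J, then J tends to infinity. *)
Lemma laguerre_bessel g (B : R) N :
  (forall n : nat, \sum_(j < n) M j * g j ^+ 2 <= B) ->
  C * \sum_(n < N) theta ^+ n * wint (fun x => exp_series g x * (l n).[x]) ^+ 2 <= B.
Proof.
move=> hB; have fg : fock g by exists B.
pose c n := wint (fun x => exp_series g x * (l n).[x]).
rewrite -subr_ge0.
have h J : 0 <= B - 2 * (\sum_(n < N) c n * \sum_(j < J) M j * g j * v n j)
    + \sum_(j < J) M j * (\sum_(n < N) c n * v n j) ^+ 2.
  have : 0 <= \sum_(j < J) M j * (g j - \sum_(n < N) c n * v n j) ^+ 2.
    by apply: sumr_ge0 => j _; exact: M_ge0.
  move=> /le_trans; apply; rewrite -subr_ge0.
  have -> : \sum_(n < N) c n * \sum_(j < J) M j * g j * v n j =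
      \sum_(j < J) M j * g j * \sum_(n < N) c n * v n j.
    under eq_bigr do rewrite mulr_sumr.
    rewrite exchange_big/=; apply: eq_bigr => j _.
    by rewrite mulr_sumr; apply: eq_bigr => n _; ring.
  rewrite (_ : _ - _ = B - \sum_(j < J) M j * g j ^+ 2) ?subr_ge0//.
  have -> : \sum_(j < J) M j * (g j - \sum_(n < N) c n * v n j) ^+ 2 =
      \sum_(j < J) M j * g j ^+ 2 -
      2 * (\sum_(j < J) M j * g j * \sum_(n < N) c n * v n j) +
      \sum_(j < J) M j * (\sum_(n < N) c n * v n j) ^+ 2.
    rewrite mulr_sumr -sumrB -big_split/=; apply: eq_bigr => j _.
    by ring.
  by ring.
have hc : (B - 2 * (\sum_(n < N) c n * \sum_(j < J) M j * g j * v n j)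
    + \sum_(j < J) M j * (\sum_(n < N) c n * v n j) ^+ 2) @[J --> \oo] -->
  B - 2 * (\sum_(n < N) c n * (C * (theta ^+ n * c n))) + C * \sum_(n < N) theta ^+ n * c n ^+ 2.
  apply: cvgD; last exact: combination_cvg.
  apply: cvgB; first exact: cvg_cst.
  apply: cvgM; first exact: cvg_cst.
  apply: (@cvg_sum_ord _ N (fun n J => c n * \sum_(j < J) M j * g j * v n j)
    (fun n => c n * (C * (theta ^+ n * c n)))) => n.
  apply: cvgM; first exact: cvg_cst.
  exact: laguerre_pairing.
have : 0 <= B - 2 * (\sum_(n < N) c n * (C * (theta ^+ n * c n))) +
    C * \sum_(n < N) theta ^+ n * c n ^+ 2.
  rewrite -(cvg_lim _ hc)//; apply: limr_ge; last exact: nearW.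
  by apply/cvg_ex; eexists; exact: hc.
rewrite (_ : \sum_(n < N) c n * (C * (theta ^+ n * c n)) = C * \sum_(n < N) theta ^+ n * c n ^+ 2).
  by rewrite -/c; set S := C * _; rewrite (_ : B - _ + _ = B - S)//; ring.
by rewrite mulr_sumr; apply: eq_bigr => n _; ring.
Qed.

Let theta_ge0 n (c : R) : 0 <= theta ^+ n * c ^+ 2.
Proof. by rewrite mulr_ge0 ?sqr_ge0// exprn_ge0// ltW// theta_gt0. Qed.

(* The signs of the [v n j] are absorbed into the coefficients, so the bound for
   finite combinations gives absolute convergence of each coordinate. *)
Lemma synthesis_cvg (f : nat -> R) j :
  bounded_sums (fun n => theta ^+ n * f n ^+ 2) ->
  cvgn (series (fun n => f n * v n j)).
Proof.
move=> [B hB]; pose c n := f n * Num.sg (f n * v n j).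
have M0 : 0 < M j := fock_weight_gt0 hnu htheta gamma0_fin gamma0_gt0 j.
have hc n : c n * v n j = `|f n * v n j| by rewrite /c mulrAC normrEsg mulrC.
apply: (@bounded_sums_normr_cvg _ _ (fun n => c n * v n j)) => [n|].
  by rewrite hc.
exists (C * B / M j + 1) => N.
have := @combination_le N c j.+1; rewrite big_ord_recr/= => h.
have {}h : M j * (\sum_(n < N) c n * v n j) ^+ 2 <= C * B.
  apply: le_trans (le_trans h _).
    by rewrite lerDr; apply: sumr_ge0 => i _; exact: M_ge0.
  rewrite ler_pM2l//; apply: le_trans (hB N); apply: ler_sum => n _.
  rewrite ler_wpM2l ?exprn_ge0 ?(ltW (theta_gt0 htheta))//.
  rewrite exprMn ler_piMr ?sqr_ge0// sqr_sg.
  by case: (_ != 0).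
set S := \sum_(n < N) _ in h *.
have : S ^+ 2 <= C * B / M j by rewrite ler_pdivlMr// mulrC.
by have := sqr_ge0 (S - 1); nra.
Qed.

(** The sum of the f_n v_n taken coordinate by coordinate, intended as the Taylor coefficients of
    F(z) e^{az} when the f_n are the Laguerre coefficients of F on the half line. *)
Definition synthesis (f : nat -> R) (j : nat) : R :=
  limn (series (fun n => f n * v n j)).

(** Apply the bound for finite combinations to the coefficients with P <= n < N and let N tend to
    infinity, with J fixed so that only finitely many coordinates are involved. *)
Let synthesis_tail (f : nat -> R) (P J : nat) :
  bounded_sums (fun n => theta ^+ n * f n ^+ 2) ->
  \sum_(j < J) M j * (synthesis f j + (-1) * \sum_(n < P) f n * v n j) ^+ 2 <=
  C * (limn (series (fun n => theta ^+ n * f n ^+ 2)) -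
       \sum_(n < P) theta ^+ n * f n ^+ 2).
Proof.
move=> bf.
have hlim : \sum_(j < J) M j * (\sum_(n < N) f n * v n j + (-1) * \sum_(n < P) f n * v n j) ^+ 2
    @[N --> \oo] -->
    \sum_(j < J) M j * (synthesis f j + (-1) * \sum_(n < P) f n * v n j) ^+ 2.
  apply: (@cvg_sum_ord _ J (fun j N => M j *
    (\sum_(n < N) f n * v n j + (-1) * \sum_(n < P) f n * v n j) ^+ 2)
    (fun j => M j * (synthesis f j + (-1) * \sum_(n < P) f n * v n j) ^+ 2)) => j.
  apply: cvgM; first exact: cvg_cst.
  have h : \sum_(n < N) f n * v n j + (-1) * \sum_(n < P) f n * v n j @[N --> \oo] -->
      synthesis f j + (-1) * \sum_(n < P) f n * v n j.
    apply: cvgD; last exact: cvg_cst.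
    have := @synthesis_cvg f j bf; rewrite /synthesis.
    by under [X in _ -> X @ _ --> _]eq_fun do rewrite -(seriesEordf (fun n => f n * v n j)).
  by apply: cvgM; exact: h.
rewrite -(cvg_lim _ hlim)//; apply: limr_le; first by apply/cvg_ex; eexists; exact: hlim.
near=> N.
have PN : (P <= N)%N by near: N; exact: nbhs_infty_ge.
(* Zeroing the first P coefficients expresses a difference of two partial sums as one finite
   combination. *)
pose c n := if (n < P)%N then 0 else f n.
have cE (u : nat -> R -> R) : (forall n, u n 0 = 0) ->
    \sum_(n < N) u n (c n) = \sum_(n < N) u n (f n) - \sum_(n < P) u n (f n).
  move=> u0; rewrite -(big_mkord xpredT (fun n => u n (c n))) -!(big_mkord xpredT (fun n => u n (f n))).
  rewrite [in RHS](big_cat_nat (leq0n P) PN)/= addrAC subrr add0r.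
  rewrite (big_cat_nat (leq0n P) PN)/= big_nat big1 ?add0r; last first.
    by move=> i /andP[_ iP]; rewrite /c iP.
  rewrite big_nat [RHS]big_nat; apply: eq_bigr => i /andP[Pi _].
  by rewrite /c ltnNge Pi.
under eq_bigr => j _.
  rewrite mulN1r -(cE (fun n y => y * v n j)); last by move=> n; rewrite mul0r.
  over.
apply: le_trans (combination_le _ _ _) _.
rewrite ler_pM2l// (cE (fun n y => theta ^+ n * y ^+ 2)); last first.
  by move=> n; rewrite expr0n mulr0.
by rewrite lerD2r; apply: bounded_sums_sum_le_lim.
Unshelve. all: end_near. Qed.

Lemma fock_synthesis (f : nat -> R) :
  bounded_sums (fun n => theta ^+ n * f n ^+ 2) -> fock (synthesis f).
Proof.
move=> bf; exists (C * limn (series (fun n => theta ^+ n * f n ^+ 2))) => J.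
have := @synthesis_tail f 0 J bf; rewrite !big_ord0 subr0.
by under eq_bigr do rewrite big_ord0 mulr0 addr0.
Qed.

(** Subtracting the P-th partial sum changes the n-th coefficient to w - f_n once n < P. Bessel's
    inequality bounds theta^n (w - f_n)^2 by the tail beyond P, which tends to 0. *)
Lemma wint_synthesis (f : nat -> R) n :
  bounded_sums (fun n => theta ^+ n * f n ^+ 2) ->
  wint (fun x => exp_series (synthesis f) x * (l n).[x]) = f n.
Proof.
move=> bf; have fs := fock_synthesis bf.
set w := wint _.
have hP P : (n < P)%N -> theta ^+ n * (w - f n) ^+ 2 <=
    limn (series (fun n => theta ^+ n * f n ^+ 2)) - \sum_(n < P) theta ^+ n * f n ^+ 2.
  move=> nP; pose g j := synthesis f j + (-1) * \sum_(n < P) f n * v n j.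
  have fp : fock (fun j => \sum_(n < P) f n * v n j).
    apply: (@fock_sum _ _ _ hnu htheta gamma0_fin gamma0_gt0 P f
      (fun i => taylor (l i))) => i; exact: fock_taylor.
  have fp1 := fockZ (-1) fp.
  have gE : wint (fun x => exp_series g x * (l n).[x]) = w - f n.
    rewrite /g; transitivity (wint (fun x => exp_series (synthesis f) x * (l n).[x] -
        (\sum_(i < P) f i *: l i).[x] * (l n).[x])).
      apply: eq_wint => x _; rewrite exp_seriesD// exp_seriesZ//.
      rewrite (@exp_series_sum P f (fun i => taylor (l i))); last first.
        by move=> i; exact: fock_taylor.
      rewrite horner_sum; under eq_bigr do rewrite exp_series_taylor.
      by under [X in _ - X * _]eq_bigr do rewrite hornerZ; ring.
    rewrite wintB.
    - by rewrite wint_sum_laguerre nP.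
    - apply: wintegrable_mul.
      + exact: (measurable_exp_series hnu htheta gamma0_fin gamma0_gt0).
      + exact: measurable_horner.
      + exact: (wintegrable_exp_series_sqr hnu htheta gamma0_fin gamma0_gt0).
      + exact: wintegrable_poly_sqr.
    - exact: wintegrable_polyM.
  have := @laguerre_bessel g _ n.+1 (fun J => @synthesis_tail f P J bf).
  rewrite ler_pM2l//; apply: le_trans; rewrite big_ord_recr/= gE lerDr.
  by apply: sumr_ge0 => i _; exact: theta_ge0.
apply/eqP; rewrite -subr_eq0 -sqrf_eq0.
have t0 : 0 < theta ^+ n by rewrite exprn_gt0// theta_gt0.
rewrite -(mulrI_eq0 _ (lregP (lt0r_neq0 t0))) eq_le theta_ge0 andbT.
have cv := bounded_sums_cvg (fun n => theta_ge0 n (f n)) bf.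
have hlim : limn (series (fun n => theta ^+ n * f n ^+ 2)) -
    \sum_(n < P) theta ^+ n * f n ^+ 2 @[P --> \oo] --> (0 : R).
  rewrite -[X in _ --> X](subrr (limn (series (fun n => theta ^+ n * f n ^+ 2)))).
  apply: cvgB; first exact: cvg_cst.
  by under eq_fun do rewrite -(seriesEordf (fun n => theta ^+ n * f n ^+ 2)).
rewrite -(cvg_lim _ hlim)//; apply: limr_ge; first by apply/cvg_ex; eexists; exact: hlim.
by near=> P; apply: hP; near: P; exact: nbhs_infty_gt.
Unshelve. all: end_near. Qed.

End LaguerreSystem.

(** * Completeness of the Laguerre polynomials *)

Lemma bernoulli_inequality {R : realDomainType} (x : R) n : -1 <= x ->
  1 + n%:R * x <= (1 + x) ^+ n.
Proof.
move=> x1; elim: n => [|n IH]; first by rewrite mul0r addr0 expr0.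
have x0 : 0 <= 1 + x by rewrite -lerBlDl sub0r.
rewrite exprS; apply: le_trans (ler_wpM2l x0 IH).
have := mulr_ge0 (ler0n R n) (sqr_ge0 x); rewrite -natr1; lra.
Qed.

(* [(1 - u^n)^(2^n)] tends to the indicator of [u < 1/2] on [[0, 1]]; taking
   [u = e^{-sx}], it produces indicators of half lines from exponentials. *)
Lemma step_approx_bounds {R : realFieldType} (u : R) n : 0 <= u <= 1 ->
  0 <= (1 - u ^+ n) ^+ (2 ^ n) <= 1.
Proof.
move=> /andP[u0 u1]; have v0 : 0 <= u ^+ n by rewrite exprn_ge0.
have v1 : u ^+ n <= 1 by rewrite exprn_ile1.
by rewrite exprn_ge0 ?subr_ge0// exprn_ile1// ?subr_ge0// gerBl.
Qed.

(** Bernoulli's inequality gives the lower bound 1 - (2u)^n, which tends to 1. *)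
Lemma step_approx_lt {R : realType} (u : R) : 0 <= u < 1 / 2 ->
  (1 - u ^+ n) ^+ (2 ^ n) @[n --> \oo] --> (1 : R).
Proof.
move=> /andP[u0 u2]; have u1 : u <= 1 by lra.
apply: (@squeeze_cvgr _ _ _ _ (fun n => 1 - (2 * u) ^+ n) (cst 1)); last exact: cvg_cst.
  apply: nearW => n; have /andP[_ ->] := @step_approx_bounds R u n (introT andP (conj u0 u1)).
  rewrite andbT; have := @bernoulli_inequality R (- u ^+ n) (2 ^ n).
  rewrite lerN2 exprn_ile1// => /(_ isT); apply: le_trans.
  by rewrite mulrN natrX exprMn.
rewrite -[X in _ --> X]subr0; apply: cvgB; first exact: cvg_cst.
by apply: cvg_expr; rewrite ger0_norm; lra.
Qed.

(** With v = u^n, the product of (1 - v)^{2^n} and (1 + v)^{2^n} is at most 1, while Bernoulli makes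
    the second factor at least (2u)^n. *)
Lemma step_approx_gt {R : realType} (u : R) : 1 / 2 < u <= 1 ->
  (1 - u ^+ n) ^+ (2 ^ n) @[n --> \oo] --> (0 : R).
Proof.
move=> /andP[u2 u1]; have u0 : 0 < u by lra.
apply: (@squeeze_cvgr _ _ _ _ (cst 0) (fun n => (2 * u)^-1 ^+ n)); first last.
- apply: cvg_expr; rewrite ger0_norm ?invr_ge0; last by lra.
  by rewrite invf_lt1; lra.
- exact: cvg_cst.
apply: nearW => n; have /andP[-> _] := @step_approx_bounds R u n (introT andP (conj (ltW u0) u1)).
have v0 : 0 < u ^+ n by rewrite exprn_gt0.
have v1 : u ^+ n <= 1 by rewrite exprn_ile1// ltW.
rewrite /= exprVn -[leRHS]mul1r ler_pdivlMr; last by rewrite exprn_gt0//; lra.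
apply: (@le_trans _ _ ((1 - u ^+ n) ^+ (2 ^ n) * (1 + u ^+ n) ^+ (2 ^ n))).
  apply: ler_wpM2l; first by rewrite exprn_ge0// subr_ge0.
  have := @bernoulli_inequality R (u ^+ n) (2 ^ n).
  rewrite (le_trans _ (ltW v0))// => /(_ isT); apply: le_trans.
  by rewrite natrX exprMn lerDr.
rewrite -exprMn exprn_ile1//.
  by rewrite mulr_ge0 ?subr_ge0// addr_ge0// ltW.
rewrite (_ : _ * _ = 1 - (u ^+ n) ^+ 2); last by ring.
by rewrite gerBl sqr_ge0.
Qed.

Section Completeness.
Context {R : realType}.
Variable nu : R.
Hypothesis hnu : -1 < nu.
Hypothesis gamma0_fin : gamma_moment nu 0 \is a fin_num.
Local Notation mu := (@lebesgue_measure R).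
Local Notation W := (laguerre_weight nu).
Local Notation Rp := ([set` `]0%R, +oo[] : set R).
Local Notation wint := (wint nu).
Local Notation wintegrable := (wintegrable nu).

Let poly_null (f : R -> R) := [/\ measurable_fun Rp f,
  wintegrable (fun x => f x ^+ 2) & forall p : {poly R}, wint (fun x => f x * p.[x]) = 0].

Let measurable_expN (s : R) (D : set R) : measurable_fun D (fun x : R => expR (- (s * x))).
Proof.
apply: measurable_funTS; apply: measurableT_comp; first exact: measurable_expR.
by apply: measurableT_comp => //; exact: measurable_funM.
Qed.

(** Expand e^{-sx} in its power series and integrate term by term against f p. The majorant |f p|
    e^{sx} is integrable by Cauchy-Schwarz when p e^{sx} is square integrable for the weight e^{-x},
    that is for 2s < 1; the bound 1/4 stays clear of this. *)
Let poly_null_exp_small (f : R -> R) (s : R) : 0 <= s <= 1 / 4 -> poly_null f ->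
  poly_null (fun x => f x * expR (- (s * x))).
Proof.
move=> /andP[s0 s4] [mf if2 fp]; split.
- by apply: measurable_funM => //; exact: measurable_expN.
- apply: le_wintegrable if2.
    apply: measurable_funX; apply: measurable_funM => //; exact: measurable_expN.
  move=> x x0; rewrite ger0_norm ?sqr_ge0// exprMn ler_piMr ?sqr_ge0//.
  rewrite exprn_ile1 ?expR_ge0// -expR0 ler_expR oppr_le0 mulr_ge0// ltW//.
move=> p.
have s2 : -1 < - (2 * s) by lra.
have ipe : wintegrable (fun x => (p.[x] * expR (s * x)) ^+ 2).
  apply: eq_wintegrable (wintegrable_horner_expR hnu gamma0_fin (p ^+ 2) s2).
  move=> x _; rewrite exprMn horner_exp; congr (_ * _).
  by rewrite [RHS]expr2 -expRD; congr expR; ring.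
have mpe : measurable_fun Rp (fun x => p.[x] * expR (s * x)).
  apply: measurable_funM; first exact: measurable_poly.
  apply: measurable_funTS; apply: measurableT_comp; first exact: measurable_expR.
  exact: measurable_funM.
pose g x := `|f x| * `|p.[x] * expR (s * x)|.
have ig : wintegrable g.
  apply: wintegrable_mul.
  - exact: measurableT_comp.
  - exact: measurableT_comp.
  - by apply: eq_wintegrable if2 => x _; rewrite real_normK// num_real.
  - by apply: eq_wintegrable ipe => x _; rewrite real_normK// num_real.
pose t n x := series (exp_coeff (- (s * x))) n.
have tE n : exists r : {poly R}, forall x, t n x = r.[x].
  exists (\sum_(i < n) ((- s) ^+ i / i`!%:R) *: 'X^i) => x.
  rewrite /t seriesEordf horner_sum; apply: eq_bigr => i _.
  by rewrite hornerZ hornerXn /exp_coeff/= -mulNr exprMn; ring.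
have mt n : measurable_fun Rp (t n).
  have [r tr] := tE n; rewrite (_ : t n = horner r); last exact/funext.
  exact: measurable_poly.
have := @dominated_convergence _ _ _ mu Rp (measurable_itv _)
  (fun n x => (f x * (p.[x] * t n x) * W x)%:E)
  (fun x => (f x * expR (- (s * x)) * p.[x] * W x)%:E)
  (fun x => (g x * W x)%:E).
have mp : measurable_fun Rp (horner p) by exact: measurable_poly.
have mW : measurable_fun Rp W by exact: measurable_laguerre_weight.
case.
- move=> n; apply/measurable_EFinP; apply: (measurable_funM _ mW).
  by apply: (measurable_funM mf); exact: (measurable_funM mp).
- apply/measurable_EFinP; apply: (measurable_funM _ mW).
  by apply: (measurable_funM _ mp); apply: (measurable_funM mf); exact: measurable_expN.
- apply: aeW => x _; apply: cvg_EFin; first exact: nearW.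
  apply: cvgM; last exact: cvg_cst.
  rewrite -mulrA; apply: cvgM; first exact: cvg_cst.
  rewrite mulrC; apply: cvgM; first exact: cvg_cst.
  exact: is_cvg_series_exp_coeff.
- exact: ig.
- apply: aeW => x n; rewrite /= in_itv/= andbT => x0.
  rewrite lee_fin normrM [`|W x|]ger0_norm ?laguerre_weight_ge0//.
  rewrite ler_wpM2r ?laguerre_weight_ge0// normrM /g ler_wpM2l//.
  rewrite normrM [leRHS]normrM ler_wpM2l// [leRHS]ger0_norm ?expR_ge0//.
  rewrite /t seriesEordf; apply: le_trans (ler_norm_sum _ _ _) _.
  have sx : 0 <= s * x by rewrite mulr_ge0// ltW.
  under eq_bigr do rewrite /exp_coeff/= normrM normrX normrN (ger0_norm sx) normfV normr_nat.
  rewrite -(seriesEordf (exp_coeff (s * x))); apply: nondecreasing_cvgn_le.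
    by apply: nondecreasing_series => k _ _; exact: exp_coeff_ge0.
  exact: is_cvg_series_exp_coeff.
move=> iF _; rewrite (wint_EFin (f := fun x => f x * expR (- (s * x)) * p.[x]) iF).
move/fine_cvgP => [_ /= hc]; rewrite -(cvg_lim _ hc)//.
rewrite (_ : fine \o _ = fun=> 0) ?lim_cst//.
apply/funext => n; have [r tr] := tE n.
rewrite -[RHS](fp (p * r)) /= !wintE /Rintegral; congr fine.
by apply: eq_integral => x _; rewrite hornerM tr.
Qed.

Let poly_null_exp (f : R -> R) (s : R) : 0 <= s -> poly_null f ->
  wint (fun x => f x * expR (- (s * x))) = 0.
Proof.
move=> s0 fn.
(* Writing e^{-sx} as a product of [m] equal factors keeps each exponent below 1/4, and the class
   [poly_null] is stable under each factor. *)
pose m := Num.bound (4 * s).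
have sm : 4 * s < m%:R by apply: archi_boundP; rewrite mulr_ge0.
have m0 : 0 < m%:R :> R by apply: le_lt_trans sm; rewrite mulr_ge0.
have h k : poly_null (fun x => f x * expR (- ((k%:R * (s / m%:R)) * x))).
  elim: k => [|k IH].
    rewrite (_ : (fun x => _) = f)//; apply/funext => x.
    by rewrite !mul0r oppr0 expR0 mulr1.
  rewrite (_ : (fun x => _) = (fun x => (f x * expR (- ((k%:R * (s / m%:R)) * x))) *
      expR (- (s / m%:R * x)))).
    apply: poly_null_exp_small => //; rewrite divr_ge0 ?ler0n//=.
    by rewrite ler_pdivrMr//; lra.
  by apply/funext => x; rewrite -[RHS]mulrA -expRD; congr (_ * expR _); rewrite -natr1; ring.
have [_ _ /(_ 1)] := h m; rewrite mulrCA divff ?gt_eqF// mulr1 => <-.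
by apply: eq_wint => x _; rewrite hornerC mulr1.
Qed.

(** The step approximations are polynomials in u = e^{-sx}, hence combinations of exponentials
    orthogonal to f. Dominated convergence carries the orthogonality to the indicator of a half
    line. *)
Let poly_null_tail (f : R -> R) (X : R) : 0 < X -> poly_null f ->
  (\int[mu]_(x in [set` `]X, +oo[]) (f x * W x) = 0)%R.
Proof.
move=> X0 fn; have [mf if2 fp] := fn.
(* Places the threshold u = 1/2 exactly at x = X. *)
pose s := ln 2 / X.
have l2 : 0 < ln 2 :> R by rewrite ln_gt0// ltr1n.
have s0 : 0 < s by rewrite divr_gt0.
have i1 : wintegrable (fun=> 1 ^+ 2).
  apply: eq_wintegrable (wintegrable_horner hnu gamma0_fin 1) => x _.
  by rewrite hornerC expr1n.
have if1 : wintegrable f.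
  apply: eq_wintegrable (wintegrable_mul mf (measurable_cst (1 : R)) if2 i1) => x _.
  by rewrite mulr1.
have mW : measurable_fun Rp W by exact: measurable_laguerre_weight.
pose u x := expR (- (s * x)).
pose t n x := (1 - u x ^+ n) ^+ (2 ^ n).
have mt n : measurable_fun Rp (t n).
  apply: measurable_funX; apply: measurable_funB => //.
  by apply: measurable_funX; exact: measurable_expN.
have := @dominated_convergence _ _ _ mu Rp (measurable_itv _)
  (fun n x => (f x * t n x * W x)%:E)
  (fun x => (f x * \1_([set` `]X, +oo[]) x * W x)%:E)
  (fun x => (`|f x| * W x)%:E).
have u01 x : 0 < x -> 0 <= u x <= 1.
  move=> x0; rewrite expR_ge0/= -expR0 ler_expR oppr_le0.
  by rewrite mulr_ge0// ltW.
have h2 : expR (- ln 2) = 1 / 2 :> R by rewrite expRN lnK ?posrE// mul1r.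
case.
- move=> n; apply/measurable_EFinP; apply: (measurable_funM _ mW).
  exact: (measurable_funM mf).
- apply/measurable_EFinP; apply: (measurable_funM _ mW).
  exact: (measurable_funM mf).
(* At x = X one has u = 1/2, outside the range of both limit lemmas; this single point is discarded
   as a null set. *)
- exists [set X]; split => //; first exact: lebesgue_measure_set1.
  move=> x /= /not_implyP[]; rewrite in_itv/= andbT => x0 nc.
  apply: contra_notP nc => xX; apply: cvg_EFin; first exact: nearW.
  apply: cvgM; last exact: cvg_cst.
  apply: cvgM; first exact: cvg_cst.
  have /andP[ux0 ux1] := u01 x x0.
  rewrite /t indicE; have [Xx|xX'|/esym//] := ltgtP X x.
    rewrite mem_set/= ?in_itv/= ?Xx//; apply: step_approx_lt.
    rewrite ux0/= -h2 ltr_expR ltrN2 /s mulrAC ltr_pdivlMr// ltr_pM2l//.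
  rewrite memNset/= ?in_itv/= ?andbT; last by apply/negP; rewrite -leNgt ltW.
  apply: step_approx_gt.
  rewrite ux1 andbT -h2 ltr_expR ltrN2 /s mulrAC ltr_pdivrMr// ltr_pM2l//.
- have mnf : measurable_fun Rp (fun x => `|f x|) by exact: measurableT_comp.
  have ifn : wintegrable (fun x => `|f x| ^+ 2).
    by apply: eq_wintegrable if2 => x _; rewrite real_normK// num_real.
  by apply: eq_wintegrable (wintegrable_mul mnf (measurable_cst (1 : R)) ifn i1) => x _;
    rewrite mulr1.
- apply: aeW => x n; rewrite /= in_itv/= andbT => x0.
  rewrite lee_fin normrM [`|W x|]ger0_norm ?laguerre_weight_ge0//.
  rewrite ler_wpM2r ?laguerre_weight_ge0// normrM ler_piMr//.
  by have /andP[t0 t1] := step_approx_bounds n (u01 x x0); rewrite ger0_norm.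
move=> iF _.
rewrite (wint_EFin (f := fun x => f x * \1_([set` `]X, +oo[]) x) iF).
move/fine_cvgP => [_ /= hc].
transitivity (wint (fun x => f x * \1_([set` `]X, +oo[]) x)).
  rewrite !wintE [LHS]Rintegral_mkcond [RHS]Rintegral_mkcond.
  apply: eq_Rintegral => x _; rewrite !patchE indicE.
  have [xX|xX] := boolP (x \in [set` `]X, +oo[]).
    rewrite mulr1 ifT// inE/= in_itv/= andbT.
    by move: xX; rewrite inE/= in_itv/= andbT; exact: lt_trans.
  by rewrite mulr0 mul0r; case: ifP.
rewrite -(cvg_lim _ hc)// (_ : fine \o _ = fun=> 0) ?lim_cst//.
apply/funext => n /=.
pose P : {poly R} := (1 - 'X^n) ^+ (2 ^ n).
have iu i : wintegrable (fun x => f x * expR (- (i%:R * s * x))).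
  have := wintegrable_mul mf (@measurable_expN (i%:R * s) Rp) if2; apply.
  have si : -1 < 2 * (i%:R * s).
    by have := mulr_ge0 (ler0n R i) (ltW s0); lra.
  apply: eq_wintegrable (wintegrable_horner_expR hnu gamma0_fin 1 si) => x _.
  by rewrite hornerC mul1r expr2 -expRD; congr expR; ring.
transitivity (wint (fun x => f x * t n x)) => //.
transitivity (wint (fun x => \sum_(i < size P) P`_i * (f x * expR (- (i%:R * s * x))))).
  apply: eq_wint => x _; rewrite /t.
  have -> : (1 - u x ^+ n) ^+ (2 ^ n) = P.[u x].
    by rewrite /P horner_exp hornerD hornerN hornerC hornerXn.
  rewrite horner_coef mulr_sumr; apply: eq_bigr => i _.
  by rewrite /u -expRM_natl mulrCA; congr (_ * (_ * expR _)); ring.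
rewrite (@wint_sum _ nu (size P) (fun i x => P`_i * (f x * expR (- (i%:R * s * x)))))//.
  rewrite big1// => i _; rewrite wintZ//.
  by rewrite poly_null_exp ?mulr0//; exact: mulr_ge0 (ler0n R i) (ltW s0).
by move=> i; exact: wintegrableZ.
Qed.

(** All tail integrals of f W vanish, so its cumulative integral is constant on the positive half
    line. Lebesgue differentiation then gives f W = 0 almost everywhere, and W is positive. *)
Lemma laguerre_complete (f : R -> R) : measurable_fun Rp f ->
  wintegrable (fun x => f x ^+ 2) ->
  (forall p : {poly R}, wint (fun x => f x * p.[x]) = 0) ->
  {ae mu, forall x, 0 < x -> f x = 0}.
Proof.
move=> mf if2 fp; have fn : poly_null f by [].
have i1 : wintegrable (fun=> 1 ^+ 2).
  apply: eq_wintegrable (wintegrable_horner hnu gamma0_fin 1) => x _.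
  by rewrite hornerC expr1n.
have if1 : wintegrable f.
  apply: eq_wintegrable (wintegrable_mul mf (measurable_cst (1 : R)) if2 i1) => x _.
  by rewrite mulr1.
pose h := (fun x => f x * W x) \_ Rp.
have ih : mu.-integrable setT (EFin \o h).
  rewrite /h -restrict_EFin.
  exact: (@integrable_mkcond _ (measurableTypeR R) R mu Rp _ (measurable_itv _)).1 if1.
have := @FTC1Ny R h.
case.
- by move=> y; apply: integrableS ih.
- exact: integrable_locally_restrict.
move=> N [mN N0 hN]; exists N; split => // x /= /not_implyP[x0 fx0].
apply: hN => /= -[dF dFx]; apply: fx0.
have hx : h x = f x * W x by rewrite /h patchE mem_set//= in_itv/= x0.
suff : h x = 0.
  by rewrite hx => /eqP; rewrite mulf_eq0 (gt_eqF (laguerre_weight_gt0 _ x0)) orbF => /eqP.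
rewrite -dFx derive1E.
rewrite (near_eq_derive (g := cst (\int[mu]_x h x)))%R ?derive_cst//.
near=> y.
have y0 : 0 < y by near: y; exact: lt_nbhsr.
have := @Rintegral_itvB R h -oo%O +oo%O y.
rewrite set_itvNyy => /(_ ih isT isT) /eqP; rewrite subr_eq => /eqP ->.
rewrite (_ : \int[mu]_(x in _) h x = 0)%R ?add0r//.
rewrite -[RHS](poly_null_tail y0 fn); apply: eq_Rintegral => z.
rewrite inE/= in_itv/= andbT => yz; rewrite /h patchE mem_set//=.
by rewrite in_itv/= andbT (lt_trans y0).
Unshelve. all: end_near. Qed.

End Completeness.

(** * Complex differentiability and Cauchy's formula on squares *)

Section ComplexModulus.
Context {R : realType}.
Implicit Types (z w : R[i]) (x : R).
Local Notation normc := Normc.normc.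

Lemma normc_sqr z : normc z ^+ 2 = complex.Re z ^+ 2 + complex.Im z ^+ 2.
Proof. by case: z => a b; rewrite /= sqr_sqrtr// addr_ge0 ?sqr_ge0. Qed.

Lemma normc_ge0 z : 0 <= normc z.
Proof. by case: z => a b; exact: sqrtr_ge0. Qed.

Lemma normc_real x : normc x%:C = `|x|.
Proof. by rewrite /= expr0n addr0 sqrtr_sqr. Qed.

Lemma normc_eq0 z : (normc z == 0) = (z == 0).
Proof.
apply/eqP/eqP => [|->]; first exact: Normc.eq0_normc.
exact: Normc.normc0.
Qed.

Lemma normc_gt0 z : (0 < normc z) = (z != 0).
Proof. by rewrite lt_neqAle normc_ge0 andbT eq_sym normc_eq0. Qed.

Lemma normcX z n : normc (z ^+ n) = normc z ^+ n.
Proof.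
elim: n => [|n IH]; first by rewrite !expr0 normc_real normr1.
by rewrite !exprS Normc.normcM IH.
Qed.

Lemma normc_Re z : `|complex.Re z| <= normc z.
Proof.
rewrite -ler_sqr ?nnegrE ?normc_ge0// normc_sqr real_normK ?num_real//.
by rewrite lerDl sqr_ge0.
Qed.

Lemma normc_Im z : `|complex.Im z| <= normc z.
Proof.
rewrite -ler_sqr ?nnegrE ?normc_ge0// normc_sqr real_normK ?num_real//.
by rewrite lerDr sqr_ge0.
Qed.

Lemma normc_le_ReIm z : normc z <= `|complex.Re z| + `|complex.Im z|.
Proof.
rewrite -ler_sqr ?nnegrE ?normc_ge0 ?addr_ge0// normc_sqr.
rewrite -(real_normK (num_real (complex.Re z))) -(real_normK (num_real (complex.Im z))).
have := mulr_ge0 (normr_ge0 (complex.Re z)) (normr_ge0 (complex.Im z)).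
nra.
Qed.

Lemma normcB z w : normc (z - w) = normc (w - z).
Proof. by rewrite -normcN opprB. Qed.

Lemma ler_normcB z w : normc (z - w) <= normc z + normc w.
Proof. by rewrite -[normc w]normcN; exact: le_normcD. Qed.

Lemma normc_sum n (f : nat -> R[i]) :
  normc (\sum_(j < n) f j) <= \sum_(j < n) normc (f j).
Proof.
elim: n => [|n IH]; first by rewrite !big_ord0 normc_real normr0.
by rewrite !big_ord_recr/=; apply: le_trans (le_normcD _ _) _; rewrite lerD2r.
Qed.

Lemma normcE z : `|z| = (normc z)%:C.
Proof. by rewrite normc_def; case: z. Qed.

(** Complex differentiability with real tolerances and the real modulus. The multiplied-out form
    avoids dividing by h, and the closed ball lets the bound be used at its boundary. *)
Definition cdiff (F : R[i] -> R[i]) (z d : R[i]) : Prop :=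
  forall e : R, 0 < e -> exists2 r : R, 0 < r & forall h, normc h <= r ->
    normc (F (z + h) - F z - d * h) <= e * normc h.

Lemma entireP (F : R[i] -> R[i]) :
  entire F <-> forall z, exists d, cdiff F z d.
Proof.
split=> hF z.
  have /cvg_ex[/= d /cvgrPdist_le hd] := hF z.
  exists d => e e0.
  have e0' : (0 : R[i]) < e%:C by rewrite ltcR.
  have := hd _ e0'; rewrite /dnbhs /within/= => /nbhs_normP[r /= r0 hr].
  have rR : r = (complex.Re r)%:C by rewrite RRe_real// gtr0_real.
  rewrite rR ltcR in r0.
  exists (complex.Re r / 2); first by rewrite divr_gt0.
  move=> h hh; have [->|h0] := eqVneq h 0.
    by rewrite addr0 subrr sub0r mulr0 oppr0 Normc.normc0 mulr0.
  have hb : ball_ (fun x : R[i] => `|x|) 0 r h.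
    rewrite /ball_/= sub0r normrN normcE rR ltcR; apply: le_lt_trans hh _.
    by rewrite ltr_pdivrMr// ltr_pMr// ltr1n.
  have := hr h hb h0; rewrite normcE lecR => {}hr.
  have n0 : 0 < normc h by rewrite normc_gt0.
  apply: le_trans (ler_wpM2r (ltW n0) hr).
  rewrite -Normc.normcM -normcN le_eqVlt; apply/orP; left; apply/eqP; congr normc.
  rewrite mulrBl /GRing.scale/= mulr1 [z + h]addrC mulrAC mulVf// mul1r.
  by rewrite opprB opprB addrC; ring.
have [d hd] := hF z; apply/cvg_ex; exists d => /=.
apply/cvgrPdist_le => e e0.
have eR : e = (complex.Re e)%:C by rewrite RRe_real// gtr0_real.
rewrite eR ltcR in e0; have [r r0 hr] := hd _ e0.
rewrite /dnbhs /within/=; apply/nbhs_normP; exists r%:C => /=; first by rewrite ltcR.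
move=> h; rewrite /ball_/= sub0r normrN normcE ltcR => hh h0.
rewrite eR normcE lecR.
have n0 : 0 < normc h by rewrite normc_gt0.
rewrite -(ler_pM2r n0) -Normc.normcM; apply: le_trans (hr h (ltW hh)).
rewrite -[normc (_ * h)]normcN le_eqVlt; apply/orP; left; apply/eqP; congr normc.
rewrite mulrBl /GRing.scale/= mulr1 [z + h]addrC mulrAC mulVf// mul1r.
by rewrite opprB addrC; ring.
Qed.

Lemma cdiff_bounded F z d : cdiff F z d -> exists2 r : R, 0 < r &
  forall h, normc h <= r -> normc (F (z + h) - F z) <= (1 + normc d) * normc h.
Proof.
move=> /(_ 1 ltr01)[r r0 hr]; exists r => // h /hr; rewrite mul1r => {}hr.
rewrite -(subrK (d * h) (F (z + h) - F z)).
by apply: le_trans (le_normcD _ _) _; rewrite Normc.normcM mulrDl mul1r lerD2r.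
Qed.

Lemma cdiff_cst (k z : R[i]) : cdiff (fun=> k) z 0.
Proof.
move=> e e0; exists 1 => // h _.
by rewrite subrr mul0r subr0 Normc.normc0 mulr_ge0 ?normc_ge0// ltW.
Qed.

Lemma cdiff_id (z : R[i]) : cdiff id z 1.
Proof.
move=> e e0; exists 1 => // h _.
rewrite [z + h]addrC addrK mul1r subrr Normc.normc0 mulr_ge0 ?normc_ge0//.
exact: ltW.
Qed.

Lemma cdiffD F G z d k : cdiff F z d -> cdiff G z k ->
  cdiff (fun w => F w + G w) z (d + k).
Proof.
move=> hF hG e e0; have e2 : 0 < e / 2 by rewrite divr_gt0.
have [r r0 hr] := hF _ e2; have [s s0 hs] := hG _ e2.
exists (Num.min r s); first by rewrite lt_min r0.
move=> h; rewrite le_min => /andP[/hr {}hr /hs {}hs].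
have -> : F (z + h) + G (z + h) - (F z + G z) - (d + k) * h =
  (F (z + h) - F z - d * h) + (G (z + h) - G z - k * h) by ring.
apply: le_trans (le_normcD _ _) _; apply: le_trans (lerD hr hs) _.
by rewrite -mulrDl -splitr.
Qed.

Lemma cdiffM F G z d k : cdiff F z d -> cdiff G z k ->
  cdiff (fun w => F w * G w) z (d * G z + F z * k).
Proof.
move=> hF hG e e0.
pose A := normc (G z) + normc (F z) + 1.
have A0 : 0 < A by rewrite ltr_wpDl// addr_ge0 ?normc_ge0.
have B0 : 0 < (1 + normc d) * (1 + normc k).
  by rewrite mulr_gt0// ltr_pwDl// normc_ge0.
have e1 : 0 < e / (2 * A) by rewrite divr_gt0// mulr_gt0.
have [r r0 hr] := hF _ e1; have [s s0 hs] := hG _ e1.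
have [r' r0' hr'] := cdiff_bounded hF; have [s' s0' hs'] := cdiff_bounded hG.
exists (Num.min (Num.min r s) (Num.min (Num.min r' s')
   (e / (2 * ((1 + normc d) * (1 + normc k)))))).
  by rewrite !lt_min r0 s0 r0' s0' divr_gt0// mulr_gt0.
move=> h; rewrite !le_min -!andbA.
move=> /and5P[/hr {}hr /hs {}hs /hr' {}hr' /hs' {}hs' he].
have -> : F (z + h) * G (z + h) - F z * G z - (d * G z + F z * k) * h =
  (F (z + h) - F z - d * h) * G z + F z * (G (z + h) - G z - k * h) +
  (F (z + h) - F z) * (G (z + h) - G z) by ring.
apply: le_trans (le_normcD _ _) _.
rewrite (_ : e * normc h = e / 2 * normc h + e / 2 * normc h); last first.
  by rewrite -mulrDl -splitr.
apply: lerD.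
  apply: le_trans (le_normcD _ _) _; rewrite !Normc.normcM.
  apply: (@le_trans _ _ (e / (2 * A) * normc h * normc (G z) +
      normc (F z) * (e / (2 * A) * normc h))).
    by apply: lerD; [rewrite ler_wpM2r ?normc_ge0 | rewrite ler_wpM2l ?normc_ge0].
  rewrite (_ : _ + _ = (e / 2 * normc h) * ((normc (G z) + normc (F z)) / A)); last first.
    by field; rewrite gt_eqF.
  rewrite ler_piMr ?mulr_ge0 ?normc_ge0 ?divr_ge0// ?ltW//.
  by rewrite ltr_pdivrMr// mul1r ltrDl.
rewrite Normc.normcM; apply: le_trans (ler_pM (normc_ge0 _) (normc_ge0 _) hr' hs') _.
rewrite mulrACA mulrA ler_wpM2r ?normc_ge0//.
move: he B0; set P := (1 + normc d) * (1 + normc k) => he B0.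
by rewrite mulrC -ler_pdivlMr// -mulrA -invfM.
Qed.

Lemma cdiffV z : z != 0 -> cdiff (fun w => w^-1) z (- z ^- 2).
Proof.
move=> z0 e e0; have n0 : 0 < normc z by rewrite normc_gt0.
have n3 : 0 < normc z ^+ 3 by rewrite exprn_gt0.
exists (Num.min (normc z / 2) (e * normc z ^+ 3 / 2)).
  by rewrite lt_min !divr_gt0// mulr_gt0.
move=> h; rewrite le_min => /andP[h1 h2].
have nzh : normc z / 2 <= normc (z + h).
  have : normc z <= normc (z + h) + normc h.
    by rewrite -{1}(addrK h z); exact: ler_normcB.
  lra.
have zh : z + h != 0 by rewrite -normc_gt0; apply: lt_le_trans nzh; rewrite divr_gt0.
have -> : (z + h)^-1 - z^-1 - - z ^- 2 * h = h ^+ 2 / (z ^+ 2 * (z + h)).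
  by field; rewrite z0 zh.
rewrite !expr2 !(Normc.normcM, Normc.normcV) -mulrA [leLHS]mulrC.
rewrite ler_wpM2r ?normc_ge0// ler_pdivrMr; last first.
  by rewrite !mulr_gt0// normc_gt0.
apply: le_trans h2 _; rewrite -mulrA ler_wpM2l ?(ltW e0)//.
rewrite (_ : normc z ^+ 3 / 2 = normc z * normc z * (normc z / 2)); last by field.
by rewrite ler_wpM2l// mulr_ge0// ltW.
Qed.

Lemma cdiff_shift F z w d : cdiff F (z - w) d -> cdiff (fun u => F (u - w)) z d.
Proof.
move=> hF e /hF[r r0 hr]; exists r => // h /hr.
by rewrite (_ : z + h - w = z - w + h)// addrAC.
Qed.

End ComplexModulus.

(** * Integrals of complex functions along segments *)

Section ComplexSegments.
Context {R : realType}.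
Local Notation mu := (@lebesgue_measure R).
Local Notation normc := Normc.normc.
Implicit Types (H G : R -> R[i]) (D : set (measurableTypeR R)).

Definition cintegrable D H : Prop :=
  mu.-integrable D (EFin \o (fun t => complex.Re (H t))) /\
  mu.-integrable D (EFin \o (fun t => complex.Im (H t))).

Lemma eq_cintegral D H G : {in D, H =1 G} -> cintegral D H = cintegral D G.
Proof. by move=> HG; congr Complex; apply: eq_Rintegral => x /HG ->. Qed.

Lemma cintegralD D H G : measurable D -> cintegrable D H -> cintegrable D G ->
  cintegral D (fun t => H t + G t) = cintegral D H + cintegral D G.
Proof.
move=> mD [hR hI] [gR gI]; rewrite /cintegral.
transitivity ((\int[mu]_(x in D) (complex.Re (H x) + complex.Re (G x)))%R +i*
   (\int[mu]_(x in D) (complex.Im (H x) + complex.Im (G x)))%R).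
  by congr Complex; apply: eq_Rintegral => x _; case: (H x) (G x) => [? ?] [].
by rewrite !RintegralD.
Qed.

Lemma cintegrableZ D (c : R[i]) H : measurable D -> cintegrable D H ->
  cintegrable D (fun t => c * H t).
Proof.
move=> mD [hR hI]; case: c => p q; split.
  have := integrableB mD (integrableZl mD p hR) (integrableZl mD q hI).
  by apply: eq_integrable => // x _ /=; case: (H x) => ? ?.
have := integrableD mD (integrableZl mD p hI) (integrableZl mD q hR).
apply: eq_integrable => // x _ /=; case: (H x) => ? ?.
by rewrite -!EFinM -EFinD.
Qed.

Lemma cintegralZ D (c : R[i]) H : measurable D -> cintegrable D H ->
  cintegral D (fun t => c * H t) = c * cintegral D H.
Proof.
move=> mD [hR hI]; case: c => p q; rewrite /cintegral.
transitivity ((\int[mu]_(x in D) (p * complex.Re (H x) - q * complex.Im (H x)))%R +i*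
   (\int[mu]_(x in D) (p * complex.Im (H x) + q * complex.Re (H x)))%R).
  by congr Complex; apply: eq_Rintegral => x _; case: (H x) => [? ?].
rewrite RintegralB ?RintegralD ?RintegralZl//.
- exact: (integrableZl mD p hI).
- exact: (integrableZl mD q hR).
- exact: (integrableZl mD p hR).
- exact: (integrableZl mD q hI).
Qed.

Let mitv (a b : R) : measurable ([set` `[a, b]] : set (measurableTypeR R)).
Proof. exact: measurable_itv. Qed.

Lemma Rintegral_cst_itv (a b k : R) : a <= b ->
  (\int[mu]_(x in `[a, b]) k = k * (b - a))%R.
Proof.
move=> ab; rewrite /Rintegral integral_cst//= lebesgue_measure_itv/= lte_fin.
move: ab; rewrite le_eqVlt => /predU1P[->|->]; last by rewrite -EFinB -EFinM.
by rewrite ltxx mule0 subrr mulr0.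
Qed.

Lemma le_normr_Rintegral_itv (a b B : R) (f : R -> R) : a <= b ->
  mu.-integrable `[a, b] (EFin \o f) ->
  (forall t, a <= t <= b -> `|f t| <= B) ->
  `|(\int[mu]_(x in `[a, b]) f x)%R| <= B * (b - a).
Proof.
move=> ab fi fB; apply: (le_trans (le_normr_Rintegral _ fi)) => //.
have B0 : 0 <= B by apply: le_trans (fB a _); rewrite ?lexx.
rewrite -Rintegral_cst_itv//; apply: le_Rintegral => //.
- exact: integrable_norm.
- apply/integrableP; split; first exact: measurable_cst.
  under eq_integral do rewrite /= ger0_norm//.
  rewrite integral_cst//= lebesgue_measure_itv/=.
  by case: ifPn => _; rewrite ?mule0 ?ltry// -EFinB -EFinM ltry.
Qed.

(** The factor 2 comes from bounding real and imaginary parts separately; the contour estimates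
    below need no sharp constant. *)
Lemma normc_cintegral_le (a b B : R) H : a <= b -> cintegrable `[a, b] H ->
  (forall t, a <= t <= b -> normc (H t) <= B) ->
  normc (cintegral `[a, b] H) <= 2 * B * (b - a).
Proof.
move=> ab [hR hI] hB; apply: le_trans (normc_le_ReIm _) _.
rewrite -mulrA mulr2n mulrDl mul1r; apply: lerD.
  by apply: le_normr_Rintegral_itv => // t /hB; exact: le_trans (normc_Re _).
by apply: le_normr_Rintegral_itv => // t /hB; exact: le_trans (normc_Im _).
Qed.

Lemma cintegral_itv_split (a m b : R) H : a <= m <= b ->
  cintegrable `[a, b] H ->
  cintegral `[a, b] H = cintegral `[a, m] H + cintegral `[m, b] H.
Proof.
move=> /andP[am mb] [hR hI].
have key (f : R -> R) : mu.-integrable `[a, b] (EFin \o f) ->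
    (\int[mu]_(x in `[a, b]) f x =
     \int[mu]_(x in `[a, m]) f x + \int[mu]_(x in `[m, b]) f x)%R.
  move=> fi; have := Rintegral_itvB (x := m) fi; rewrite !bnd_simp => /(_ am mb).
  rewrite -(@Rintegral_itv_obnd_cbnd _ m (BRight b)).
    by move=> <-; rewrite addrCA subrr addr0.
  apply: (integrableS _ _ _ fi) => //.
  move=> x /=; rewrite !in_itv/= => /andP[mx ->]; rewrite andbT.
  by rewrite (le_trans am)// ltW.
by rewrite /cintegral !key.
Qed.

Definition cdiffable (F : R[i] -> R[i]) (z : R[i]) := exists d, cdiff F z d.

Lemma continuous_along (F : R[i] -> R[i]) (w : R -> R[i]) (t : R) :
  (forall s u, normc (w s - w u) <= `|s - u|) -> cdiffable F (w t) ->
  {for t, continuous (fun s => complex.Re (F (w s)))} /\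
  {for t, continuous (fun s => complex.Im (F (w s)))}.
Proof.
move=> wl [d /cdiff_bounded[r r0 hr]].
have key e : 0 < e -> \forall s \near t, normc (F (w s) - F (w t)) <= e.
  move=> e0; pose k := 1 + normc d.
  have k0 : 0 < k by rewrite ltr_pwDl// normc_ge0.
  have m0 : 0 < Num.min r (e / k) by rewrite lt_min r0 divr_gt0.
  near=> s.
  have st : `|s - t| <= Num.min r (e / k).
    by rewrite distrC; near: s; move/cvgrPdist_le: (@cvg_id _ (nbhs t)) => /(_ _ m0).
  have := hr (w s - w t); rewrite [w t + _]addrC subrK => /(_ _)/le_trans; apply.
    by apply: le_trans (wl _ _) (le_trans st _); rewrite ge_min lexx.
  rewrite mulrC -ler_pdivlMr//; apply: le_trans (wl _ _) (le_trans st _).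
  by rewrite ge_min lexx orbT.
split; apply/cvgrPdist_le => e e0; near=> s.
  rewrite distrC; have : normc (F (w s) - F (w t)) <= e by near: s; exact: key.
  apply: le_trans; apply: le_trans (normc_Re _).
  by case: (F (w s)) (F (w t)) => [? ?] [].
rewrite distrC; have : normc (F (w s) - F (w t)) <= e by near: s; exact: key.
apply: le_trans; apply: le_trans (normc_Im _).
by case: (F (w s)) (F (w t)) => [? ?] [].
Unshelve. all: end_near. Qed.

Lemma cintegrable_along (F : R[i] -> R[i]) (w : R -> R[i]) (a b : R) :
  (forall s u, normc (w s - w u) <= `|s - u|) ->
  (forall t, a <= t <= b -> cdiffable F (w t)) ->
  cintegrable `[a, b] (fun t => F (w t)).
Proof.
move=> wl hF; split.
  apply: continuous_compact_integrable; first exact: segment_compact.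
  apply: continuous_in_subspaceT => t; rewrite inE/= in_itv/= => /hF ht.
  by have [] := continuous_along wl ht.
apply: continuous_compact_integrable; first exact: segment_compact.
apply: continuous_in_subspaceT => t; rewrite inE/= in_itv/= => /hF ht.
by have [] := continuous_along wl ht.
Qed.

Lemma hline_lip (y s u : R) : normc ((s +i* y) - (u +i* y)) <= `|s - u|.
Proof. by rewrite /= subrr expr0n addr0 sqrtr_sqr. Qed.

Lemma vline_lip (x s u : R) : normc ((x +i* s) - (x +i* u)) <= `|s - u|.
Proof. by rewrite /= subrr expr0n add0r sqrtr_sqr. Qed.

End ComplexSegments.

(** * Contour integrals over rectangles and Goursat's theorem *)

Section RectangleIntegral.
Context {R : realType}.
Local Notation normc := Normc.normc.
Implicit Types (F G : R[i] -> R[i]) (a b c d : R).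

Let mitv a b : measurable ([set` `[a, b]] : set (measurableTypeR R)).
Proof. exact: measurable_itv. Qed.

Definition hseg F a b (y : R) : R[i] := cintegral `[a, b] (fun s => F (s +i* y)).
Definition vseg F c d (x : R) : R[i] := cintegral `[c, d] (fun t => F (x +i* t)).

(* The contour integral of [F] along the positively oriented boundary of
   [[a, b] x [c, d]]. *)
Definition rint F a b c d : R[i] :=
  hseg F a b c - hseg F a b d + (0 +i* 1) * (vseg F c d b - vseg F c d a).

(** Differentiability is asked on the boundary only, so that integrands with a pole inside the
    rectangle are covered. *)
Definition cdiff_edges F a b c d : Prop :=
  (forall x y, a <= x <= b -> (y = c \/ y = d) -> cdiffable F (x +i* y)) /\
  (forall x y, c <= y <= d -> (x = a \/ x = b) -> cdiffable F (x +i* y)).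

Lemma cintegrable_hseg F a b y :
  (forall x, a <= x <= b -> cdiffable F (x +i* y)) ->
  cintegrable `[a, b] (fun s => F (s +i* y)).
Proof.
move=> hF; apply: (@cintegrable_along _ F (fun s => s +i* y)) => // s u.
exact: hline_lip.
Qed.

Lemma cintegrable_vseg F c d x :
  (forall y, c <= y <= d -> cdiffable F (x +i* y)) ->
  cintegrable `[c, d] (fun t => F (x +i* t)).
Proof.
move=> hF; apply: (@cintegrable_along _ F (fun s => x +i* s)) => // s u.
exact: vline_lip.
Qed.

Lemma cdiff_edges_integrable F a b c d : cdiff_edges F a b c d ->
  [/\ cintegrable `[a, b] (fun s => F (s +i* c)),
      cintegrable `[a, b] (fun s => F (s +i* d)),
      cintegrable `[c, d] (fun t => F (a +i* t)) &
      cintegrable `[c, d] (fun t => F (b +i* t))].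
Proof.
move=> [h v]; split; [apply: cintegrable_hseg => x hx|
  apply: cintegrable_hseg => x hx|apply: cintegrable_vseg => x hx|
  apply: cintegrable_vseg => x hx]; [apply: h|apply: h|apply: v|apply: v] => //;
  by [left|right].
Qed.

Lemma rintD F G a b c d : cdiff_edges F a b c d -> cdiff_edges G a b c d ->
  rint (fun z => F z + G z) a b c d = rint F a b c d + rint G a b c d.
Proof.
move=> /cdiff_edges_integrable[F1 F2 F3 F4] /cdiff_edges_integrable[G1 G2 G3 G4].
by rewrite /rint /hseg /vseg !cintegralD//; ring.
Qed.

Lemma rintZ F k a b c d : cdiff_edges F a b c d ->
  rint (fun z => k * F z) a b c d = k * rint F a b c d.
Proof.
move=> /cdiff_edges_integrable[F1 F2 F3 F4].
by rewrite /rint /hseg /vseg !cintegralZ//; ring.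
Qed.

Lemma eq_rint F G a b c d :
  (forall x y, a <= x <= b -> (y = c \/ y = d) -> F (x +i* y) = G (x +i* y)) ->
  (forall x y, c <= y <= d -> (x = a \/ x = b) -> F (x +i* y) = G (x +i* y)) ->
  rint F a b c d = rint G a b c d.
Proof.
move=> h v.
have eh y : (y = c \/ y = d) -> hseg F a b y = hseg G a b y.
  by move=> hy; apply: eq_cintegral => t; rewrite inE/= in_itv/= => ht; exact: h.
have ev x : (x = a \/ x = b) -> vseg F c d x = vseg G c d x.
  by move=> hx; apply: eq_cintegral => t; rewrite inE/= in_itv/= => ht; exact: v.
by rewrite /rint !eh ?ev; auto.
Qed.

Lemma normc_rint_le F a b c d B : a <= b -> c <= d -> cdiff_edges F a b c d ->
  (forall x y, a <= x <= b -> (y = c \/ y = d) -> normc (F (x +i* y)) <= B) ->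
  (forall x y, c <= y <= d -> (x = a \/ x = b) -> normc (F (x +i* y)) <= B) ->
  normc (rint F a b c d) <= 4 * B * ((b - a) + (d - c)).
Proof.
move=> ab cd /cdiff_edges_integrable[F1 F2 F3 F4] h v.
rewrite /rint /hseg /vseg; apply: le_trans (le_normcD _ _) _.
rewrite Normc.normcM (_ : normc (0 +i* 1) = 1); last first.
  by rewrite /= expr0n expr1n add0r sqrtr1.
rewrite mul1r mulrDr; apply: lerD; apply: le_trans (ler_normcB _ _) _.
  have -> : 4 * B * (b - a) = 2 * B * (b - a) + 2 * B * (b - a) by ring.
  apply: lerD; apply: normc_cintegral_le => // t ht; apply: h => //;
  by [left|right].
have -> : 4 * B * (d - c) = 2 * B * (d - c) + 2 * B * (d - c) by ring.
apply: lerD; apply: normc_cintegral_le => // t ht; apply: v => //;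
by [left|right].
Qed.

Lemma rint_vcut F a m b c d : a <= m <= b ->
  (forall x y, a <= x <= b -> (y = c \/ y = d) -> cdiffable F (x +i* y)) ->
  rint F a b c d = rint F a m c d + rint F m b c d.
Proof.
move=> amb h; rewrite /rint /hseg.
rewrite (cintegral_itv_split amb (cintegrable_hseg (fun x hx => h x c hx (or_introl erefl)))).
rewrite (cintegral_itv_split amb (cintegrable_hseg (fun x hx => h x d hx (or_intror erefl)))).
ring.
Qed.

Lemma rint_hcut F a b c m d : c <= m <= d ->
  (forall x y, c <= y <= d -> (x = a \/ x = b) -> cdiffable F (x +i* y)) ->
  rint F a b c d = rint F a b c m + rint F a b m d.
Proof.
move=> cmd h; rewrite /rint /vseg.
rewrite (cintegral_itv_split cmd (cintegrable_vseg (fun x hx => h a x hx (or_introl erefl)))).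
rewrite (cintegral_itv_split cmd (cintegrable_vseg (fun x hx => h b x hx (or_intror erefl)))).
ring.
Qed.

Lemma cdiff_edges_rect F a b c d : a <= b -> c <= d ->
  (forall x y, a <= x <= b -> c <= y <= d -> cdiffable F (x +i* y)) ->
  cdiff_edges F a b c d.
Proof.
move=> ab cd h; split=> x y hx [] ->; apply: h => //; by rewrite lexx ?ab ?cd.
Qed.

Lemma cdiffable_cst (k : R[i]) z : cdiffable (fun=> k) z.
Proof. by exists 0; exact: cdiff_cst. Qed.

Lemma cdiffable_id (z : R[i]) : cdiffable (fun z => z) z.
Proof. by exists 1; exact: cdiff_id. Qed.

Lemma cdiffableD F G z : cdiffable F z -> cdiffable G z ->
  cdiffable (fun w => F w + G w) z.
Proof. by move=> [p hp] [q hq]; exists (p + q); exact: cdiffD. Qed.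

Lemma cdiffableM F G z : cdiffable F z -> cdiffable G z ->
  cdiffable (fun w => F w * G w) z.
Proof. by move=> [p hp] [q hq]; exists (p * G z + F z * q); exact: cdiffM. Qed.

Lemma cdiffableZ (k : R[i]) F z : cdiffable F z -> cdiffable (fun w => k * F w) z.
Proof. by apply: cdiffableM; exact: cdiffable_cst. Qed.

Lemma cintegral_cst a b (k : R[i]) : a <= b ->
  cintegral `[a, b] (fun=> k) = k * (b - a)%:C.
Proof.
move=> ab; rewrite /cintegral !Rintegral_cst_itv//.
by case: k => p q; apply/eqP; rewrite eq_complex/= !mulr0 subr0 add0r !eqxx.
Qed.

(** For z itself, the integrands on opposite edges differ by a constant: the horizontal pair
    contributes i (c - d) (b - a) and the vertical pair i (b - a) (d - c). Constants cancel edge by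
    edge. *)
Lemma rint_affine a b c d (p q : R[i]) : a <= b -> c <= d ->
  rint (fun z => p + q * z) a b c d = 0.
Proof.
move=> ab cd.
have hid := @cdiffable_id.
have -> : rint (fun z => p + q * z) a b c d =
    rint (fun=> p) a b c d + q * rint (fun z => z) a b c d.
  rewrite -rintZ ?rintD//; split=> *; do ?apply: cdiffableZ;
    first [exact: cdiffable_cst|exact: cdiffable_id].
have -> : rint (fun=> p) a b c d = 0.
  by rewrite /rint /hseg /vseg !subrr mulr0 addr0.
suff -> : rint (fun z => z) a b c d = 0 by rewrite mulr0 addr0.
have [F1 F2 F3 F4] := @cdiff_edges_integrable (fun z => z) a b c d
   (conj (fun x y _ _ => hid _) (fun x y _ _ => hid _)).
have opp D (H : R -> R[i]) : measurable D -> cintegrable D H ->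
    - cintegral D H = cintegral D (fun t => - 1 * H t).
  by move=> mD iH; rewrite cintegralZ// mulN1r.
rewrite /rint /hseg /vseg !opp//.
rewrite -!cintegralD//; do ?exact: cintegrableZ.
rewrite (_ : (fun t : R => (t +i* c) + - 1 * (t +i* d)) = fun=> (0 +i* (c - d))); last first.
  apply/funext => t; apply/eqP; rewrite eq_complex/=.
  by apply/andP; split; apply/eqP; ring.
rewrite (_ : (fun t : R => (b +i* t) + - 1 * (a +i* t)) = fun=> ((b - a) +i* 0)); last first.
  apply/funext => t; apply/eqP; rewrite eq_complex/=.
  by apply/andP; split; apply/eqP; ring.
rewrite !cintegral_cst//; apply/eqP; rewrite eq_complex/=.
by apply/andP; split; apply/eqP; ring.
Qed.

Lemma half_pow2 (p : R) (n : nat) : p / 2 ^+ n.+1 = p / 2 ^+ n / 2.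
Proof. by rewrite exprSr invfM mulrA. Qed.

Lemma nested_limit (x : nat -> R) (p : R) : 0 <= p ->
  (forall n : nat, x n <= x n.+1 <= x n + p / 2 ^+ n.+1) ->
  exists z, forall n : nat, x n <= z <= x n + p / 2 ^+ n.
Proof.
move=> p0 hx; have x_nd : nondecreasing_seq x.
  by apply/nondecreasing_seqP => n; have /andP[] := hx n.
have up_ni m n : (m <= n)%N -> x n + p / 2 ^+ n <= x m + p / 2 ^+ m.
  elim: n => [|n IH]; first by rewrite leqn0 => /eqP ->.
  rewrite leq_eqVlt => /predU1P[-> //|/IH]; apply: le_trans.
  have /andP[_] := hx n; rewrite -(lerD2r (p / 2 ^+ n.+1)) => /le_trans; apply.
  by rewrite half_pow2; lra.
have ppos n : 0 <= p / 2 ^+ n by rewrite divr_ge0// exprn_ge0.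
have xub m n : x m <= x n + p / 2 ^+ n.
  have [mn|/ltnW nm] := leqP m n.
    by apply: le_trans (x_nd _ _ mn) _; rewrite lerDl.
  by apply: le_trans (up_ni _ _ nm); rewrite lerDl.
have xcv : cvgn x.
  apply: nondecreasing_is_cvgn => //; exists (x 0 + p / 2 ^+ 0) => _ [n _ <-].
  exact: xub.
exists (limn x) => n; apply/andP; split; first exact: nondecreasing_cvgn_le.
by apply: limr_le => //; apply: nearW => m; exact: xub.
Qed.

(** Bisection separated from contour integration: when badness is inherited by some quarter, the
    nested bad rectangles shrink to a point lying in all of them. *)
Lemma quarter_limit (bad : R -> R -> R -> R -> Prop) (x y p q : R) :
  0 <= p -> 0 <= q -> bad p q x y ->
  (forall p q x y, 0 <= p -> 0 <= q -> bad p q x y -> exists k m : bool,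
     bad (p / 2) (q / 2) (x + k%:R * (p / 2)) (y + m%:R * (q / 2))) ->
  exists s t, [/\ x <= s <= x + p, y <= t <= y + q &
    forall e, 0 < e -> exists p' q' x' y',
      [/\ 0 <= p', 0 <= q', p' + q' <= e & bad p' q' x' y'] /\
      [/\ x' <= s <= x' + p', y' <= t <= y' + q', x <= x', x' + p' <= x + p &
         (y <= y') && (y' + q' <= y + q)]].
Proof.
move=> p0 q0 bad0 step.
(* The corner is bundled with its proof of badness, so that the choice of a bad quarter can be
   iterated by recursion. *)
pose S n := {xy : R * R | bad (p / 2 ^+ n) (q / 2 ^+ n) xy.1 xy.2}.
have nxt n (s : S n) : {km : bool * bool |
    bad (p / 2 ^+ n.+1) (q / 2 ^+ n.+1)
      ((sval s).1 + km.1%:R * (p / 2 ^+ n.+1))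
      ((sval s).2 + km.2%:R * (q / 2 ^+ n.+1))}.
  apply: cid; case: s => [[u v] /= bs].
  have := step _ _ _ _ _ _ bs; rewrite !divr_ge0 ?exprn_ge0// => /(_ isT isT).
  move=> [k [m]]; exists (k, m) => /=.
  by rewrite !half_pow2.
have bad0' : bad (p / 2 ^+ 0) (q / 2 ^+ 0) (x, y).1 (x, y).2.
  by rewrite expr0 !divr1.
pose s := fix s n : S n := match n return S n with
  | 0 => exist _ (x, y) bad0'
  | n'.+1 => exist _ ((sval (s n')).1 + (sval (nxt n' (s n'))).1%:R * (p / 2 ^+ n'.+1),
                      (sval (s n')).2 + (sval (nxt n' (s n'))).2%:R * (q / 2 ^+ n'.+1))
               (svalP (nxt n' (s n')))
  end.
pose X (n : nat) := (sval (s n)).1; pose Y (n : nat) := (sval (s n)).2.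
have bXY n : bad (p / 2 ^+ n) (q / 2 ^+ n) (X n) (Y n) by exact: (svalP (s n)).
have pos (r : R) (n : nat) : 0 <= r -> 0 <= r / 2 ^+ n.
  by move=> r0; rewrite divr_ge0// exprn_ge0.
have bump (k : bool) (u r : R) : 0 <= r -> u <= u + k%:R * r <= u + r.
  by case: k => r0; rewrite ?mul1r ?mul0r ?addr0 !lerDl ?lexx ?r0.
have hX n : X n <= X n.+1 <= X n + p / 2 ^+ n.+1 by apply: bump; exact: pos.
have hY n : Y n <= Y n.+1 <= Y n + q / 2 ^+ n.+1 by apply: bump; exact: pos.
have [a ha] := nested_limit p0 hX; have [b hb] := nested_limit q0 hY.
have mono (r : R) (u : nat -> R) : 0 <= r -> 
    (forall n : nat, u n <= u n.+1 <= u n + r / 2 ^+ n.+1) -> forall n : nat,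
    u 0 <= u n /\ u n + r / 2 ^+ n <= u 0 + r.
  move=> r0 hu; elim=> [|n [IH1 IH2]]; first by rewrite expr0 divr1.
  have /andP[h1 h2] := hu n; split; first exact: le_trans h1.
  apply: le_trans IH2; rewrite -(lerD2r (r / 2 ^+ n.+1)) in h2.
  by apply: le_trans h2 _; rewrite half_pow2; lra.
exists a, b; split.
- by have := ha 0; rewrite expr0 divr1.
- by have := hb 0; rewrite expr0 divr1.
move=> e e0; have [n hn] : exists n : nat, p / 2 ^+ n + q / 2 ^+ n <= e.
  have : ((p + q) * (1 / 2) ^+ n @[n --> \oo] --> (p + q) * 0).
    apply: cvgM; first exact: cvg_cst.
    by apply: cvg_expr; rewrite ger0_norm// ?divr_ge0// ltr_pdivrMr// mul1r ltr1n.
  rewrite mulr0 => /cvgr0_norm_le/(_ _ e0)[n _ /(_ n (leqnn n))/=] hn.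
  exists n; rewrite -mulrDl; apply: le_trans hn; apply: le_trans (ler_norm _).
  by rewrite expr_div_n expr1n div1r.
exists (p / 2 ^+ n), (q / 2 ^+ n), (X n), (Y n); split.
  by split => //; exact: pos.
have [? ?] := mono p X p0 hX n; have [h1 h2] := mono q Y q0 hY n.
by split => //; rewrite h1 h2.
Qed.

Lemma normc_ge_coords (x y s t p q : R) : x <= s <= x + p -> y <= t <= y + q ->
  forall u v, x <= u <= x + p -> y <= v <= y + q ->
  normc ((u +i* v) - (s +i* t)) <= p + q.
Proof.
move=> /andP[s1 s2] /andP[t1 t2] u v /andP[u1 u2] /andP[v1 v2].
apply: le_trans (normc_le_ReIm _) _ => /=.
by apply: lerD; rewrite ler_norml; apply/andP; split; lra.
Qed.

Lemma rint_quarters F x y p q (u := x + p / 2) (v := y + q / 2) :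
  0 <= p -> 0 <= q ->
  (forall s t, x <= s <= x + p -> y <= t <= y + q -> cdiffable F (s +i* t)) ->
  rint F x (x + p) y (y + q) = (rint F x u y v + rint F x u v (y + q)) +
    (rint F u (x + p) y v + rint F u (x + p) v (y + q)).
Proof.
move=> p0 q0 hF.
have xu : x <= u by rewrite lerDl divr_ge0.
have yv : y <= v by rewrite lerDl divr_ge0.
have ux : u <= x + p by rewrite lerD2l ler_pdivrMr// mulr_natr mulr2n lerDl.
have vy : v <= y + q by rewrite lerD2l ler_pdivrMr// mulr_natr mulr2n lerDl.
have xx := le_trans xu ux; have yy := le_trans yv vy.
rewrite (@rint_vcut F x u); first last.
- by move=> s t hs [] ->; apply: hF; rewrite ?lexx ?yy.
- by rewrite xu.
rewrite (@rint_hcut F x u y v); first last.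
- by move=> s t hs [] ->; apply: hF; rewrite ?lexx ?xx ?xu.
- by rewrite yv.
rewrite (@rint_hcut F u (x + p) y v)//.
- by rewrite yv.
- by move=> s t hs [] ->; apply: hF; rewrite ?lexx ?xx ?xu.
Qed.

(* Cousin-style bisection: the bound [eps * (width + height)^2] is additive under
   quartering and holds on small rectangles around every point. *)
Lemma goursat F a b c d : a <= b -> c <= d ->
  (forall x y, a <= x <= b -> c <= y <= d -> cdiffable F (x +i* y)) ->
  rint F a b c d = 0.
Proof.
move=> ab cd hF; apply/eqP; rewrite -normc_eq0.
suff main e : 0 < e -> normc (rint F a b c d) <= e * ((b - a) + (d - c)) ^+ 2.
  rewrite eq_le normc_ge0 andbT; apply/ler_addgt0Pr => e e0; rewrite add0r.
  pose S := ((b - a) + (d - c)) ^+ 2 + 1.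
  have S0 : 0 < S by rewrite ltr_wpDl// sqr_ge0.
  apply: (le_trans (main (e / S) _)); first exact: divr_gt0.
  rewrite mulrAC ler_pdivrMr// ler_wpM2l ?(ltW e0)//.
  by rewrite /S lerDl.
move=> e0; rewrite leNgt; apply/negP => bad0.
pose bad p q x y := [/\ a <= x, x + p <= b, c <= y, y + q <= d &
   e * (p + q) ^+ 2 < normc (rint F x (x + p) y (y + q))].
have [|||p q x y p0 q0 [ax xb cy yd hb]|s [t [hs ht hst]]] :=
    @quarter_limit bad a c (b - a) (d - c).
- by rewrite subr_ge0.
- by rewrite subr_ge0.
- rewrite /bad (_ : a + (b - a) = b); last by ring.
  by rewrite (_ : c + (d - c) = d); [split; rewrite ?lexx|ring].
- have p2 : 0 <= p / 2 by rewrite divr_ge0.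
  have q2 : 0 <= q / 2 by rewrite divr_ge0.
  apply: contrapT => /forallNP hn; move: hb; apply/negP; rewrite -leNgt.
  have xx : x + p / 2 + p / 2 = x + p by field.
  have yy : y + q / 2 + q / 2 = y + q by field.
  rewrite rint_quarters//; last first.
    move=> s t /andP[s1 s2] /andP[t1 t2]; apply: hF.
      by rewrite (le_trans ax s1) (le_trans s2 xb).
    by rewrite (le_trans cy t1) (le_trans t2 yd).
  have -> : e * (p + q) ^+ 2 = (e * (p / 2 + q / 2) ^+ 2 + e * (p / 2 + q / 2) ^+ 2)
     + (e * (p / 2 + q / 2) ^+ 2 + e * (p / 2 + q / 2) ^+ 2) by field.
  have bump (k : bool) (u r w : R) : 0 <= r -> u + r + r <= w ->
      u <= u + k%:R * r /\ u + k%:R * r + r <= w.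
    move=> r0 uw; have ur : u + r <= u + r + r by rewrite lerDl.
    by case: k; rewrite ?mul1r ?mul0r ?addr0 ?lerDl; split=> //; exact: le_trans uw.
  have good (k m : bool) : normc (rint F (x + k%:R * (p / 2)) (x + k%:R * (p / 2) + p / 2)
       (y + m%:R * (q / 2)) (y + m%:R * (q / 2) + q / 2)) <= e * (p / 2 + q / 2) ^+ 2.
    rewrite leNgt; apply/negP => hk; apply: (hn k); exists m.
    have [|k1 k2] := bump k x _ b p2; first by rewrite xx.
    have [|m1 m2] := bump m y _ d q2; first by rewrite yy.
    by split => //; [exact: le_trans ax k1|exact: le_trans cy m1].
  have := good false false; have := good false true.
  have := good true false; have := good true true.
  rewrite !mul0r !mul1r !addr0 xx yy => h11 h10 h01 h00.
  apply: le_trans (le_normcD _ _) _; apply: lerD;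
    by apply: le_trans (le_normcD _ _) _; apply: lerD.
have sab : a <= s <= b by move: hs; rewrite addrC subrK.
have tcd : c <= t <= d by move: ht; rewrite addrC subrK.
have [D hD] := hF _ _ sab tcd.
have e4 : 0 < e / 4 by rewrite divr_gt0.
have [r r0 hr] := hD _ e4.
have [p [q [x [y [[p0 q0 pq [ax xb cy yd hb]] [h1 h2 _ _ _]]]]]] := hst _ r0.
move: hb; apply/negP; rewrite -leNgt.
pose z := s +i* t.
(* The affine part of F at the limit point integrates to zero, so F may be replaced by its
   remainder, at most e/4 (p + q) on the boundary; the 4 cancels the constant of [normc_rint_le]. *)
pose E w := F w + - 1 * ((F z - D * z) + D * w).
have xp : x <= x + p by rewrite lerDl.
have yq : y <= y + q by rewrite lerDl.
have dF : cdiff_edges F x (x + p) y (y + q).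
  apply: cdiff_edges_rect => // u v /andP[u1 u2] /andP[v1 v2]; apply: hF.
    by rewrite (le_trans ax u1) (le_trans u2 xb).
  by rewrite (le_trans cy v1) (le_trans v2 yd).
have dA w : cdiffable (fun w => (F z - D * z) + D * w) w.
  apply: cdiffableD; first exact: cdiffable_cst.
  by apply: cdiffableZ; exact: cdiffable_id.
have eA : cdiff_edges (fun w => (F z - D * z) + D * w) x (x + p) y (y + q).
  by split.
have eE : cdiff_edges E x (x + p) y (y + q).
  by case: dF => dF1 dF2; split=> u v hu hv; apply: cdiffableD; 
    [exact: dF1|exact: cdiffableZ|exact: dF2|exact: cdiffableZ].
have -> : rint F x (x + p) y (y + q) = rint E x (x + p) y (y + q).
  rewrite rintD//; last by split=> *; exact: cdiffableZ.
  by rewrite rintZ// rint_affine// mulr0 addr0.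
have hE u v : x <= u <= x + p -> y <= v <= y + q -> normc (E (u +i* v)) <= e / 4 * (p + q).
  move=> hu hv; have hz := normc_ge_coords h1 h2 hu hv.
  rewrite /E (_ : _ + _ = F (z + ((u +i* v) - z)) - F z - D * ((u +i* v) - z)).
    apply: le_trans (hr _ (le_trans hz pq)) _.
    by rewrite ler_wpM2l// ltW.
  by rewrite [z + _]addrC subrK; ring.
apply: (le_trans (@normc_rint_le E _ _ _ _ (e / 4 * (p + q)) xp yq eE _ _)).
- by move=> u v hu [] ->; apply: hE => //; rewrite lexx ?yq.
- by move=> u v hu [] ->; apply: hE => //; rewrite lexx ?xp.
rewrite le_eqVlt; apply/orP; left; apply/eqP; by field.
Qed.

(** Cut along the lines of the inner rectangle: the four outer pieces vanish by Goursat.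
    Differentiability is required only off the open inner rectangle, where a singularity may sit. *)
Lemma rint_nested F a a' b' b c c' d' d : a <= a' -> a' <= b' -> b' <= b ->
  c <= c' -> c' <= d' -> d' <= d ->
  (forall x y, a <= x <= b -> c <= y <= d -> ~~ ((a' < x < b') && (c' < y < d')) ->
     cdiffable F (x +i* y)) ->
  rint F a b c d = rint F a' b' c' d'.
Proof.
move=> aa ab bb cc cd dd hF.
have io x y : a <= x -> x <= b -> c <= y -> y <= d ->
    [|| x <= a', b' <= x, y <= c' | d' <= y] -> cdiffable F (x +i* y).
  by move=> *; apply: hF; rewrite ?negb_and -?leNgt -?orbA//; apply/andP; split.
rewrite (@rint_vcut F a a'); first last.
- by move=> x y /andP[? ?] [] ->; apply: io; rewrite ?cc ?dd ?orbT//; lra.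
- by apply/andP; split; lra.
rewrite (@rint_vcut F a' b'); first last.
- by move=> x y /andP[? ?] [] ->; apply: io; rewrite ?cc ?dd ?orbT//; lra.
- by apply/andP; split; lra.
rewrite (@goursat F a a')//; last 2 first.
- by lra.
- by move=> x y /andP[? xa] /andP[? ?]; apply: io; rewrite ?xa//; lra.
rewrite (@goursat F b' b)//; last 2 first.
- by lra.
- by move=> x y /andP[xb ?] /andP[? ?]; apply: io; rewrite ?xb ?orbT//; lra.
rewrite add0r addr0.
rewrite (@rint_hcut F a' b' c c'); first last.
- by move=> x y /andP[? ?] [] ->; apply: io; rewrite ?lexx ?orbT//; lra.
- by apply/andP; split; lra.
rewrite (@rint_hcut F a' b' c' d'); first last.
- by move=> x y /andP[? ?] [] ->; apply: io; rewrite ?lexx ?orbT//; lra.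
- by apply/andP; split; lra.
rewrite (@goursat F a' b' c c')//; last first.
  by move=> x y /andP[? ?] /andP[? yc]; apply: io; rewrite ?yc ?orbT//; lra.
rewrite (@goursat F a' b' d' d)//; last first.
  by move=> x y /andP[? ?] /andP[yc ?]; apply: io; rewrite ?yc ?orbT//; lra.
by rewrite add0r addr0.
Qed.

End RectangleIntegral.

(** * Cauchy's formula and Taylor expansion of entire functions *)

Section Cauchy.
Context {R : realType}.
Local Notation normc := Normc.normc.
Implicit Types (F G : R[i] -> R[i]).

(** Squares centred at 0 play the part of circles, so that every contour deformation reduces to
    Goursat's theorem on rectangles. *)
Definition sq F (r : R) : R[i] := rint F (- r) r (- r) r.

Lemma cdiffableV G (z : R[i]) w : z - w != 0 -> cdiffable (fun u => (u - w)^-1) z.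
Proof. by move=> zw; exists (- (z - w) ^- 2); apply: cdiff_shift; exact: cdiffV. Qed.

Definition on_edge (r : R) (z : R[i]) : Prop :=
  (`|complex.Re z| <= r /\ `|complex.Im z| = r) \/
  (`|complex.Im z| <= r /\ `|complex.Re z| = r).

Lemma on_edge_ge r z : on_edge r z -> r <= normc z.
Proof.
by case=> -[_ <-]; [exact: normc_Im|exact: normc_Re].
Qed.

Lemma on_edge_neq0 r z : 0 < r -> on_edge r z -> z != 0.
Proof. by move=> r0 /on_edge_ge h; rewrite -normc_gt0; exact: lt_le_trans h. Qed.

Lemma on_edge_h (r x y : R) : 0 <= r -> - r <= x <= r -> (y = - r \/ y = r) ->
  on_edge r (x +i* y).
Proof.
move=> r0 hx hy; left => /=; split; first by rewrite ler_norml.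
by case: hy => ->; rewrite ?normrN ger0_norm.
Qed.

Lemma on_edge_v (r x y : R) : 0 <= r -> - r <= y <= r -> (x = - r \/ x = r) ->
  on_edge r (x +i* y).
Proof.
move=> r0 hx hy; right => /=; split; first by rewrite ler_norml.
by case: hy => ->; rewrite ?normrN ger0_norm.
Qed.

Lemma cdiff_edges_sq F r : 0 <= r -> (forall z, on_edge r z -> cdiffable F z) ->
  cdiff_edges F (- r) r (- r) r.
Proof.
by move=> r0 hF; split=> x y hx hy; apply: hF; [exact: on_edge_h|exact: on_edge_v].
Qed.

Lemma sqD F G r : 0 <= r -> (forall z, on_edge r z -> cdiffable F z) ->
  (forall z, on_edge r z -> cdiffable G z) ->
  sq (fun z => F z + G z) r = sq F r + sq G r.
Proof. by move=> r0 hF hG; apply: rintD; exact: cdiff_edges_sq. Qed.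

Lemma sqZ F k r : 0 <= r -> (forall z, on_edge r z -> cdiffable F z) ->
  sq (fun z => k * F z) r = k * sq F r.
Proof. by move=> r0 hF; apply: rintZ; exact: cdiff_edges_sq. Qed.

Lemma eq_sq F G r : 0 <= r -> (forall z, on_edge r z -> F z = G z) ->
  sq F r = sq G r.
Proof.
by move=> r0 FG; apply: eq_rint => x y hx hy; apply: FG;
  [exact: on_edge_h|exact: on_edge_v].
Qed.

Lemma normc_sq_le F r B : 0 <= r -> (forall z, on_edge r z -> cdiffable F z) ->
  (forall z, on_edge r z -> normc (F z) <= B) -> normc (sq F r) <= 16 * r * B.
Proof.
move=> r0 dF hF.
apply: (le_trans (@normc_rint_le _ F _ _ _ _ B _ _ (cdiff_edges_sq r0 dF) _ _)).
- by rewrite ge0_cp.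
- by rewrite ge0_cp.
- by move=> x y hx hy; apply: hF; exact: on_edge_h.
- by move=> x y hx hy; apply: hF; exact: on_edge_v.
- by rewrite le_eqVlt; apply/orP; left; apply/eqP; ring.
Qed.

Lemma sq_shrink F (r x y s : R) : 0 <= s -> - r <= x - s -> x + s <= r ->
  - r <= y - s -> y + s <= r ->
  (forall z, normc (z - (x +i* y)) >= s -> cdiffable F z) ->
  sq F r = rint F (x - s) (x + s) (y - s) (y + s).
Proof.
move=> s0 *; apply: rint_nested => //; try lra.
move=> u v _ _ huv; match goal with h : forall z, _ -> cdiffable F z |- _ => apply: h end.
move: huv; rewrite negb_and !negb_and -!leNgt.
have cs : s <= `|u - x| \/ s <= `|v - y| -> s <= normc ((u +i* v) - (x +i* y)).
  by case=> h; apply: le_trans h _; [exact: (normc_Re ((u +i* v) - (x +i* y)))|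
    exact: (normc_Im ((u +i* v) - (x +i* y)))].
by move=> /orP[/orP[]|/orP[]] h; apply: cs; [left|left|right|right];
  rewrite ler_normr; apply/orP; [right|left|right|left]; lra.
Qed.

Lemma sq_eq F (r s : R) : 0 < r -> r <= s ->
  (forall z, z != 0 -> cdiffable F z) -> sq F s = sq F r.
Proof.
move=> r0 rs hF; rewrite (@sq_shrink F s 0 0 r) ?add0r ?sub0r ?lerN2 ?(ltW r0)//.
move=> z; rewrite (_ : 0 +i* 0 = 0)// subr0 => h.
by apply: hF; rewrite -normc_gt0; exact: lt_le_trans h.
Qed.

Lemma edge_bounded F (r : R) : 0 <= r -> (forall z, on_edge r z -> cdiffable F z) ->
  exists2 B, 0 < B & forall z, on_edge r z -> normc (F z) <= B.
Proof.
move=> r0 hF.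
have seg (w : R -> R[i]) : (forall s u, normc (w s - w u) <= `|s - u|) ->
    (forall t, - r <= t <= r -> on_edge r (w t)) ->
    exists B, forall t, - r <= t <= r -> normc (F (w t)) <= B.
  move=> wl hw.
  have rr : - r <= r by rewrite ge0_cp.
  have cR : {within `[- r, r], continuous (fun t => complex.Re (F (w t)))}.
    apply: continuous_in_subspaceT => t; rewrite inE/= in_itv/= => /hw/hF ht.
    by have [] := continuous_along wl ht.
  have cI : {within `[- r, r], continuous (fun t => complex.Im (F (w t)))}.
    apply: continuous_in_subspaceT => t; rewrite inE/= in_itv/= => /hw/hF ht.
    by have [] := continuous_along wl ht.
  have [p _ hp] := EVT_max rr cR; have [p' _ hp'] := EVT_min rr cR.
  have [q _ hq] := EVT_max rr cI; have [q' _ hq'] := EVT_min rr cI.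
  exists ((`|complex.Re (F (w p))| + `|complex.Re (F (w p'))|) +
          (`|complex.Im (F (w q))| + `|complex.Im (F (w q'))|)) => t ht.
  have ht' : t \in `[- r, r] by rewrite in_itv.
  have ab (u v x : R) : u <= x -> x <= v -> `|x| <= `|v| + `|u|.
    move=> ux xv; rewrite ler_norml; apply/andP; split.
      have := ler_norm (- u); rewrite normrN; have := normr_ge0 v; lra.
    have := ler_norm v; have := normr_ge0 u; lra.
  apply: le_trans (normc_le_ReIm _) _; apply: lerD; apply: ab.
  - exact: hp'.
  - exact: hp.
  - exact: hq'.
  - exact: hq.
have [B1 h1] := seg (fun t => t +i* (- r)) (@hline_lip R (- r)) (fun t ht => on_edge_h r0 ht (or_introl erefl)).
have [B2 h2] := seg (fun t => t +i* r) (@hline_lip R r) (fun t ht => on_edge_h r0 ht (or_intror erefl)).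
have [B3 h3] := seg (fun t => (- r) +i* t) (@vline_lip R (- r)) (fun t ht => on_edge_v r0 ht (or_introl erefl)).
have [B4 h4] := seg (fun t => r +i* t) (@vline_lip R r) (fun t ht => on_edge_v r0 ht (or_intror erefl)).
exists (`|B1| + `|B2| + `|B3| + `|B4| + 1) => [|[x y]].
  by rewrite ltr_wpDl// !addr_ge0.
have n1 := ler_norm B1; have n2 := ler_norm B2; have n3 := ler_norm B3; have n4 := ler_norm B4.
have p1 := normr_ge0 B1; have p2 := normr_ge0 B2; have p3 := normr_ge0 B3; have p4 := normr_ge0 B4.
have sg (t : R) : `|t| = r -> t = - r \/ t = r.
  by case: (ler0P t) => ? <-; [left; rewrite opprK|right].
by case=> /= -[]; rewrite ler_norml => ht /sg[]->;
  [have := h1 _ ht|have := h2 _ ht|have := h3 _ ht|have := h4 _ ht]; lra.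
Qed.

(* Equal to [2 pi i]; only [kap != 0] matters. *)
Definition kap : R[i] := sq (fun z => z^-1) 1.

Lemma cdiffable_inv (z : R[i]) : z != 0 -> cdiffable (fun z => z^-1) z.
Proof. by move=> z0; exists (- z ^- 2); exact: cdiffV. Qed.

(** Each of the four sides contributes the integral of 1 / (1 + t^2) over [-1, 1] to the imaginary
    part, and that integrand is at least 1/2. *)
Lemma kap_neq0 : kap != 0.
Proof.
have invE (x y : R) : ((x +i* y)^-1 : R[i]) =
    (x / (x ^+ 2 + y ^+ 2)) +i* - (y / (x ^+ 2 + y ^+ 2)) by [].
pose g (t : R) := (1 + t ^+ 2)^-1.
have g0 (t : R) : 0 < 1 + t ^+ 2 by rewrite ltr_pwDl// sqr_ge0.
have r0 : (0 : R) <= 1 by [].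
have dV := fun z hz => @cdiffable_inv z (on_edge_neq0 (@ltr01 R) hz).
have [[_ i1] _ _ _] := cdiff_edges_integrable (cdiff_edges_sq r0 dV).
pose I := (\int[lebesgue_measure]_(t in `[-1, 1]) g t)%R.
have gi : lebesgue_measure.-integrable `[-1, 1] (EFin \o g).
  apply: eq_integrable i1 => //.
  move=> t _ /=; congr EFin; rewrite /g; field.
  by rewrite gt_eqF//= addrC -expr2 g0.
have negI (f : R -> R) : (forall t, f t = - g t) ->
    (\int[lebesgue_measure]_(t in `[-1, 1]) f t)%R = - I.
  move=> fg; transitivity (\int[lebesgue_measure]_(t in `[-1, 1]) (-1 * g t))%R.
    by apply: eq_Rintegral => t _; rewrite fg mulN1r.
  by rewrite RintegralZl// mulN1r.
have ImE (A B C D : R[i]) : complex.Im (A - B + (0 +i* 1) * (C - D)) =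
    complex.Im A - complex.Im B + (complex.Re C - complex.Re D).
  by case: A B C D => [? ?] [? ?] [? ?] [? ?] /=; ring.
have nz (t : R) : (t ^+ 2 + 1 != 0) by rewrite gt_eqF// addrC.
have Imk : complex.Im kap = 4 * I.
  rewrite /kap /sq /rint ImE /hseg /vseg /cintegral.
  rewrite [X in X - _ + _](_ : _ = I); last first.
    by apply: eq_Rintegral => t _; rewrite invE /g/= mulN1r opprK sqrrN expr1n addrC.
  rewrite [X in _ - X + _](_ : _ = - I); last first.
    by apply: negI => t; rewrite invE /g/= expr1n mul1r addrC.
  rewrite [X in _ + (X - _)](_ : _ = I); last first.
    by apply: eq_Rintegral => t _; rewrite invE /g/= expr1n mul1r.
  rewrite [X in _ + (_ - X)](_ : _ = - I); last first.
    by apply: negI => t; rewrite invE /g/= sqrrN expr1n mulN1r.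
  ring.
have : 1 <= I.
  have c2 : (\int[lebesgue_measure]_(t in `[-1, 1]) (2^-1 : R))%R = 1 :> R.
    by rewrite Rintegral_cst_itv; [field|lra].
  rewrite -c2; apply: le_Rintegral => //.
  - apply/integrableP; split; first exact: measurable_cst.
    under eq_integral do rewrite /= ger0_norm//.
    rewrite integral_cst//= lebesgue_measure_itv/=.
    by case: ifPn => _; rewrite ?mule0 ?ltry// -EFinB -EFinM ltry.
  - move=> t /=; rewrite in_itv/= => /andP[t1 t2].
    rewrite /g lef_pV2 ?posrE//; nra.
move=> h; rewrite eq_complex negb_and Imk; apply/orP; right.
by rewrite gt_eqF//=; lra.
Qed.

Lemma geometric_expansion (z w : R[i]) N : w != 0 -> w - z != 0 ->
  (w - z)^-1 = \sum_(j < N) z ^+ j * w ^- j.+1 + z ^+ N * (w ^- N * (w - z)^-1).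
Proof.
move=> w0 wz; elim: N => [|N IH].
  by rewrite big_ord0 add0r !expr0 invr1 !mul1r.
transitivity (\sum_(j < N) z ^+ j * w ^- j.+1 + z ^+ N * (w ^- N * (w - z)^-1)) => //.
rewrite big_ord_recr/= -addrA; congr (_ + _).
rewrite !exprS; field.
by rewrite w0 wz expf_neq0.
Qed.

Lemma small_eq0 (a K : R) : 0 <= a -> (forall e : R, 0 < e -> e <= 1 -> a <= K * e) -> a = 0.
Proof.
move=> a0 ha; apply/eqP; rewrite eq_le a0 andbT.
apply/ler_addgt0Pr => e e0; rewrite add0r.
have K0 : 0 < `|K| + 1 by rewrite ltr_wpDl.
have m0 : 0 < Num.min 1 (e / (`|K| + 1)) by rewrite lt_min ltr01 divr_gt0.
apply: (le_trans (ha _ m0 _)); first by rewrite ge_min lexx.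
apply: (@le_trans _ _ ((`|K| + 1) * (e / (`|K| + 1)))).
  apply: le_trans (ler_wpM2r (ltW m0) (ler_norm K)) _.
  apply: ler_pM; rewrite ?(ltW m0)// ?lerDl//.
  by rewrite ge_min lexx orbT.
by rewrite mulrC divfK ?gt_eqF.
Qed.

Lemma sub_neq0 (z w : R[i]) r : normc z < r -> r <= normc w -> w - z != 0.
Proof.
move=> zr rw; apply/negP => /eqP/subr0_eq wz.
by move: zr; rewrite -wz ltNge rw.
Qed.

(** On a large square of half-side s, 1/(w - z) differs from 1/w by z / ((w - z) w), of size
    O(s^{-2}) on a contour of length O(s). Neither integral changes as s grows, so they are
    equal. *)
Lemma sq_inv_shift (z : R[i]) (r : R) : normc z < r -> 1 <= r ->
  sq (fun w => (w - z)^-1) r = kap.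
Proof.
move=> zr r1; have rpos : 0 < r by lra.
have z0 := normc_ge0 z.
have hk s : r <= s -> sq (fun w => (w - z)^-1) s = sq (fun w => (w - z)^-1) r.
  move=> rs; rewrite (@sq_shrink _ s 0 0 r) ?add0r ?sub0r ?lerN2 ?(ltW rpos)//.
  move=> w; rewrite (_ : 0 +i* 0 = 0)// subr0 => rw.
  by apply: cdiffableV => //; exact: sub_neq0 zr rw.
apply: subr0_eq; apply/eqP; rewrite -normc_eq0; apply/eqP.
apply: (@small_eq0 _ (32 * normc z / (r + 2 * normc z))); first exact: normc_ge0.
move=> e e0 e1.
(* Ensures |z| <= s/2, hence |w - z| >= s/2 on the contour, and makes the error proportional to
   [e]. *)
pose s := (r + 2 * normc z) / e.
have rs : r + 2 * normc z <= s by rewrite ler_pdivlMr// ler_piMr//; lra.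
have s0 : 0 < s by lra.
have rs' : r <= s by lra.
have zs : normc z < s by lra.
rewrite -(hk s rs') /kap -(@sq_eq _ 1 s) ?ltr01//; last 2 first.
- exact: le_trans r1 rs'.
- exact: cdiffable_inv.
have dz w : on_edge s w -> cdiffable (fun w => (w - z)^-1) w.
  by move=> /on_edge_ge sw; apply: cdiffableV => //; exact: sub_neq0 zs sw.
have d0 w : on_edge s w -> cdiffable (fun w => w^-1) w.
  by move=> /(on_edge_neq0 s0); exact: cdiffable_inv.
have dp w : on_edge s w -> cdiffable (fun w => z * ((w - z)^-1 * w^-1)) w.
  by move=> hw; apply: cdiffableZ; apply: cdiffableM; [exact: dz|exact: d0].
rewrite (@eq_sq (fun w => (w - z)^-1) (fun w => w^-1 + z * ((w - z)^-1 * w^-1)) s (ltW s0)); last first.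
  move=> w hw; have w0 := on_edge_neq0 s0 hw.
  have wz := sub_neq0 zs (on_edge_ge hw).
  by field; rewrite w0 wz.
rewrite sqD ?(ltW s0)// addrC addKr.
apply: (le_trans (@normc_sq_le _ s (normc z * (2 / (s * s))) (ltW s0) dp _)).
  move=> w hw; have sw := on_edge_ge hw.
  have wz : s / 2 <= normc (w - z).
    have := le_normcD (w - z) z; rewrite subrK; lra.
  rewrite !Normc.normcM !Normc.normcV; apply: ler_wpM2l => //.
  rewrite invfM mulrA; apply: ler_pM; rewrite ?invr_ge0 ?normc_ge0//.
    have wp : 0 < normc (w - z) by lra.
    by rewrite ler_pdivlMr// ler_pdivrMl//; lra.
  by rewrite lef_pV2 ?posrE//; exact: lt_le_trans sw.
rewrite /s le_eqVlt; apply/orP; left; apply/eqP; field.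
by rewrite !gt_eqF//; lra.
Qed.

(** Split off F(z)/(w - z). The remaining difference quotient is bounded by 1 + |F'(z)| near z, and
    its contour can be shrunk to a small square around z, where the integral is proportional to the
    side. *)
Lemma cauchy_formula F (z : R[i]) (r : R) : (forall w, cdiffable F w) ->
  normc z < r -> 1 <= r -> sq (fun w => F w * (w - z)^-1) r = F z * kap.
Proof.
move=> hF zr r1; have rpos : 0 < r by lra.
have z0 := normc_ge0 z.
have dz w : on_edge r w -> cdiffable (fun w => (w - z)^-1) w.
  by move=> /on_edge_ge sw; apply: cdiffableV => //; exact: sub_neq0 zr sw.
pose G w := (F w + - F z) * (w - z)^-1.
have dG w : w - z != 0 -> cdiffable G w.
  move=> wz; apply: cdiffableM; last exact: cdiffableV.
  by apply: cdiffableD => //; exact: cdiffable_cst.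
have dGe w : on_edge r w -> cdiffable G w.
  by move=> /on_edge_ge sw; apply: dG; exact: sub_neq0 zr sw.
rewrite (@eq_sq _ (fun w => F z * (w - z)^-1 + G w) r (ltW rpos)); last first.
  by move=> w _; rewrite /G -mulrDl; congr (_ * _); rewrite addrC subrK.
rewrite sqD ?(ltW rpos)//; last by move=> w /dz; exact: cdiffableZ.
rewrite sqZ ?(ltW rpos)// sq_inv_shift//.
apply/eqP; rewrite -subr_eq0 addrC addKr -normc_eq0; apply/eqP.
have [d /cdiff_bounded[t t0 ht]] := hF z.
have m0 : 0 < Num.min (t / 2) (r - normc z) by rewrite lt_min divr_gt0//= subr_gt0.
apply: (@small_eq0 _ (16 * (1 + normc d) * Num.min (t / 2) (r - normc z))).
  exact: normc_ge0.
(* The bound t/2 keeps the small square, whose points are within 2s of z, where the difference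
   quotient is controlled; the bound r - |z| keeps it inside the large square. *)
move=> e e0 e1; pose s := e * Num.min (t / 2) (r - normc z).
have s0 : 0 < s by rewrite mulr_gt0.
have sm : s <= Num.min (t / 2) (r - normc z) by rewrite ler_piMl// ltW.
have st : s + s <= t.
  by have : s <= t / 2 by [apply: le_trans sm _; rewrite ge_min lexx]; lra.
have sr : s <= r - normc z by apply: le_trans sm _; rewrite ge_min lexx orbT.
have zE : z = complex.Re z +i* complex.Im z by case: (z).
have hx := normc_Re z; have hy := normc_Im z.
set x := complex.Re z in zE hx *; set y := complex.Im z in zE hy *.
have x1 := ler_norm x; have y1 := ler_norm y.
have x2 := ler_norm (- x); have y2 := ler_norm (- y); rewrite !normrN in x2 y2.
rewrite (@sq_shrink _ r x y s) ?(ltW s0)//; try lra; last first.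
  by move=> w; rewrite -zE => sw; apply: dG; rewrite -normc_gt0; exact: lt_le_trans sw.
have far u v : x - s <= u <= x + s -> y - s <= v <= y + s ->
    (u = x - s \/ u = x + s \/ v = y - s \/ v = y + s) ->
    s <= normc ((u +i* v) - z) /\ normc ((u +i* v) - z) <= t.
  move=> /andP[u1 u2] /andP[v1 v2] huv; split.
    have h1 := normc_Re ((u +i* v) - z); have h2 := normc_Im ((u +i* v) - z).
    rewrite {1}zE /= in h1; rewrite {1}zE /= in h2.
    by case: huv => [|[|[]]] huv; [apply: le_trans h1|apply: le_trans h1|
      apply: le_trans h2|apply: le_trans h2]; rewrite ler_normr; apply/orP;
      [right|left|right|left]; lra.
  apply: le_trans (normc_le_ReIm _) _; apply: le_trans st.
  by rewrite zE /=; apply: lerD; rewrite ler_norml; apply/andP; split; lra.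
have bG w : s <= normc (w - z) -> normc (w - z) <= t -> normc (G w) <= 1 + normc d.
  move=> w1 w2; have wp : 0 < normc (w - z) by exact: lt_le_trans w1.
  rewrite /G Normc.normcM Normc.normcV ler_pdivrMr//.
  by have := ht _ w2; rewrite [z + _]addrC subrK.
have xx : x - s <= x + s by lra.
have yy : y - s <= y + s by lra.
apply: (le_trans (@normc_rint_le _ G _ _ _ _ (1 + normc d) xx yy _ _ _)).
- split=> u v hu [] vE; apply: dG; rewrite -normc_gt0; apply: lt_le_trans s0 _;
    [apply: (proj1 (far u v hu _ _))|apply: (proj1 (far u v hu _ _))|
     apply: (proj1 (far u v _ hu _))|apply: (proj1 (far u v _ hu _))];
    rewrite ?vE ?lexx ?xx ?yy//; tauto.
- by move=> u v hu [] vE; apply: bG; [apply: (proj1 (far u v hu _ _))|apply: (proj2 (far u v hu _ _))|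
   apply: (proj1 (far u v hu _ _))|apply: (proj2 (far u v hu _ _))];
    rewrite ?vE ?lexx ?xx ?yy//; tauto.
- by move=> u v hu [] vE; apply: bG; [apply: (proj1 (far u v _ hu _))|apply: (proj2 (far u v _ hu _))|
   apply: (proj1 (far u v _ hu _))|apply: (proj2 (far u v _ hu _))];
    rewrite ?vE ?lexx ?xx ?yy//; tauto.
rewrite le_eqVlt; apply/orP; left; apply/eqP; rewrite /s; ring.
Qed.

(* [F] is the sum of [c_j z^j], in the strong form that the partial sums converge
   geometrically on every disc. *)
Definition pser (c : nat -> R[i]) (F : R[i] -> R[i]) : Prop :=
  forall r : R, exists K : R, forall (N : nat) (z : R[i]), normc z <= r ->
    normc (F z - \sum_(j < N) c j * z ^+ j) <= K * 2^-1 ^+ N.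

(** Cauchy's coefficient formula, with [kap] in place of 2 pi i. The square of half-side 1 serves
    for every radius, since the integrand is differentiable away from 0. *)
Definition taylor_coef F (j : nat) : R[i] :=
  kap^-1 * sq (fun w => F w * w ^- j.+1) 1.

Lemma cdiffable_invX (z : R[i]) n : z != 0 -> cdiffable (fun w => w ^- n) z.
Proof.
move=> z0; elim: n => [|n IH].
  by rewrite (_ : (fun w => _) = fun=> 1); [exact: cdiffable_cst|
    apply/funext => w; rewrite expr0 invr1].
rewrite (_ : (fun w => _) = fun w => w^-1 * w ^- n); last first.
  by apply/funext => w; rewrite exprS invfM.
by apply: cdiffableM => //; exact: cdiffable_inv.
Qed.

Lemma sq_sum (c : nat -> R[i]) (G : nat -> R[i] -> R[i]) r N : 0 <= r ->
  (forall j z, on_edge r z -> cdiffable (G j) z) ->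
  sq (fun w => \sum_(j < N) c j * G j w) r = \sum_(j < N) c j * sq (G j) r /\
  (forall z, on_edge r z -> cdiffable (fun w => \sum_(j < N) c j * G j w) z).
Proof.
move=> r0 hG; elim: N => [|N [IH1 IH2]].
  rewrite (_ : (fun w => _) = fun=> 0) ?big_ord0; last first.
    by apply/funext => w; rewrite big_ord0.
  split; last by move=> z _; exact: cdiffable_cst.
  by rewrite /sq /rint /hseg /vseg !subrr mulr0 addr0.
rewrite (_ : (fun w => _) = fun w => \sum_(j < N) c j * G j w + c N * G N w); last first.
  by apply/funext => w; rewrite big_ord_recr.
split.
  rewrite sqD//; last by move=> z hz; apply: cdiffableZ; exact: hG.
  by rewrite IH1 sqZ ?big_ord_recr// => z; exact: hG.
by move=> z hz; apply: cdiffableD; [exact: IH2|apply: cdiffableZ; exact: hG].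
Qed.

Lemma pser_taylor F : (forall w, cdiffable F w) -> pser (taylor_coef F) F.
Proof.
(* Gives |z| <= s/2 on the disc, whence the factor 2^{-N} from (z/w)^N, and |w - z| >= 1 on the
   contour. *)
move=> hF r; pose s := 2 * (`|r| + 1).
have r0 := normr_ge0 r.
have s0 : 0 < s by rewrite /s; lra.
have s1 : 1 <= s by rewrite /s; lra.
have [B B0 hB] := edge_bounded (ltW s0) (fun z _ => hF z).
exists (normc kap^-1 * (16 * s * B)) => N z zr.
have zs : normc z + 1 <= s / 2 by rewrite /s; have := ler_norm r; lra.
have zs' : normc z < s by have := normc_ge0 z; lra.
have dj j w : on_edge s w -> cdiffable (fun w => F w * w ^- j) w.
  by move=> /(on_edge_neq0 s0) w0; apply: cdiffableM => //; exact: cdiffable_invX.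
have dz w : on_edge s w -> cdiffable (fun w => F w * w ^- N * (w - z)^-1) w.
  move=> hw; apply: cdiffableM; first exact: dj.
  by apply: cdiffableV => //; exact: sub_neq0 zs' (on_edge_ge hw).
have main : F z * kap = \sum_(j < N) z ^+ j * sq (fun w => F w * w ^- j.+1) s +
    z ^+ N * sq (fun w => F w * w ^- N * (w - z)^-1) s.
  rewrite -(cauchy_formula hF zs' s1).
  have [<- dsum] := @sq_sum (fun j => z ^+ j) (fun j w => F w * w ^- j.+1) s N (ltW s0) (fun j => dj j.+1).
  rewrite -sqZ ?(ltW s0)// -sqD ?(ltW s0)//; last by move=> w /dz; exact: cdiffableZ.
  apply: eq_sq; first exact: ltW.
  move=> w hw; rewrite {1}(@geometric_expansion z w N (on_edge_neq0 s0 hw) (sub_neq0 zs' (on_edge_ge hw))).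
  rewrite mulrDr mulr_sumr; congr (_ + _); last ring.
  by apply: eq_bigr => j _; ring.
have cE j : sq (fun w => F w * w ^- j.+1) s = kap * taylor_coef F j.
  rewrite /taylor_coef mulrA divff ?kap_neq0// mul1r; apply: sq_eq => // w w0.
  by apply: cdiffableM => //; exact: cdiffable_invX.
have -> : F z - \sum_(j < N) taylor_coef F j * z ^+ j =
    kap^-1 * (z ^+ N * sq (fun w => F w * w ^- N * (w - z)^-1) s).
  apply: (mulfI kap_neq0); rewrite [RHS]mulrA divff ?kap_neq0// mul1r.
  rewrite mulrBr [kap * F z]mulrC main addrAC mulr_sumr -sumrB big1 ?add0r// => j _.
  by rewrite cE mulrCA [z ^+ j * _]mulrC subrr.
rewrite Normc.normcM -[leRHS]mulrA; apply: ler_wpM2l; first exact: normc_ge0.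
rewrite Normc.normcM normcX.
have bd w : on_edge s w -> normc (F w * w ^- N * (w - z)^-1) <= B * s ^- N.
  move=> hw; have sw := on_edge_ge hw.
  have wz : 1 <= normc (w - z) by have := le_normcD (w - z) z; rewrite subrK; lra.
  rewrite !Normc.normcM !Normc.normcV normcX -[leRHS]mulr1.
  apply: ler_pM; rewrite ?mulr_ge0 ?invr_ge0 ?exprn_ge0 ?normc_ge0//; last first.
    by rewrite invf_le1//; lra.
  apply: ler_pM; rewrite ?invr_ge0 ?exprn_ge0 ?normc_ge0//; first exact: hB.
  have wp : 0 < normc w by lra.
  rewrite lef_pV2 ?posrE; [|exact: exprn_gt0|exact: exprn_gt0].
  by apply: lerXn2r; rewrite ?nnegrE ?normc_ge0// ltW.
apply: (@le_trans _ _ ((s / 2) ^+ N * (16 * s * (B * s ^- N)))).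
  apply: ler_pM; rewrite ?exprn_ge0 ?normc_ge0//; last exact: normc_sq_le (ltW s0) dz bd.
  by rewrite lerXn2r ?nnegrE ?normc_ge0 ?divr_ge0 ?ltW//; lra.
rewrite expr_div_n exprVn le_eqVlt; apply/orP; left; apply/eqP; field.
by rewrite !expf_neq0// gt_eqF.
Qed.

End Cauchy.

(** * Power series *)

Section PowerSeries.
Context {R : realType}.
Local Notation normc := Normc.normc.
Implicit Types (c : nat -> R[i]) (F : R[i] -> R[i]).

Lemma le_geometric (a b K : R) : (forall N : nat, a <= b + K * 2^-1 ^+ N) -> a <= b.
Proof.
move=> h; have : b + K * 2^-1 ^+ n @[n --> \oo] --> b + K * 0.
  apply: cvgD; first exact: cvg_cst.
  apply: cvgM; first exact: cvg_cst.
  by apply: cvg_expr; rewrite ger0_norm ?invr_ge0// invf_lt1// ltr1n.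
rewrite mulr0 addr0 => hc; rewrite -(cvg_lim _ hc)//; apply: limr_ge.
  by apply/cvg_ex; exists b.
exact: nearW.
Qed.

Lemma sum_geometric_le (K : R) N : 0 <= K -> \sum_(j < N) K * 2^-1 ^+ j <= 2 * K.
Proof.
move=> K0; suff -> : \sum_(j < N) K * 2^-1 ^+ j = 2 * K - 2 * K * 2^-1 ^+ N.
  by rewrite lerBlDr lerDl mulr_ge0 ?mulr_ge0 ?exprn_ge0 ?invr_ge0.
elim: N => [|N IH]; first by rewrite big_ord0 expr0; ring.
by rewrite big_ord_recr/= IH exprS; field.
Qed.

Lemma normc_tail_le (u : nat -> R[i]) (K : R) N m :
  (forall j, normc (u j) <= K * 2^-1 ^+ j) ->
  normc (\sum_(j < N + m) u j - \sum_(j < N) u j) <= 2 * K * 2^-1 ^+ N.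
Proof.
move=> hu; have K0 : 0 <= K by have := hu 0; rewrite expr0 mulr1; exact/le_trans/normc_ge0.
have -> : \sum_(j < N + m) u j - \sum_(j < N) u j = \sum_(j < m) u (N + j)%N.
  by rewrite big_split_ord/= [X in X - _]addrC addrK.
apply: le_trans (normc_sum _ (fun j => u (N + j)%N)) _.
apply: (@le_trans _ _ (\sum_(j < m) (K * 2^-1 ^+ N) * 2^-1 ^+ j)).
  by apply: ler_sum => j _; apply: le_trans (hu _) _; rewrite exprD mulrA.
apply: le_trans (sum_geometric_le _ _) _; last by rewrite mulrA.
by rewrite mulr_ge0 ?exprn_ge0 ?invr_ge0.
Qed.

(** Infinite radius of convergence, stated as boundedness of the terms on every disc. *)
Definition growth c : Prop :=
  forall r : R, 0 <= r -> exists K : R, forall j, normc (c j) * r ^+ j <= K.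

Lemma growth_bound c (r : R) : growth c -> 0 <= r -> exists2 K, 0 <= K &
  forall j z, normc z <= r -> normc (c j * z ^+ j) <= K * 2^-1 ^+ j.
Proof.
move=> gc r0; have [|K hK] := gc (2 * r); first by rewrite mulr_ge0.
exists K => [|j z zr].
  by have := hK 0; rewrite expr0 mulr1; exact/le_trans/normc_ge0.
have := hK j; rewrite exprMn => h.
rewrite Normc.normcM normcX exprVn ler_pdivlMr ?exprn_gt0// -mulrA.
apply: le_trans h; apply: ler_wpM2l; first exact: normc_ge0.
rewrite mulrC ler_wpM2l ?exprn_ge0//.
by apply: lerXn2r; rewrite ?nnegrE ?normc_ge0.
Qed.

Lemma complex_series_cvg (u : nat -> R[i]) (K : R) :
  (forall j, normc (u j) <= K * 2^-1 ^+ j) -> exists l : R[i], forall N,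
  normc (l - \sum_(j < N) u j) <= 4 * K * 2^-1 ^+ N.
Proof.
move=> hu; have K0 : 0 <= K by have := hu 0; rewrite expr0 mulr1; exact/le_trans/normc_ge0.
have bs : bounded_sums (fun j => K * 2^-1 ^+ j).
  by exists (2 * K) => n; exact: sum_geometric_le.
pose re (j : nat) := complex.Re (u j); pose im (j : nat) := complex.Im (u j).
have cR : cvgn (series re).
  by apply: bounded_sums_normr_cvg bs => j; exact: le_trans (normc_Re _) (hu j).
have cI : cvgn (series im).
  by apply: bounded_sums_normr_cvg bs => j; exact: le_trans (normc_Im _) (hu j).
have ReS N : complex.Re (\sum_(j < N) u j) = series re N.
  by rewrite seriesEordf raddf_sum.
have ImS N : complex.Im (\sum_(j < N) u j) = series im N.
  by rewrite seriesEordf raddf_sum.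
have tl (v : nat -> R) N : cvgn v -> (forall m, `|v (N + m)%N - v N| <= 2 * K * 2^-1 ^+ N) ->
    `|limn v - v N| <= 2 * K * 2^-1 ^+ N.
  move=> cv hv; have : `|v n - v N| @[n --> \oo] --> `|limn v - v N|.
    by apply: cvg_norm; apply: cvgB => //; exact: cvg_cst.
  move=> hc; rewrite -(cvg_lim _ hc)//; apply: limr_le.
    by apply/cvg_ex; exists `|limn v - v N|.
  by exists N => // n /= Nn; rewrite -(subnKC Nn).
exists (limn (series re) +i* limn (series im)) => N.
apply: le_trans (normc_le_ReIm _) _.
rewrite (_ : 4 * K * 2^-1 ^+ N = 2 * K * 2^-1 ^+ N + 2 * K * 2^-1 ^+ N); last by ring.
apply: lerD.
  rewrite raddfB/= ReS; apply: tl => // m; rewrite -!ReS -raddfB.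
  exact: le_trans (normc_Re _) (normc_tail_le _ _ hu).
rewrite raddfB/= ImS; apply: tl => // m; rewrite -!ImS -raddfB.
exact: le_trans (normc_Im _) (normc_tail_le _ _ hu).
Qed.

(** The value at z is chosen to satisfy the estimate for every admissible K at once, which is
    possible because limits are unique. One function then works for all radii. *)
Lemma pser_exists c : growth c -> exists F, pser c F.
Proof.
move=> gc.
have hz z : {l : R[i] | forall K : R, 
    (forall j, normc (c j * z ^+ j) <= K * 2^-1 ^+ j) ->
    forall N, normc (l - \sum_(j < N) c j * z ^+ j) <= 4 * K * 2^-1 ^+ N}.
  apply: cid; have [K0 K00 hK0] := growth_bound gc (normc_ge0 z).
  have [l hl] := complex_series_cvg (fun j => hK0 j z (lexx _)).
  exists l => K hK N; have [l' hl'] := complex_series_cvg hK.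
  suff -> : l = l' by exact: hl'.
  apply: subr0_eq; apply/eqP; rewrite -normc_eq0 eq_le normc_ge0 andbT.
  apply: (@le_geometric _ _ (4 * K0 + 4 * K)) => n; rewrite add0r mulrDl.
  have := lerD (hl n) (hl' n); apply: le_trans.
  by apply: le_trans (ler_normcB _ _); rewrite (_ : _ - (_ - _) = l - l')//; ring.
exists (fun z => sval (hz z)) => r.
have [K K0 hK] := growth_bound gc (normr_ge0 r).
exists (4 * K) => N z zr; apply: (svalP (hz z)) => j; apply: hK.
exact: le_trans zr (ler_norm _).
Qed.

Definition deriv_coef c (j : nat) : R[i] := j.+1%:R * c j.+1.

Lemma normc_nat (n : nat) : normc (n%:R : R[i]) = n%:R.
Proof.
rewrite (_ : (n%:R : R[i]) = (n%:R : R)%:C); last by rewrite rmorph_nat.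
by rewrite normc_real ger0_norm.
Qed.

Lemma nat_le_pow2 (n : nat) : (n%:R : R) <= 2 ^+ n.
Proof. by rewrite -natrX ler_nat ltnW// ltn_expl. Qed.

Lemma growth_deriv c : growth c -> growth (deriv_coef c).
Proof.
move=> gc r r0; have r1 : 1 <= 2 * (r + 1) by lra.
have [K hK] := gc (2 * (r + 1)) (le_trans ler01 r1).
exists K => j; apply: le_trans (hK j.+1).
rewrite /deriv_coef Normc.normcM normc_nat mulrAC mulrC.
apply: ler_wpM2l; first exact: normc_ge0.
rewrite exprMn; apply: ler_pM; rewrite ?exprn_ge0//; first exact: nat_le_pow2.
rewrite exprS; apply: (@le_trans _ _ (1 * (r + 1) ^+ j)).
  by rewrite mul1r lerXn2r ?nnegrE//; lra.
by rewrite ler_wpM2r ?exprn_ge0//; lra.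
Qed.

(** Passing from j to j + 1 multiplies the first-order remainder by z + h and adds (j + 1) z^j h^2;
    the squares absorb this because (j + 1)^2 + (j + 1) <= (j + 2)^2. *)
Lemma pow_increment (z h : R[i]) (r : R) j : 1 <= r -> normc z <= r ->
  normc (z + h) <= r ->
  normc ((z + h) ^+ j.+1 - z ^+ j.+1 - j.+1%:R * z ^+ j * h) <=
    (j.+1 ^ 2)%:R * r ^+ j.+1 * normc h ^+ 2.
Proof.
move=> r1 zr zhr; have r0 : 0 <= r by lra.
elim: j => [|j IH].
  rewrite !expr1 expr0 mulr1 mul1r [z + h]addrC addrK subrr Normc.normc0.
  by rewrite mulr_ge0 ?sqr_ge0// mulr_ge0.
have -> : (z + h) ^+ j.+2 - z ^+ j.+2 - j.+2%:R * z ^+ j.+1 * h =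
   (z + h) * ((z + h) ^+ j.+1 - z ^+ j.+1 - j.+1%:R * z ^+ j * h) +
   j.+1%:R * z ^+ j * h ^+ 2.
  by rewrite -[j.+2%:R]natr1 ![_ ^+ j.+2]exprS ![z ^+ j.+1]exprS expr2; ring.
apply: le_trans (le_normcD _ _) _.
apply: (@le_trans _ _ (r * ((j.+1 ^ 2)%:R * r ^+ j.+1 * normc h ^+ 2) +
    j.+1%:R * r ^+ j.+2 * normc h ^+ 2)).
  apply: lerD; first by rewrite Normc.normcM; apply: ler_pM; rewrite ?normc_ge0.
  rewrite !Normc.normcM normc_nat !normcX ler_wpM2r ?sqr_ge0// ler_wpM2l//.
  apply: (@le_trans _ _ (r ^+ j)); first by rewrite lerXn2r ?nnegrE ?normc_ge0.
  by rewrite -[leLHS]mul1r -addn2 exprD mulrC ler_wpM2l ?exprn_ge0// exprn_ege1.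
rewrite (_ : r * _ + _ = ((j.+1 ^ 2)%:R + j.+1%:R) * r ^+ j.+2 * normc h ^+ 2); last first.
  by rewrite ![r ^+ j.+2]exprS; ring.
rewrite ler_wpM2r ?sqr_ge0// ler_wpM2r ?exprn_ge0//.
by rewrite -natrD ler_nat -[j.+2]addn1 sqrnD muln1 -addnA leq_add2l mul2n -addnn addnA leq_addl.
Qed.

Lemma pser_cdiffable c F : growth c -> pser c F -> forall z, cdiffable F z.
Proof.
move=> gc pF z; have [G pG] := pser_exists (growth_deriv gc).
exists (G z).
pose r := normc z + 1; have z0 := normc_ge0 z.
have r1 : 1 <= r by rewrite /r; lra.
have r0 : 0 <= r by lra.
(* Of the factor 8 = 4 * 2, the powers of 4 absorb the (j + 1)^2 of [pow_increment] and the powers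
   of 2 make the sum converge. *)
have [K hK] := gc (8 * r) (mulr_ge0 (ler0n _ _) r0).
have K0 : 0 <= K by have := hK 0; rewrite expr0 mulr1; exact/le_trans/normc_ge0.
have [KF hKF] := pF r; have [KG hKG] := pG r.
have main h : normc h <= 1 -> normc (F (z + h) - F z - G z * h) <= 2 * K * normc h ^+ 2.
  move=> h1; have h0 := normc_ge0 h.
  have zr : normc z <= r by rewrite /r; lra.
  have zhr : normc (z + h) <= r by have := le_normcD z h; rewrite /r; lra.
  apply: (@le_geometric _ _ (`|KF| + `|KF| + `|KG|)) => N.
  pose P (N : nat) z := \sum_(j < N) c j * z ^+ j.
  pose Q (N : nat) z := \sum_(j < N) deriv_coef c j * z ^+ j.
  have -> : F (z + h) - F z - G z * h = (P N.+1 (z + h) - P N.+1 z - Q N z * h) +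
     (((F (z + h) - P N.+1 (z + h)) - (F z - P N.+1 z)) - (G z - Q N z) * h) by ring.
  apply: le_trans (le_normcD _ _) _; apply: lerD; last first.
    have hN : (2^-1 : R) ^+ N.+1 <= 2^-1 ^+ N.
      by rewrite exprS ler_piMl ?exprn_ge0 ?invr_ge0// invf_le1// ler1n.
    have p0 : 0 <= (2^-1 : R) ^+ N by rewrite exprn_ge0 ?invr_ge0.
    have e1 w : normc w <= r -> normc (F w - P N.+1 w) <= `|KF| * 2^-1 ^+ N.
      move=> wr; apply: le_trans (hKF N.+1 w wr) _.
      apply: le_trans (ler_wpM2r _ (ler_norm KF)) _.
        by rewrite exprn_ge0 ?invr_ge0.
      by rewrite ler_wpM2l.
    apply: le_trans (ler_normcB _ _) _; rewrite [leRHS]mulrDl; apply: lerD.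
      by apply: le_trans (ler_normcB _ _) _; rewrite [leRHS]mulrDl; apply: lerD; exact: e1.
    rewrite Normc.normcM -[leRHS]mulr1; apply: ler_pM; rewrite ?normc_ge0//.
    apply: le_trans (hKG N z zr) _.
    exact: le_trans (ler_wpM2r p0 (ler_norm KG)) _.
  have -> : P N.+1 (z + h) - P N.+1 z - Q N z * h =
      \sum_(j < N) c j.+1 * ((z + h) ^+ j.+1 - z ^+ j.+1 - j.+1%:R * z ^+ j * h).
    rewrite /P /Q !big_ord_recl /= !expr0 opprD addrACA subrr add0r.
    rewrite mulr_suml -sumrB -sumrB; apply: eq_bigr => j _.
    by rewrite /deriv_coef /bump/= add1n; ring.
  apply: le_trans (normc_sum _ (fun j => c j.+1 * ((z + h) ^+ j.+1 - z ^+ j.+1 - j.+1%:R * z ^+ j * h))) _.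
  apply: (@le_trans _ _ (\sum_(j < N) (K * normc h ^+ 2) * 2^-1 ^+ j)); last first.
    apply: le_trans (sum_geometric_le _ _) _; last by rewrite mulrA.
    by rewrite mulr_ge0 ?sqr_ge0.
  apply: ler_sum => j _; rewrite Normc.normcM.
  apply: le_trans (ler_wpM2l (normc_ge0 _) (pow_increment _ r1 zr zhr)) _.
  rewrite [leRHS]mulrAC [leLHS]mulrA; apply: ler_wpM2r; first exact: sqr_ge0.
  have := hK j.+1; rewrite (_ : 8 = 4 * 2 :> R); last by rewrite -natrM.
  rewrite 2!exprMn => hKj; rewrite exprVn ler_pdivlMr ?exprn_gt0//.
  apply: le_trans hKj; rewrite -[leLHS]mulrA; apply: ler_wpM2l; first exact: normc_ge0.
  rewrite [leLHS]mulrAC; apply: ler_wpM2r; first exact: exprn_ge0.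
  apply: ler_pM; rewrite ?exprn_ge0//.
    rewrite natrX (_ : 4 = 2 ^+ 2 :> R); last by rewrite -natrX.
    by rewrite -exprM mulnC exprM lerXn2r ?nnegrE ?exprn_ge0 ?nat_le_pow2.
  by rewrite exprS ler_peMl ?exprn_ge0// ler1n.
move=> e e0; have m0 : 0 < Num.min 1 (e / (2 * K + 1)).
  by rewrite lt_min ltr01 divr_gt0//; lra.
exists (Num.min 1 (e / (2 * K + 1))) => // h; rewrite le_min => /andP[h1 h2].
apply: le_trans (main h h1) _; rewrite expr2 mulrA ler_wpM2r ?normc_ge0//.
apply: (@le_trans _ _ ((2 * K + 1) * normc h)).
  by rewrite ler_wpM2r ?normc_ge0//; lra.
by rewrite mulrC -ler_pdivlMr//; lra.
Qed.

End PowerSeries.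

(** * The complex exponential *)

Section ComplexExponential.
Context {R : realType}.
Local Notation normc := Normc.normc.

Definition cexp (z : R[i]) : R[i] :=
  (expR (complex.Re z) * cos (complex.Im z)) +i* (expR (complex.Re z) * sin (complex.Im z)).

Lemma cexpD z w : cexp (z + w) = cexp z * cexp w.
Proof.
case: z w => [x y] [u v]; apply/eqP; rewrite eq_complex/= expRD cosD sinD.
by apply/andP; split; apply/eqP; ring.
Qed.

Lemma cexp0 : cexp 0 = 1.
Proof. by rewrite /cexp/= expR0 cos0 sin0 mulr1 mulr0. Qed.

Lemma cexpNM z : cexp (- z) * cexp z = 1.
Proof. by rewrite -cexpD addNr cexp0. Qed.

Lemma normc_cexp z : normc (cexp z) = expR (complex.Re z).
Proof.
rewrite /cexp/= !exprMn -mulrDr cos2Dsin2 mulr1 sqrtr_sqr ger0_norm ?expR_ge0//.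
Qed.

Lemma cexp_real (x : R) : cexp x%:C = (expR x)%:C.
Proof. by rewrite /cexp/= cos0 sin0 mulr1 mulr0. Qed.

Lemma derive_increment (f : R -> R) (x d : R) : is_derive x 1 f d ->
  forall e : R, 0 < e -> exists2 r : R, 0 < r &
    forall h, `|h| <= r -> `|f (x + h) - f x - d * h| <= e * `|h|.
Proof.
move=> [fd <-] e e0.
have /cvgrPdist_le/(_ e e0) := fd.
rewrite near_withinE => /nbhs_ballP[r /= r0 hr].
exists (r / 2); first by rewrite divr_gt0.
move=> h hh; have [->|h0] := eqVneq h 0.
  by rewrite addr0 subrr mulr0 subr0 normr0 mulr0.
have := hr h; rewrite -ball_normE/= sub0r normrN => /(_ _ h0).
rewrite (le_lt_trans hh) => [/(_ isT)|]; last by rewrite gtr_pMr// invf_lt1// ltr1n.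
rewrite -ler_pdivrMr ?normr_gt0// -normrV ?unitfE// -normrM distrC => h1.
apply: le_trans h1; rewrite le_eqVlt; apply/orP; left; apply/eqP; congr `|_|.
by rewrite /derive /GRing.scale/= mulr1 [h + x]addrC; field.
Qed.

Lemma cdiff_cexp0 : cdiff cexp 0 1.
Proof.
(* The errors of exp, cos and sin add up to eight multiples of [e'] times the modulus of h; nine
   leaves a margin. *)
move=> e e0; pose e' := Num.min 1 (e / 9).
have e'0 : 0 < e' by rewrite lt_min ltr01 divr_gt0.
have e'1 : e' <= 1 by rewrite ge_min lexx.
have e'e : 9 * e' <= e by rewrite mulrC -ler_pdivlMr// ge_min lexx orbT.
have [r1 r10 hr1] := derive_increment (is_derive_expR (0 : R)) e'0.
have [r2 r20 hr2] := derive_increment (is_derive_cos (0 : R)) e'0.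
have [r3 r30 hr3] := derive_increment (is_derive_sin (0 : R)) e'0.
exists (Num.min (Num.min r1 r2) (Num.min r3 e')).
  by rewrite lt_min; apply/andP; split; rewrite lt_min; apply/andP.
case=> x y; rewrite !le_min => /andP[/andP[hr1' hr2'] /andP[hr3' /andP[he1 he2]]].
have he' : normc (x +i* y) <= e' by rewrite le_min he1.
have hx := normc_Re (x +i* y); have hy := normc_Im (x +i* y); rewrite /= -/(normc (x +i* y)) in hx hy.
have := hr1 x (le_trans hx hr1'); have := hr2 y (le_trans hy hr2').
have := hr3 y (le_trans hy hr3').
rewrite !add0r !expR0 !cos0 !sin0 !oppr0 !mul0r !mul1r !subr0 => hS hC hE.
have hxe : `|x| <= e' by exact: le_trans he'.
have x0 := normr_ge0 x; have y0 := normr_ge0 y.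
rewrite cexp0.
apply: le_trans (normc_le_ReIm _) _ => /=.
rewrite oppr0 addr0 .
set A := expR x in hE *; set B := cos y in hC *; set C := sin y in hS *.
have B1 : `|B| <= 1 by rewrite /B ler_norml cos_geN1 cos_le1.
have A1 : `|A - 1| <= 2 * `|x|.
  have -> : A - 1 = (A - 1 - x) + x by ring.
  apply: le_trans (ler_normD _ _) _; have : e' * `|x| <= 1 * `|x| by rewrite ler_wpM2r.
  by lra.
have A3 : `|A| <= 3.
  have -> : A = (A - 1) + 1 by ring.
  by apply: le_trans (ler_normD _ _) _; rewrite normr1; lra.
have h1 : `|A * B - 1 - x| <= e' * `|x| + 2 * (e' * `|y|).
  have -> : A * B - 1 - x = (A - 1 - x) * B + (1 + x) * (B - 1) by ring.
  apply: le_trans (ler_normD _ _) _; rewrite !normrM; apply: lerD.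
    by rewrite -[leRHS]mulr1; apply: ler_pM.
  apply: ler_pM => //; apply: le_trans (ler_normD _ _) _; rewrite normr1; lra.
have h2 : `|A * C - y| <= 3 * (e' * `|y|) + 2 * e' * `|y|.
  have -> : A * C - y = A * (C - y) + (A - 1) * y by ring.
  apply: le_trans (ler_normD _ _) _; rewrite !normrM; apply: lerD.
    by rewrite addr0 in hS; apply: ler_pM.
  by apply: ler_wpM2r => //; lra.
have ex : e' * `|x| <= e' * normc (x +i* y) by rewrite ler_wpM2l// ltW.
have ey : e' * `|y| <= e' * normc (x +i* y) by rewrite ler_wpM2l// ltW.
have ee : 9 * e' * normc (x +i* y) <= e * normc (x +i* y) by rewrite ler_wpM2r ?normc_ge0.
have n0 : 0 <= e' * normc (x +i* y) by rewrite mulr_ge0 ?normc_ge0 ?ltW.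
move: ee ex ey n0; rewrite /= => ee ex ey n0; lra.
Qed.

Lemma cdiff_cexp (k z : R[i]) : cdiffable (fun w => cexp (k * w)) z.
Proof.
exists (cexp (k * z) * k) => e e0.
have D0 : 0 < (normc (cexp (k * z)) + 1) * (normc k + 1).
  by rewrite mulr_gt0// ltr_wpDl// normc_ge0.
have [r r0 hr] := cdiff_cexp0 (divr_gt0 e0 D0).
have k1 : 0 < normc k + 1 by rewrite ltr_wpDl// normc_ge0.
exists (r / (normc k + 1)); first by rewrite divr_gt0.
move=> h; rewrite ler_pdivlMr// => hh.
have kh : normc (k * h) <= (normc k + 1) * normc h.
  by rewrite Normc.normcM ler_wpM2r ?normc_ge0// lerDl.
have khr : normc (k * h) <= r by apply: le_trans kh _; rewrite mulrC.
have := hr (k * h) khr; rewrite add0r cexp0 mul1r => h1.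
have -> : cexp (k * (z + h)) - cexp (k * z) - cexp (k * z) * k * h =
    cexp (k * z) * (cexp (k * h) - 1 - k * h) by rewrite mulrDr cexpD; ring.
rewrite Normc.normcM; apply: le_trans (ler_wpM2l (normc_ge0 _) h1) _.
apply: (@le_trans _ _ ((normc (cexp (k * z)) + 1) * 
   (e / ((normc (cexp (k * z)) + 1) * (normc k + 1)) * ((normc k + 1) * normc h)))).
  apply: ler_pM; rewrite ?normc_ge0 ?mulr_ge0 ?normc_ge0 ?lerDl//.
    exact: ltW.
  - by rewrite invr_ge0 ltW.
  by rewrite ler_wpM2l// divr_ge0// ltW.
rewrite le_eqVlt; apply/orP; left; apply/eqP; field.
by rewrite !gt_eqF// ltr_wpDl// normc_ge0.
Qed.

End ComplexExponential.

(** * The Macdonald function as a mixture of Gaussians *)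

Section LogarithmicSubstitution.
Context {R : realType}.
Local Notation mu := (@lebesgue_measure R).
Local Notation Rp := ([set` `]0%R, +oo[] : set R).

Lemma measurable_inv : measurable_fun setT (fun x : R => x^-1).
Proof.
(* The power function is used on the square because its base must be nonnegative; at 0 both sides
   are 0, by the convention for the inverse. *)
rewrite (_ : (fun x => x^-1) = fun x => x * (x * x) `^ (-1)).
  apply: measurable_funM => //.
  by apply: (measurableT_comp (measurable_realfun.measurable_powR (-1))); exact: measurable_funM.
apply/funext => x; rewrite powR_inv1 -?expr2 ?sqr_ge0//.
have [->|x0] := eqVneq x 0; first by rewrite invr0 mul0r.
by rewrite expr2 invfM mulrA divff// mul1r.
Qed.

Lemma derive1_ln (y : R) : 0 < y -> ((@ln R)^`())%classic y = y^-1.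
Proof. by move=> y0; rewrite derive1E; apply: derive_val; exact: is_derive1_ln. Qed.

Lemma derive1_ln_cvg (F : set_system R) (l : R) {FF : Filter F} :
  (\forall y \near F, 0 < y) -> y^-1 @[y --> F] --> l ->
  ((@ln R)^`())%classic y @[y --> F] --> l.
Proof.
move=> F0; apply: cvg_trans; apply: near_eq_cvg; near=> y.
by rewrite derive1_ln//; near: y.
Unshelve. all: end_near. Qed.

Lemma integral_ln_subst_tail (G : R -> R) (a : R) : 0 < a -> continuous G ->
  (forall t, 0 <= G t) ->
  (\int[mu]_(t in `[ln a, +oo[) (G t)%:E =
   \int[mu]_(u in `[a, +oo[) (G (ln u) / u)%:E)%E.
Proof.
move=> a0 cG G0; rewrite increasing_ge0_integration_by_substitutiony//.
- apply: eq_integral => u; rewrite inE/= in_itv/= andbT => au.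
  congr EFin; change (G (ln u) * ((@ln R)^`())%classic u = G (ln u) / u).
  by rewrite derive1_ln// (lt_le_trans a0).
- move=> x y; rewrite !in_itv/= !andbT => ax ay xy.
  by rewrite ltr_ln ?posrE// (lt_le_trans a0).
- move=> x; rewrite in_itv/= andbT => ax; have x0 := lt_trans a0 ax.
  rewrite /continuous_at derive1_ln//; apply: derive1_ln_cvg; last first.
    by apply: cvgV => //; rewrite gt_eqF.
  exact: lt_nbhsr.
- apply/cvg_ex; exists a^-1; apply: derive1_ln_cvg; last first.
    by apply: cvgV; rewrite ?gt_eqF//; apply: cvg_at_right_filter; exact: cvg_id.
  near=> y; apply: lt_trans a0 _; near: y; exact: nbhs_right_gt.
- apply/cvg_ex; exists 0; apply: derive1_ln_cvg; last first.
    apply/cvgrPdist_le => e e0; near=> y.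
    have y0 : 0 < y by near: y; exact: nbhs_pinfty_gt.
    have ye : e^-1 <= y by near: y; apply: nbhs_pinfty_ge; rewrite num_real.
    by rewrite sub0r normrN gtr0_norm ?invr_gt0// -[leRHS]invrK lef_pV2 ?posrE ?invr_gt0.
  exact: nbhs_pinfty_gt.
- split=> [x|].
    rewrite in_itv/= andbT => ax; apply: ex_derive; apply: is_derive1_ln.
    exact: lt_trans ax.
  by apply: cvg_at_right_filter; exact: continuous_ln.
- exact: cvg_ln_pinfty.
- exact: continuous_subspaceT.
Unshelve. all: end_near. Qed.

(** Substitution on the half lines u >= 1/(n + 1), then monotone convergence as they exhaust the
    positive axis. *)
Lemma integral_ln_subst (G : R -> R) : continuous G -> (forall t, 0 <= G t) ->
  (\int[mu]_t (G t)%:E = \int[mu]_(u in Rp) (G (ln u) / u)%:E)%E.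
Proof.
move=> cG G0; pose a (n : nat) : R := n.+1%:R^-1.
have a0 n : 0 < a n by rewrite invr_gt0.
have a_ni m n : (m <= n)%N -> a n <= a m.
  by move=> mn; rewrite lef_pV2 ?posrE// ler_nat.
pose S (n : nat) : set (measurableTypeR R) := [set` `[ln (a n), +oo[].
pose T (n : nat) : set (measurableTypeR R) := [set` `[a n, +oo[].
have cS : (\int[mu]_(t in S n) (G t)%:E @[n --> \oo] -->
    \int[mu]_(t in \bigcup_n S n) (G t)%:E)%E.
  apply: ge0_nondecreasing_set_cvg_integral.
  - move=> m n mn; apply/subsetPset => t; rewrite /S/= !in_itv/= !andbT.
    by apply: le_trans; rewrite ler_ln ?posrE// a_ni.
  - by move=> n; exact: measurable_itv.
  - move=> n; apply: measurable_funTS; apply/measurable_EFinP.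
    exact: continuous_measurable_fun.
  - by move=> n t _; rewrite lee_fin.
have cT : (\int[mu]_(u in T n) (G (ln u) / u)%:E @[n --> \oo] -->
    \int[mu]_(u in \bigcup_n T n) (G (ln u) / u)%:E)%E.
  apply: ge0_nondecreasing_set_cvg_integral.
  - move=> m n mn; apply/subsetPset => t; rewrite /T/= !in_itv/= !andbT.
    by apply: le_trans; exact: a_ni.
  - by move=> n; exact: measurable_itv.
  - move=> n; apply: measurable_funTS; apply/measurable_EFinP.
    apply: measurable_funM.
      apply: measurableT_comp; first exact: continuous_measurable_fun.
      exact: measurable_ln.
    exact: measurable_inv.
  - move=> n u; rewrite /T/= in_itv/= andbT => au.
    by rewrite lee_fin divr_ge0// ltW// (lt_le_trans _ au).
have ST : (fun n => \int[mu]_(t in S n) (G t)%:E)%E =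
    (fun n => \int[mu]_(u in T n) (G (ln u) / u)%:E)%E.
  by apply/funext => n; exact: integral_ln_subst_tail.
have US : \bigcup_n S n = setT.
  apply/seteqP; split=> // t _.
  exists (Num.trunc (expR (- t))) => //; rewrite /S/= in_itv/= andbT.
  rewrite -[leRHS]expRK ler_ln ?posrE ?expR_gt0// /a invf_ple ?posrE ?expR_gt0//.
  by rewrite -expRN ltW// truncnS_gt.
have UT : \bigcup_n T n = Rp.
  apply/seteqP; split=> [u [n _]|u].
    by rewrite /T/= !in_itv/= !andbT => /(lt_le_trans (a0 n)).
  rewrite /= in_itv/= andbT => u0.
  exists (Num.trunc u^-1) => //; rewrite /T/= in_itv/= andbT.
  by rewrite /a invf_ple ?posrE// ltW// truncnS_gt.
rewrite US ST in cS; rewrite UT in cT.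
exact: cvg_unique cS cT.
Qed.

End LogarithmicSubstitution.

Section Bessel.
Context {R : realType}.
Local Notation mu := (@lebesgue_measure R).
Local Notation Rp := ([set` `]0%R, +oo[] : set R).

(* [int_0^oo u^(nu-1) e^{-u} e^{-q/u} du = 2 q^(nu/2) K_nu(2 sqrt q)] *)
Definition mixture (nu q : R) : \bar R :=
  (\int[mu]_(u in Rp) (laguerre_weight nu u / u * expR (- (q / u)))%:E)%E.

Lemma continuous_cosh : continuous (@cosh R).
Proof.
move=> t; rewrite /cosh; apply: cvgM; last exact: cvg_cst.
apply: cvgD; first exact: continuous_expR.
apply: (@continuous_comp _ _ _ (fun t : R => - t) (@expR R)); first exact: continuousN.
exact: continuous_expR.
Qed.

Lemma coshN (t : R) : cosh (- t) = cosh t.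
Proof. by rewrite /cosh opprK addrC. Qed.

Lemma cosh_ge0 (t : R) : 0 <= cosh t.
Proof. by rewrite /cosh divr_ge0// addr_ge0 ?expR_ge0. Qed.

Lemma continuous_expRZ (k : R) (f : R -> R) : continuous f ->
  continuous (fun t => expR (k * f t)).
Proof.
move=> cf t; apply: (@continuous_comp _ _ _ (fun t : R => k * f t) (@expR R)).
  by apply: cvgM; [exact: cvg_cst|exact: cf].
exact: continuous_expR.
Qed.

(** Put t = ln(2u/x): then x cosh t = u + x^2/(4u), e^{nu t} = (2/x)^nu u^nu and dt = du/u. *)
Lemma integral_expR_cosh (nu x : R) : 0 < x ->
  (\int[mu]_t (expR (- x * cosh t) * expR (nu * t))%:E =
   ((2 / x) `^ nu)%:E * mixture nu (x ^+ 2 / 4))%E.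
Proof.
move=> x0; have s0 : 0 < 2 / x by rewrite divr_gt0.
rewrite integral_ln_subst; first last.
- by move=> t; rewrite mulr_ge0 ?expR_ge0.
- move=> t; apply: cvgM; first by apply: continuous_expRZ; exact: continuous_cosh.
  by apply: continuous_expRZ => ?; exact: cvg_id.
rewrite (ge0_integral_scale_itv s0); first last.
- by move=> u u0; rewrite lee_fin divr_ge0 ?(ltW u0)// mulr_ge0 ?expR_ge0.
- apply/measurable_EFinP; apply: measurable_funTS; apply: measurable_funM.
    apply: measurable_funM; apply: measurableT_comp => //; try exact: measurable_expR.
      apply: measurable_funM => //; apply: measurableT_comp; last exact: measurable_ln.
      exact: continuous_measurable_fun continuous_cosh.
    by apply: measurable_funM => //; exact: measurable_ln.
  exact: measurable_inv.
have mR : measurable (Rp : set (measurableTypeR R)) by exact: measurable_itv.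
have mln : measurable_fun setT (fun u : R => ln (2 / x * u)).
  by apply: (measurableT_comp (@measurable_ln R)); exact: measurable_funM.
rewrite /mixture -ge0_integralZl//; first last.
- by rewrite lee_fin ltW.
- move=> u; rewrite /= in_itv/= andbT => u0; rewrite lee_fin.
  by apply: divr_ge0; [rewrite mulr_ge0 ?expR_ge0|rewrite mulr_ge0 ?ltW].
- apply/measurable_EFinP; apply: measurable_funTS; apply: measurable_funM.
    apply: measurable_funM; apply: (measurableT_comp (@measurable_expR R)).
      apply: measurable_funM => //; apply: measurableT_comp mln.
      exact: continuous_measurable_fun continuous_cosh.
    by apply: measurable_funM.
  by apply: (measurableT_comp measurable_inv); exact: measurable_funM.
rewrite -ge0_integralZl//; first last.
- by rewrite lee_fin powR_ge0.
- by move=> u; rewrite /= in_itv/= andbT => u0; rewrite lee_fin mulr_ge0 ?expR_ge0// divr_ge0 ?laguerre_weight_ge0 ?ltW.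
- apply/measurable_EFinP; apply: measurable_funTS; apply: measurable_funM.
    apply: measurable_funM; first exact: measurable_laguerre_weight.
    exact: measurable_inv.
  apply: (measurableT_comp (@measurable_expR R)); apply: measurableT_comp => //.
  by apply: measurable_funM => //; exact: measurable_inv.
apply: eq_integral => u; rewrite inE/= in_itv/= andbT => u0.
have su0 : 0 < 2 / x * u by rewrite mulr_gt0.
rewrite -!EFinM; congr EFin; rewrite /cosh lnK ?posrE// expRN lnK ?posrE//.
have -> : expR (nu * ln (2 / x * u)) = (2 / x) `^ nu * u `^ nu.
  by rewrite -powRM ?ltW// /powR gt_eqF.
have -> : expR (- x * ((2 / x * u + (2 / x * u)^-1) / 2)) = expR (- u) * expR (- (x ^+ 2 / 4 / u)).
  by rewrite -expRD; congr expR; field; rewrite !gt_eqF.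
by rewrite /laguerre_weight; field; rewrite !gt_eqF.
Qed.

(** By evenness, the half-line integral of e^{-x cosh t} cosh(nu t) is half the full-line integral
    with e^{nu t}. Finiteness is assumed because [besselK] is a real-valued integral, which defaults
    to 0 when the extended one is infinite. *)
Lemma besselK_mixture (nu x : R) : 0 < x -> (mixture nu (x ^+ 2 / 4) < +oo)%E ->
  ((besselK nu x)%:E = (2^-1 * (2 / x) `^ nu)%:E * mixture nu (x ^+ 2 / 4))%E.
Proof.
move=> x0 fin.
pose f (t : R) := expR (- x * cosh t) * cosh (nu * t).
have cf : continuous f.
  move=> t; apply: cvgM; first by apply: continuous_expRZ; exact: continuous_cosh.
  apply: (@continuous_comp _ _ _ (fun t : R => nu * t) (@cosh R)); last exact: continuous_cosh.
  by apply: cvgM; [exact: cvg_cst|exact: cvg_id].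
have f0 t : 0 <= f t by rewrite mulr_ge0 ?expR_ge0 ?cosh_ge0.
have fe : f =1 f \o -%R by move=> t; rewrite /f/= mulrN !coshN.
pose g (t : R) := expR (- x * cosh t) * expR (nu * t).
have cg : continuous g.
  move=> t; apply: cvgM; first by apply: continuous_expRZ; exact: continuous_cosh.
  by apply: continuous_expRZ => ?; exact: cvg_id.
have g0 t : 0 <= g t by rewrite mulr_ge0 ?expR_ge0.
have mg : measurable_fun setT (EFin \o g) by apply/measurable_EFinP; exact: continuous_measurable_fun.
have gN : (\int[mu]_t (g (- t))%:E = \int[mu]_t (g t)%:E)%E.
  have := @ge0_integral_affine _ (-1) 0 (EFin \o g); rewrite oppr_eq0 oner_eq0 => /(_ isT mg).
  have g0' t : (0 <= (EFin \o g) t)%E by rewrite lee_fin.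
  move=> /(_ g0') ->.
  by rewrite normrN1 mul1e; apply: eq_integral => t _; rewrite /= mulN1r addr0.
have mgN : measurable_fun setT (fun t : R => (g (- t))%:E).
  apply/measurable_EFinP; apply: measurableT_comp; last exact: oppr_measurable.
  exact: continuous_measurable_fun.
have intf : (\int[mu]_t (f t)%:E = \int[mu]_t (g t)%:E)%E.
  transitivity (\int[mu]_t (2^-1%:E * ((g t)%:E + (g (- t))%:E)))%E.
    apply: eq_integral => t _; rewrite -EFinD -EFinM; congr EFin.
    by rewrite /f /g {2}/cosh coshN mulrN; field.
  rewrite ge0_integralZl//; first last.
  - by move=> t _; rewrite adde_ge0// lee_fin.
  - exact: emeasurable_funD.
  rewrite ge0_integralD//; first last.
  - by move=> t _; rewrite lee_fin.
  - by move=> t _; rewrite lee_fin.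
  have I0 : (0 <= \int[mu]_t (g t)%:E)%E by apply: integral_ge0 => t _; rewrite lee_fin.
  rewrite gN ge0_muleDr// -ge0_muleDl ?lee_fin ?invr_ge0// -EFinD.
  by rewrite (_ : 2^-1 + 2^-1 = 1) ?mul1e//; field.
have half : (\int[mu]_(t in `[0%R, +oo[) (f t)%:E =
    (2^-1 * (2 / x) `^ nu)%:E * mixture nu (x ^+ 2 / 4))%E.
  have := @ge0_symfun_integralT _ f f0 cf fe; rewrite intf (integral_expR_cosh nu x0).
  rewrite -set_itvcy => h; rewrite EFinM -muleA h muleA -EFinM mulVf ?mul1e//.
rewrite /besselK /Rintegral.
rewrite (_ : (\int[mu]_(_ in _) _)%E = \int[mu]_(t in `[0%R, +oo[) (f t)%:E)%E; last first.
  by apply: eq_integral => t _; rewrite /f mulNr.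
rewrite half fineK// ge0_fin_numE.
  by rewrite lte_mul_pinfty// lee_fin mulr_ge0 ?powR_ge0 ?invr_ge0.
rewrite mule_ge0//; first by rewrite lee_fin mulr_ge0 ?powR_ge0 ?invr_ge0.
apply: integral_ge0 => u; rewrite /= in_itv/= andbT => u0.
by rewrite lee_fin mulr_ge0 ?expR_ge0// divr_ge0 ?laguerre_weight_ge0 ?ltW.
Qed.

End Bessel.

(** * Planar integrals *)

Section IteratedMeasurability.
Local Open Scope ereal_scope.
Context d1 d2 (T1 : measurableType d1) (T2 : measurableType d2) (R : realType).

Lemma measurable_integral_snd (m : {sigma_finite_measure set T2 -> \bar R})
    (f : T1 * T2 -> \bar R) :
  measurable_fun setT f -> (forall z, 0 <= f z) ->
  measurable_fun setT (fun x => \int[m]_y f (x, y)).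
Proof. exact: measurable_fun_fubini_tonelli_F. Qed.

Lemma measurable_integral_fst (m : {sigma_finite_measure set T1 -> \bar R})
    (f : T1 * T2 -> \bar R) :
  measurable_fun setT f -> (forall z, 0 <= f z) ->
  measurable_fun setT (fun y => \int[m]_x f (x, y)).
Proof. exact: measurable_fun_fubini_tonelli_G. Qed.

Lemma measurable_integral_on (m : {sigma_finite_measure set T2 -> \bar R})
    (E : set T2) (f : T1 * T2 -> \bar R) :
  measurable E -> measurable_fun (setT `*` E) f ->
  (forall x y, E y -> 0 <= f (x, y)) ->
  measurable_fun setT (fun x => \int[m]_(y in E) f (x, y)).
Proof.
move=> mE mf f0; pose g := f \_ (setT `*` E).
have mg : measurable_fun setT g.
  by apply/(measurable_restrictT _ (measurableX measurableT mE)).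
have gE x y : g (x, y) = if y \in E then f (x, y) else 0.
  by rewrite /g patchE in_setX in_setT.
have g0 p : 0 <= g p.
  by case: p => z u; rewrite gE; case: ifPn => //; rewrite inE; exact: f0.
have := measurable_integral_snd m mg g0.
rewrite (_ : (fun x => _) = fun x => \int[m]_(y in E) f (x, y))//.
apply/funext => x; rewrite [RHS]integral_mkcond.
by apply: eq_integral => y _; rewrite gE patchE.
Qed.

End IteratedMeasurability.

Section ProductTonelli.
Local Open Scope ereal_scope.
Context d1 d2 d3 (T1 : measurableType d1) (T2 : measurableType d2)
  (T3 : measurableType d3) (R : realType).
Variables (m1 : {sigma_finite_measure set T1 -> \bar R})
  (m2 : {sigma_finite_measure set T2 -> \bar R})
  (m3 : {sigma_finite_measure set T3 -> \bar R}).

Let tonelli_productT (g : (T1 * T2) * T3 -> \bar R) :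
  measurable_fun setT g -> (forall p, 0 <= g p) ->
  \int[m1 \x m2]_z \int[m3]_u g (z, u) = \int[m3]_u \int[m1 \x m2]_z g (z, u).
Proof.
move=> mg g0.
have mgx x : measurable_fun setT (fun p : T2 * T3 => g ((x, p.1), p.2)).
  by apply: (measurableT_comp mg); apply: measurable_fun_pair => //;
    apply: measurable_fun_pair.
have mgu u : measurable_fun setT (fun z : T1 * T2 => g (z, u)).
  by apply: (measurableT_comp mg); exact: measurable_fun_pair.
pose k (p : (T1 * T3) * T2) := g ((p.1.1, p.2), p.1.2).
have mk : measurable_fun setT k.
  apply: (measurableT_comp mg); apply: measurable_fun_pair.
    by apply: measurable_fun_pair => //; exact: measurableT_comp.
  exact: measurableT_comp.
have k0 p : 0 <= k p by exact: g0.
rewrite (@fubini_tonelli1 _ _ _ _ _ m1 m2 (fun z => \int[m3]_u g (z, u))); last 2 first.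
- exact: (measurable_integral_snd m3 mg g0).
- by move=> z; exact: integral_ge0.
transitivity (\int[m1]_x \int[m3]_u \int[m2]_y g ((x, y), u)).
  apply: eq_integral => x _.
  exact: (@fubini_tonelli _ _ _ _ _ m2 m3 (fun p : T2 * T3 => g ((x, p.1), p.2))).
rewrite (@fubini_tonelli _ _ _ _ _ m1 m3 (fun p => \int[m2]_y k (p, y))); last 2 first.
- exact: (measurable_integral_snd m2 mk k0).
- by move=> z; exact: integral_ge0.
by apply: eq_integral => u _; rewrite fubini_tonelli1.
Qed.

Lemma tonelli_product (E : set T3) (f : (T1 * T2) * T3 -> \bar R) :
  measurable E -> measurable_fun (setT `*` E) f ->
  (forall z u, E u -> 0 <= f (z, u)) ->
  \int[m1 \x m2]_z \int[m3]_(u in E) f (z, u) =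
  \int[m3]_(u in E) \int[m1 \x m2]_z f (z, u).
Proof.
move=> mE mf f0; pose g := f \_ (setT `*` E).
have mg : measurable_fun setT g.
  by apply/(measurable_restrictT _ (measurableX measurableT mE)).
have gE z u : g (z, u) = if u \in E then f (z, u) else 0.
  by rewrite /g patchE in_setX in_setT.
have g0 p : 0 <= g p.
  by case: p => z u; rewrite gE; case: ifPn => //; rewrite inE; exact: f0.
have := tonelli_productT mg g0; rewrite [X in _ = X -> _](_ : _ =
    \int[m3]_(u in E) \int[m1 \x m2]_z f (z, u)).
  move=> <-; apply: eq_integral => z _; rewrite integral_mkcond.
  by apply: eq_integral => u _; rewrite gE patchE.
rewrite [RHS]integral_mkcond; apply: eq_integral => u _; rewrite patchE.
case: ifPn => uE; first by apply: eq_integral => z _; rewrite gE uE.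
by rewrite integral0_eq// => z _; rewrite gE (negbTE uE).
Qed.

End ProductTonelli.

Section PlanarIntegrals.
Context {R : realType}.
Local Notation mu := (@lebesgue_measure R).
Local Notation mu2 := (mu \x mu)%E.
Local Notation Rp := ([set` `]0%R, +oo[] : set R).
Implicit Types (f g : R * R -> \bar R).

Definition sqmod (z : R * R) : R := z.1 ^+ 2 + z.2 ^+ 2.

Lemma sqmod_ge0 z : 0 <= sqmod z. Proof. by rewrite addr_ge0 ?sqr_ge0. Qed.

Lemma measurable_sqmod : measurable_fun setT sqmod.
Proof. by apply: measurable_funD; apply: measurable_funX. Qed.

Lemma sqmod_gt0 z : z != (0, 0) -> 0 < sqmod z.
Proof.
move=> z0; rewrite lt_neqAle sqmod_ge0 andbT eq_sym.
apply: contra z0; rewrite /sqmod paddr_eq0 ?sqr_ge0// !sqrf_eq0.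
by case: z => x y /= /andP[/eqP -> /eqP ->].
Qed.

Lemma origin_null : mu2 [set (0, 0)] = 0%E.
Proof.
rewrite (_ : [set (0, 0)] = [set (0 : R)] `*` [set (0 : R)]).
  have m0 : measurable ([set 0] : set (measurableTypeR R)) by exact: measurable_set1.
  rewrite product_measure1E//; move: (@lebesgue_measure_set1 R 0) => /= ->.
  by rewrite mule0.
by apply/seteqP; split=> [_ -> //|[x y] /= [-> ->]].
Qed.

Lemma measurable_origin : measurable [set ((0, 0) : R * R)].
Proof.
rewrite (_ : [set (0, 0)] = [set (0 : R)] `*` [set (0 : R)]); first exact: measurableX.
by apply/seteqP; split=> [_ -> //|[x y] /= [-> ->]].
Qed.

(** The representations of e^{-|z|^2} and of the Macdonald weight as integrals are established for
    |z| > 0 only, so planar identities are compared away from a null point. *)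
Lemma eq_integral_off_origin f g : measurable_fun setT f -> measurable_fun setT g ->
  (forall z, z != (0, 0) -> f z = g z) -> (\int[mu2]_z f z = \int[mu2]_z g z)%E.
Proof.
move=> mf mg fg; apply: ae_eq_integral => //.
exists [set (0, 0)]; split; [exact: measurable_origin|exact: origin_null|].
move=> z /= hz; apply: contrapT => z0; apply: hz => _; apply: fg.
by apply/eqP.
Qed.

Lemma measurable_linear2 f (p q r s : R) : measurable_fun setT f ->
  measurable_fun setT (fun z : R * R => f (p * z.1 + q * z.2, r * z.1 + s * z.2)).
Proof.
move=> mf; apply: (measurableT_comp mf); apply: measurable_fun_pair.
  by apply: measurable_funD; apply: measurable_funM.
by apply: measurable_funD; apply: measurable_funM.
Qed.

Lemma measurable_slice2 f (x : R) : measurable_fun setT f ->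
  measurable_fun setT (fun y : R => f (x, y)).
Proof. by move=> mf; apply: measurableT_comp mf _; exact: measurable_pair1. Qed.

Lemma measurable_slice1 f (y : R) : measurable_fun setT f ->
  measurable_fun setT (fun x : R => f (x, y)).
Proof. by move=> mf; apply: measurableT_comp mf _; exact: measurable_pair2. Qed.

(* [rotation = shear * shear]: both shears are one-dimensional affine
   substitutions since [p <> 0]. *)
Lemma integral_rotation f (p q : R) : p != 0 -> p ^+ 2 + q ^+ 2 = 1 ->
  measurable_fun setT f -> (forall z, 0 <= f z)%E ->
  (\int[mu2]_z f (p * z.1 + - q * z.2, q * z.1 + p * z.2)%R = \int[mu2]_z f z)%E.
Proof.
move=> p0 pq mf f0.
have mk : measurable_fun setT
    (fun z : R * R => f (1 * z.1 + 0 * z.2, q / p * z.1 + p^-1 * z.2)).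
  exact: measurable_linear2.
pose k (z : R * R) := f (1 * z.1 + 0 * z.2, q / p * z.1 + p^-1 * z.2).
have k0 z : (0 <= k z)%E by exact: f0.
have Ip : (`|p^-1|%:E * `|p|%:E = 1)%E by rewrite -EFinM -normrM mulVf// normr1.
have inner1 (y : R) : (\int[mu]_x f (p * x + - q * y, q * x + p * y)%R =
    `|p^-1|%:E * \int[mu]_x k (x, y))%E.
  have mky := @measurable_slice1 k y mk.
  rewrite (@ge0_integral_affine _ p (- q * y) (fun x => k (x, y)))//.
  rewrite muleA Ip mul1e; apply: eq_integral => x _; rewrite /k/=.
  congr (f (_, _)); first by ring.
  have -> : q / p * (p * x + - q * y) + p^-1 * y =
      q * x + (1 - q ^+ 2) / p * y by field.
  by rewrite -pq addrK expr2 mulfK.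
have inner2 (x : R) : (\int[mu]_y f (x, y) = `|p^-1|%:E * \int[mu]_y k (x, y))%E.
  rewrite (@ge0_integral_affine _ p^-1 (q / p * x) (fun y => f (x, y))) ?invr_eq0//; last exact: measurable_slice2.
  congr (_ * _)%E; apply: eq_integral => y _; rewrite /k/=.
  by congr (f (_, _)); ring.
rewrite fubini_tonelli2//; last exact: measurable_linear2.
transitivity (\int[mu]_y (`|p^-1|%:E * \int[mu]_x k (x, y)))%E.
  by apply: eq_integral => y _; exact: inner1.
rewrite ge0_integralZl//; first last.
- by move=> y _; apply: integral_ge0 => x _; exact: f0.
- exact: (measurable_integral_fst mu mk (fun z => f0 _)).
rewrite -(@fubini_tonelli _ _ _ _ _ mu mu k)//.
rewrite fubini_tonelli1// /fubini_F -ge0_integralZl//; first last.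
- by move=> y _; apply: integral_ge0 => x _; exact: f0.
- exact: (measurable_integral_snd mu mk (fun z => f0 _)).
by apply: eq_integral => x _; rewrite inner2.
Qed.

Lemma integral_dilation f (s : R) : 0 < s ->
  measurable_fun setT f -> (forall z, 0 <= f z)%E ->
  (\int[mu2]_z f z = (s ^+ 2)%:E * \int[mu2]_z f (s * z.1, s * z.2)%R)%E.
Proof.
move=> s0 mf f0.
have mk : measurable_fun setT (fun z : R * R => f (s * z.1, s * z.2)).
  have := @measurable_linear2 f s 0 0 s mf; congr measurable_fun.
  by apply/funext => z; rewrite !mul0r addr0 add0r.
rewrite !fubini_tonelli1// /fubini_F/=.
rewrite (@ge0_integral_affine _ s 0) ?gt_eqF//; first last.
- by move=> x; exact: integral_ge0.
- exact: (measurable_integral_snd mu mf f0).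
rewrite gtr0_norm// expr2 EFinM -muleA; congr (_ * _)%E.
rewrite -ge0_integralZl//; first last.
- by rewrite lee_fin ltW.
- by move=> y _; apply: integral_ge0 => x _; exact: f0.
- exact: (measurable_integral_snd mu mk (fun z => f0 _)).
apply: eq_integral => x _.
have mfx := measurable_slice2 (s * x + 0) mf.
rewrite (@ge0_integral_affine _ s 0 (fun y => f (s * x + 0, y))) ?gt_eqF//.
rewrite gtr0_norm//; congr (_ * _)%E; apply: eq_integral => y _.
by rewrite !addr0.
Qed.

Definition planar_moment (al : R) (j : nat) : \bar R :=
  (\int[mu2]_z (sqmod z ^+ j * expR (- (al * sqmod z)))%:E)%E.

Lemma measurable_planar_moment (al : R) (j : nat) (D : set (R * R)) :
  measurable_fun D (fun z : R * R => (sqmod z ^+ j * expR (- (al * sqmod z)))%:E).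
Proof.
apply: measurable_funTS; apply/measurable_EFinP; apply: measurable_funM.
  by apply: measurable_funX; exact: measurable_sqmod.
apply: (measurableT_comp (@measurable_expR R)); apply: measurableT_comp => //.
by apply: measurable_funM => //; exact: measurable_sqmod.
Qed.

Lemma planar_moment_ge0 al j : (0 <= planar_moment al j)%E.
Proof.
by apply: integral_ge0 => z _; rewrite lee_fin mulr_ge0 ?expR_ge0 ?exprn_ge0 ?sqmod_ge0.
Qed.

Lemma planar_moment_scale (al : R) j : 0 < al ->
  planar_moment al j = ((al ^- j.+1)%:E * planar_moment 1 j)%E.
Proof.
move=> al0; pose s := Num.sqrt al.
have s0 : 0 < s by rewrite sqrtr_gt0.
have s2 : s ^+ 2 = al by rewrite sqr_sqrtr// ltW.
rewrite [in RHS]/planar_moment (integral_dilation s0); first last.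
- by move=> z; rewrite lee_fin mulr_ge0 ?expR_ge0 ?exprn_ge0 ?sqmod_ge0.
- exact: measurable_planar_moment.
rewrite s2 muleA -EFinM /planar_moment.
rewrite -ge0_integralZl//; first last.
- by rewrite lee_fin mulr_ge0 ?invr_ge0 ?exprn_ge0 ?ltW.
- by move=> z _; rewrite lee_fin mulr_ge0 ?expR_ge0 ?exprn_ge0 ?sqmod_ge0.
- have := @measurable_linear2 _ s 0 0 s (@measurable_planar_moment 1 j setT).
  congr measurable_fun; apply/funext => z; by rewrite !mul0r addr0 add0r.
apply: eq_integral => z _; rewrite -EFinM; congr EFin.
have -> : sqmod (s * z.1, s * z.2) = al * sqmod z by rewrite /sqmod/= -s2; ring.
rewrite mul1r exprMn exprSr; field.
by rewrite expf_neq0 gt_eqF.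
Qed.

Lemma planar_moment0 : planar_moment 1 0 = (pi : R)%:E.
Proof.
rewrite /planar_moment fubini_tonelli1//; last 2 first.
- exact: measurable_planar_moment.
- by move=> z; rewrite lee_fin mulr_ge0 ?expR_ge0 ?exprn_ge0 ?sqmod_ge0.
rewrite /fubini_F.
have g0 (y : R) : (0 <= (gauss_fun y)%:E)%E by rewrite lee_fin expR_ge0.
have mg : measurable_fun setT (fun y : R => (gauss_fun y)%:E).
  by apply/measurable_EFinP; exact: measurable_gauss_fun.
transitivity (\int[mu]_x ((gauss_fun x)%:E * (Num.sqrt pi)%:E))%E.
  apply: eq_integral => x _; rewrite -integralT_gauss -ge0_integralZl//.
  apply: eq_integral => y _; rewrite -EFinM; congr EFin.
  by rewrite /sqmod/= expr0 !mul1r /gauss_fun -expRD; congr expR; ring.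
rewrite ge0_integralZr// ?lee_fin ?sqrtr_ge0// integralT_gauss -EFinM -expr2.
by rewrite sqr_sqrtr// pi_ge0.
Qed.

(** The superposition of exponentials used for the Gamma recurrence, now in the variable |z|^2, with
    the planar scaling s^{-(j + 2)}. Starting from the Gaussian integral it yields pi j! without
    polar coordinates. *)
Lemma planar_moment_rec j :
  planar_moment 1 j.+1 = ((j.+1%:R)%:E * planar_moment 1 j)%E.
Proof.
have j0 : (0 : R) < j.+1%:R by rewrite ltr0n.
suff -> : planar_moment 1 j = ((j.+1%:R : R)^-1%:E * planar_moment 1 j.+1)%E.
  by rewrite muleA -EFinM divff ?gt_eqF// mul1e.
have mset : measurable_fun ([set: R * R] `*` [set` `[1%R, +oo[] : set ((R * R) * R))
   (fun p : (R * R) * R => (sqmod p.1 ^+ j * (sqmod p.1 * expR (- (p.2 * sqmod p.1))))%:E).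
  apply/measurable_EFinP; apply: measurable_funTS.
  have mq : measurable_fun setT (fun p : (R * R) * R => sqmod p.1).
    by apply: (measurableT_comp measurable_sqmod).
  apply: measurable_funM; first exact: measurable_funX.
  apply: measurable_funM => //.
  apply: measurableT_comp; first exact: measurable_expR.
  by apply: measurableT_comp => //; exact: measurable_funM.
have nn z (s : R) : (0 <= (sqmod z ^+ j * (sqmod z * expR (- (s * sqmod z))))%:E)%E.
  by rewrite lee_fin !mulr_ge0 ?expR_ge0 ?exprn_ge0 ?sqmod_ge0.
transitivity (\int[mu2]_z \int[mu]_(s in `[1%R, +oo[)
   (sqmod z ^+ j * (sqmod z * expR (- (s * sqmod z))))%:E)%E.
  apply: eq_integral_off_origin.
  - exact: measurable_planar_moment.
  - apply: (@measurable_integral_on _ _ _ _ R mu _ _ (measurable_itv _) mset).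
    by move=> z s _; exact: nn.
  - move=> z /sqmod_gt0 z0.
    under eq_integral do rewrite EFinM.
    rewrite ge0_integralZl//.
    + by rewrite integral_expR_tail// -EFinM mul1r.
    + apply/measurable_EFinP; apply: measurable_funM => //.
      apply: measurableT_comp; first exact: measurable_expR.
      by apply: measurableT_comp => //; exact: measurable_funM.
    + by move=> s _; rewrite lee_fin mulr_ge0 ?expR_ge0// ltW.
    + by rewrite lee_fin exprn_ge0// ltW.
have /= -> := @tonelli_product _ _ _ _ _ _ R mu mu mu _ _
  (measurable_itv _) mset (fun z s _ => nn z s).
transitivity (\int[mu]_(s in `[1%R, +oo[)
   ((s `^ (- j.+2%:R))%:E * planar_moment 1 j.+1))%E.
  apply: eq_integral => s; rewrite inE/= in_itv/= andbT => s1.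
  have s0 : 0 < s by exact: lt_le_trans s1.
  rewrite powRN powR_mulrn ?ltW// -planar_moment_scale//.
  by apply: eq_integral => z _; congr EFin; rewrite exprSr mulrA.
rewrite ge0_integralZr//.
- rewrite integral_powR_tail ?ltr1n//.
  by congr (_^-1%:E * _)%E; rewrite -natr1; ring.
- apply/measurable_EFinP/measurable_funTS; exact: measurable_realfun.measurable_powR.
- by move=> s _; rewrite lee_fin powR_ge0.
- exact: planar_moment_ge0.
Qed.

Lemma planar_momentE (al : R) j : 0 < al ->
  planar_moment al j = (pi * j`!%:R / al ^+ j.+1)%:E.
Proof.
move=> al0; rewrite planar_moment_scale//.
suff -> : planar_moment 1 j = (pi * j`!%:R)%:E by rewrite -EFinM mulrC.
elim: j => [|j IH]; first by rewrite planar_moment0 fact0 mulr1.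
by rewrite planar_moment_rec IH -EFinM factS natrM; congr EFin; ring.
Qed.

End PlanarIntegrals.

(** * Planar moments of the Gaussian mixture *)

Section MixtureMoments.
Context {R : realType}.
Variable nu : R.
Hypothesis hnu : -1 < nu.
Hypothesis gamma0_fin : gamma_moment nu 0 \is a fin_num.
Hypothesis gamma0_gt0 : (0 < gamma_moment nu 0)%E.
Local Notation mu := (@lebesgue_measure R).
Local Notation mu2 := (mu \x mu)%E.
Local Notation Rp := ([set` `]0%R, +oo[] : set R).

Let kernel (q u : R) : R := laguerre_weight nu u / u * expR (- (q / u)).

Let kernel_ge0 (q u : R) : 0 < u -> 0 <= kernel q u.
Proof.
by move=> u0; rewrite mulr_ge0 ?expR_ge0// divr_ge0 ?laguerre_weight_ge0 ?ltW.
Qed.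

Let mRp : measurable (Rp : set (measurableTypeR R)). Proof. exact: measurable_itv. Qed.

Lemma mixture_ge0 (q : R) : (0 <= mixture nu q)%E.
Proof.
apply: integral_ge0 => u; rewrite /= in_itv/= andbT => u0.
by rewrite lee_fin kernel_ge0.
Qed.

Let measurable_kernel d (T : measurableType d) (h k : T -> R) :
  measurable_fun setT h -> measurable_fun setT k ->
  measurable_fun setT (fun p => kernel (h p) (k p)).
Proof.
move=> mh mk; have mi := measurableT_comp measurable_inv mk.
apply: measurable_funM.
  apply: measurable_funM => //.
  by apply: (measurableT_comp (@measurable_laguerre_weight R nu setT)).
apply: (measurableT_comp (@measurable_expR R)); apply: measurableT_comp => //.
exact: measurable_funM.
Qed.

(** From y e^{-y} <= 1 with y = q/u, the integrand is at most q^{-1} times the Laguerre weight. *)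
Lemma mixture_lty (q : R) : 0 < q -> (mixture nu q < +oo)%E.
Proof.
move=> q0.
apply: (@le_lt_trans _ _ (\int[mu]_(u in Rp) (q^-1%:E * (u ^+ 0 * laguerre_weight nu u)%:E))%E).
  apply: ge0_le_integral => //.
  - by move=> u; rewrite /= in_itv/= andbT => u0; rewrite lee_fin kernel_ge0.
  - apply/measurable_EFinP/measurable_funTS; exact: (@measurable_kernel _ _ (fun=> q) id).
  - apply/measurable_EFinP/measurable_funTS; apply: measurable_funM => //.
    by apply: measurable_funM => //; exact: measurable_laguerre_weight.
  - move=> u; rewrite /= in_itv/= andbT => u0; rewrite -EFinM lee_fin expr0 mul1r.
    rewrite mulrAC -mulrA mulrC ler_wpM2r ?laguerre_weight_ge0//.
    have : q / u * expR (- (q / u)) <= 1.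
      rewrite expRN ler_pdivrMr ?expR_gt0// mul1r.
      by apply: le_trans (expR_ge1Dx _); rewrite lerDr.
    by rewrite mulrC -(ler_pM2l q0) divff ?gt_eqF// mulrCA mulrA.
rewrite ge0_integralZl//.
- by rewrite -ge0_fin_numE ?mule_ge0 ?lee_fin ?invr_ge0 ?(ltW q0) ?gamma_moment_ge0// fin_numM.
- apply/measurable_EFinP/measurable_funTS; apply: measurable_funM => //.
  exact: measurable_laguerre_weight.
- move=> u; rewrite /= in_itv/= andbT => u0.
  by rewrite lee_fin expr0 mul1r laguerre_weight_ge0.
- by rewrite lee_fin invr_ge0 ltW.
Qed.

Lemma measurable_mixture (h : R * R -> R) : measurable_fun setT h ->
  measurable_fun setT (fun z => mixture nu (h z)).
Proof.
move=> mh.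
have mk : measurable_fun ([set: R * R] `*` Rp)
    (fun p : (R * R) * R => (kernel (h p.1) p.2)%:E).
  apply/measurable_EFinP/measurable_funTS.
  by apply: measurable_kernel => //; exact: measurableT_comp mh _.
apply: (@measurable_integral_on _ _ _ _ R mu _ _ mRp mk) => z u.
by rewrite /= in_itv/= andbT => u0; rewrite lee_fin kernel_ge0.
Qed.

(** For fixed u the integrand is a planar Gaussian with parameter b/u, whose moment is pi j!
    (u/b)^{j + 1}. The remaining integral in u is Gamma(nu + j + 1). *)
Lemma integral_mixture_moment (b : R) j : 0 < b ->
  (\int[mu2]_z ((sqmod z ^+ j)%:E * mixture nu (b * sqmod z)) =
   (pi * j`!%:R * gam nu j / b ^+ j.+1)%:E)%E.
Proof.
move=> b0.
have mset : measurable_fun ([set: R * R] `*` Rp)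
   (fun p : (R * R) * R => (sqmod p.1 ^+ j * kernel (b * sqmod p.1) p.2)%:E).
  apply/measurable_EFinP; apply: measurable_funTS.
  have mq : measurable_fun setT (fun p : (R * R) * R => sqmod p.1).
    by apply: (measurableT_comp measurable_sqmod).
  apply: measurable_funM; first exact: measurable_funX.
  by apply: measurable_kernel => //; exact: measurable_funM.
transitivity (\int[mu2]_z \int[mu]_(u in Rp) (sqmod z ^+ j * kernel (b * sqmod z) u)%:E)%E.
  apply: eq_integral => z _; rewrite -ge0_integralZl//.
  - apply/measurable_EFinP/measurable_funTS; exact: (@measurable_kernel _ _ (fun=> b * sqmod z) id).
  - by move=> u; rewrite /= in_itv/= andbT => u0; rewrite lee_fin kernel_ge0.
  - by rewrite lee_fin exprn_ge0 ?sqmod_ge0.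
have /= -> := @tonelli_product _ _ _ _ _ _ R mu mu mu _ _ mRp mset; last first.
  move=> z u; rewrite /= in_itv/= andbT => u0.
  by rewrite lee_fin mulr_ge0 ?exprn_ge0 ?sqmod_ge0 ?kernel_ge0.
transitivity (\int[mu]_(u in Rp) ((pi * j`!%:R / b ^+ j.+1)%:E * (u ^+ j * laguerre_weight nu u)%:E))%E.
  apply: eq_integral => u; rewrite inE/= in_itv/= andbT => u0.
  have bu0 : 0 < b / u by rewrite divr_gt0.
  transitivity ((laguerre_weight nu u / u)%:E * planar_moment (b / u) j)%E.
    rewrite -ge0_integralZl//.
    - by apply: eq_integral => z _; rewrite -EFinM /kernel; congr EFin;
        rewrite mulrCA; congr (_ * (_ * expR (- _))); field; rewrite gt_eqF.
    - exact: measurable_planar_moment.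
    - by move=> z _; rewrite lee_fin mulr_ge0 ?expR_ge0 ?exprn_ge0 ?sqmod_ge0.
    - by rewrite lee_fin divr_ge0 ?laguerre_weight_ge0 ?ltW.
  rewrite planar_momentE// -!EFinM; congr EFin.
  rewrite expr_div_n ![_ ^+ j.+1]exprS; field.
  by rewrite !expf_neq0 ?gt_eqF.
rewrite ge0_integralZl//.
- rewrite -/(gamma_moment nu j) gamma_momentE// -EFinM; congr EFin; ring.
- apply/measurable_EFinP/measurable_funTS; apply: measurable_funM => //.
  exact: measurable_laguerre_weight.
- move=> u; rewrite /= in_itv/= andbT => u0.
  by rewrite lee_fin mulr_ge0 ?laguerre_weight_ge0 ?exprn_ge0 ?ltW.
- by rewrite lee_fin divr_ge0 ?mulr_ge0 ?exprn_ge0 ?ltW ?pi_gt0.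
Qed.

End MixtureMoments.

(** * Parseval's identity in the plane *)

Section RootsOfUnity.
Context {R : realType}.
Local Notation normc := Normc.normc.

Definition unit_root (M : nat) : R[i] := cexp (0 +i* (pi *+ 2 / M%:R)).

Lemma cexp_im_exp (t : R) n : cexp (0 +i* t) ^+ n = cexp (0 +i* (n%:R * t)).
Proof.
elim: n => [|n IH]; first by rewrite expr0 mul0r (_ : 0 +i* 0 = 0) ?cexp0.
rewrite exprS IH -cexpD; congr cexp; apply/eqP; rewrite eq_complex/= addr0 eqxx/=.
by rewrite -natr1; apply/eqP; ring.
Qed.

Lemma unit_root_exp M : (0 < M)%N -> unit_root M ^+ M = 1.
Proof.
move=> M0; rewrite /unit_root cexp_im_exp mulrC divfK ?pnatr_eq0 -?lt0n//.
by rewrite /cexp/= cos2pi sin2pi expR0 mulr1 mulr0.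
Qed.

Lemma unit_root_neq1 M m : (0 < m < M)%N -> unit_root M ^+ m != 1.
Proof.
move=> /andP[m0 mM]; have M0 : (0 < M)%N by exact: leq_ltn_trans mM.
rewrite /unit_root cexp_im_exp; set t := m%:R * _.
pose s := pi * (m%:R / M%:R) : R.
have Mp : (0 : R) < M%:R by rewrite ltr0n.
have s0 : 0 < s < pi.
  rewrite mulr_gt0 ?pi_gt0 ?divr_gt0 ?ltr0n//= gtr_pMr ?pi_gt0//.
  by rewrite ltr_pdivrMr// mul1r ltr_nat.
have -> : t = s + s by rewrite /t /s mulr2n; field; rewrite gt_eqF.
apply/eqP => /(congr1 (@complex.Re R)); rewrite /cexp/= expR0 mul1r cosD.
rewrite -!expr2 cos2sin2 => h; have := sin_gt0_pi s0; have : sin s ^+ 2 = 0 by lra.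
by move/eqP; rewrite sqrf_eq0 => /eqP ->; rewrite ltxx.
Qed.

Lemma unit_root_conj M : unit_root M * (unit_root M)^* = 1.
Proof.
rewrite /unit_root /cexp/= expR0 !mul1r; apply/eqP; rewrite eq_complex/=.
apply/andP; split; apply/eqP; last by ring.
by rewrite -[RHS](cos2Dsin2 (pi *+ 2 / M%:R)); ring.
Qed.

Lemma normc_unit_root M : normc (unit_root M) = 1.
Proof. by rewrite normc_cexp/= expR0. Qed.

Lemma sum_unit_root_eq0 M (x : R[i]) : x ^+ M = 1 -> x != 1 ->
  \sum_(k < M) x ^+ k = 0.
Proof.
move=> xM x1; have : (x - 1) * \sum_(k < M) x ^+ k = 0 by rewrite -subrX1 xM subrr.
by move/eqP; rewrite mulf_eq0 subr_eq0 (negbTE x1) => /eqP.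
Qed.

Lemma sum_unit_root_cross M j l : (j < M)%N -> (l < M)%N ->
  \sum_(k < M) (unit_root M ^+ j * (unit_root M)^* ^+ l) ^+ k = (M * (j == l))%:R.
Proof.
move=> jM lM; have M0 : (0 < M)%N by exact: leq_ltn_trans jM.
set w := unit_root M; have wc : w * w^* = 1 := unit_root_conj M.
have wM : w ^+ M = 1 := unit_root_exp M0.
have wcM : w^* ^+ M = 1.
  by rewrite -[LHS]mul1r -{1}wM -exprMn wc expr1n.
have xM : (w ^+ j * w^* ^+ l) ^+ M = 1.
  by rewrite exprMn -!exprM ![(_ * M)%N]mulnC !exprM wM wcM !expr1n mulr1.
case: (ltngtP j l) => [jl|lj|->].
- rewrite sum_unit_root_eq0 ?muln0//; apply/negP => /eqP h.
  have : w ^+ (l - j) = 1.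
    rewrite -[LHS]mulr1 -{1}h mulrA -exprD subnK; last exact: ltnW.
    by rewrite -exprMn wc expr1n.
  by apply/eqP; rewrite unit_root_neq1// subn_gt0 jl (leq_ltn_trans (leq_subr _ _)).
- rewrite sum_unit_root_eq0 ?muln0//; apply/negP => /eqP h.
  have : w ^+ (j - l) = 1.
    rewrite -h -{2}(subnK (ltnW lj)) exprD -mulrA -exprMn wc expr1n mulr1//.
  by apply/eqP; rewrite unit_root_neq1// subn_gt0 lj (leq_ltn_trans (leq_subr _ _)).
- rewrite -exprMn wc expr1n; under eq_bigr do rewrite expr1n.
  by rewrite sumr_const card_ord muln1.
Qed.

Lemma normc_mul_conj (z : R[i]) : z * z^* = (normc z ^+ 2)%:C.
Proof.
rewrite normc_sqr; case: z => x y; apply/eqP; rewrite eq_complex/=.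
by apply/andP; split; apply/eqP; ring.
Qed.

(** Averaging over the M-th roots of unity removes every cross term, because two distinct exponents
    below M are incongruent modulo M. The identity is exact, with a finite average in place of an
    angular integral. *)
Lemma discrete_parseval (c : nat -> R[i]) N M (z : R[i]) : (N <= M)%N -> (0 < M)%N ->
  M%:R^-1 * \sum_(k < M) normc (\sum_(j < N) c j * (unit_root M ^+ k * z) ^+ j) ^+ 2 =
  \sum_(j < N) normc (c j) ^+ 2 * (normc z ^+ 2) ^+ j.
Proof.
move=> NM M0; apply: (@complexI R).
have Mn0 : (M%:R : R) != 0 by rewrite pnatr_eq0 -lt0n.
apply: (@mulfI _ (M%:R%:C)); first by rewrite -[0]/(0%:C) (inj_eq (@complexI R)).
rewrite -!rmorphM/= mulrA divff// mul1r.
set w := unit_root M.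
transitivity (\sum_(k < M) \sum_(j < N) \sum_(l < N)
    (c j * z ^+ j) * (c l * z ^+ l)^* * (w ^+ j * w^* ^+ l) ^+ k).
  rewrite rmorph_sum; apply: eq_bigr => k _; rewrite [LHS]/=.
  rewrite -normc_mul_conj rmorph_sum/= big_distrlr/=.
  apply: eq_bigr => j _; apply: eq_bigr => l _.
  rewrite !rmorphM/= !rmorphXn/= !rmorphM/= !rmorphXn/= !exprMn -!exprM.
  by rewrite [(j * k)%N]mulnC [(l * k)%N]mulnC; ring.
rewrite exchange_big/= mulr_sumr rmorph_sum; apply: eq_bigr => j _.
rewrite exchange_big/= (bigD1 j)//= [X in _ + X]big1 ?addr0 => [|l lj].
  rewrite -mulr_sumr sum_unit_root_cross ?(leq_trans (ltn_ord j) NM)// eqxx muln1.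
  rewrite normc_mul_conj Normc.normcM normcX exprMn -exprM mulnC exprM.
  by rewrite mulrC [RHS]rmorphM rmorph_nat.
rewrite -mulr_sumr sum_unit_root_cross ?(leq_trans (ltn_ord _) NM)//.
by rewrite (_ : (nat_of_ord j == l) = false) ?muln0 ?mulr0// eq_sym; apply/negbTE.
Qed.

End RootsOfUnity.

(** * Parseval's inequalities for a radial weight *)

Section PlanarParseval.
Context {R : realType}.
Local Notation mu := (@lebesgue_measure R).
Local Notation mu2 := (mu \x mu)%E.
Local Notation normc := Normc.normc.

Definition to_complex (p : R * R) : R[i] := p.1 +i* p.2.

Lemma normc_to_complex p : normc (to_complex p) ^+ 2 = sqmod p.
Proof. by rewrite normc_sqr. Qed.

Let cmeas (f : R * R -> R[i]) : Prop :=
  measurable_fun setT (fun p => complex.Re (f p)) /\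
  measurable_fun setT (fun p => complex.Im (f p)).

Let cmeas_cst (k : R[i]) : cmeas (fun=> k).
Proof. by split; exact: measurable_cst. Qed.

Let cmeasD f g : cmeas f -> cmeas g -> cmeas (fun p => f p + g p).
Proof.
move=> [fR fI] [gR gI]; split.
  have := measurable_funD fR gR; congr measurable_fun; apply/funext => p /=.
  by case: (f p) (g p) => [? ?] [].
have := measurable_funD fI gI; congr measurable_fun; apply/funext => p /=.
by case: (f p) (g p) => [? ?] [].
Qed.

Let cmeasM f g : cmeas f -> cmeas g -> cmeas (fun p => f p * g p).
Proof.
move=> [fR fI] [gR gI]; split.
  have := measurable_funB (measurable_funM fR gR) (measurable_funM fI gI).
  by congr measurable_fun; apply/funext => p /=; case: (f p) (g p) => [? ?] [].
have := measurable_funD (measurable_funM fR gI) (measurable_funM fI gR).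
by congr measurable_fun; apply/funext => p /=; case: (f p) (g p) => [? ?] [].
Qed.

Let cmeas_poly (c : nat -> R[i]) (x : R[i]) N :
  cmeas (fun p => \sum_(j < N) c j * (x * to_complex p) ^+ j).
Proof.
have mtc : cmeas to_complex by split; [exact: measurable_fst|exact: measurable_snd].
have mz : cmeas (fun p => x * to_complex p) := cmeasM (cmeas_cst x) mtc.
have mX j : cmeas (fun p => (x * to_complex p) ^+ j).
  elim: j => [|j IH].
    by rewrite (_ : (fun p => _) = fun=> 1)//; apply/funext => p; rewrite expr0.
  rewrite (_ : (fun p => _) = fun p => (x * to_complex p) * (x * to_complex p) ^+ j).
    exact: cmeasM.
  by apply/funext => p; rewrite exprS.
elim: N => [|N IH].
  by rewrite (_ : (fun p => _) = fun=> 0)//; apply/funext => p; rewrite big_ord0.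
rewrite (_ : (fun p => _) = fun p => \sum_(j < N) c j * (x * to_complex p) ^+ j +
    c N * (x * to_complex p) ^+ N); last by apply/funext => p; rewrite big_ord_recr.
by apply: cmeasD => //; exact: cmeasM.
Qed.

Let cmeas_sqr f : cmeas f -> measurable_fun setT (fun p => normc (f p) ^+ 2).
Proof.
move=> [fR fI]; rewrite (_ : (fun p => _) =
  fun p => complex.Re (f p) ^+ 2 + complex.Im (f p) ^+ 2).
  by apply: measurable_funD; exact: measurable_funX.
by apply/funext => p; rewrite normc_sqr.
Qed.

Lemma pser_cvg c (G : R[i] -> R[i]) (z : R[i]) : pser c G ->
  normc (\sum_(j < N) c j * z ^+ j) ^+ 2 @[N --> \oo] --> normc (G z) ^+ 2.
Proof.
move=> /(_ (normc z))[K hK].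
suff h : normc (\sum_(j < N) c j * z ^+ j) @[N --> \oo] --> normc (G z).
  by rewrite expr2; under eq_fun do rewrite expr2; exact: cvgM.
have : K * 2^-1 ^+ N @[N --> \oo] --> K * 0.
  apply: cvgM; first exact: cvg_cst.
  by apply: cvg_expr; rewrite ger0_norm ?invr_ge0// invf_lt1// ltr1n.
rewrite mulr0 => /cvgr0_norm_le h0.
apply/cvgrPdist_le => e e0; have := h0 _ e0; apply: filterS => N hN.
apply: le_trans hN; apply: le_trans (ler_norm _); apply: le_trans (hK N z (lexx _)).
set a := G z; set b := \sum_(_ < _) _.
rewrite ler_norml; apply/andP; split.
  have := le_normcD (b - a) a; rewrite subrK normcB; lra.
have := le_normcD (a - b) b; rewrite subrK; lra.
Qed.

Lemma measurable_pser_sqr c G (x : R[i]) : pser c G ->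
  measurable_fun setT (fun p => normc (G (x * to_complex p)) ^+ 2).
Proof.
move=> hG; apply: (@measurable_fun_cvg _ _ _ setT
  (fun N p => normc (\sum_(j < N) c j * (x * to_complex p) ^+ j) ^+ 2)).
  by move=> N; apply: cmeas_sqr; exact: cmeas_poly.
by move=> p _; exact: pser_cvg.
Qed.

Lemma fatou_bound (f : nat -> R * R -> R) (g : R * R -> R) (B : \bar R) :
  (forall n, measurable_fun setT (f n)) -> (forall n p, 0 <= f n p) ->
  (forall p, f n p @[n --> \oo] --> g p) ->
  (forall n, \int[mu2]_p (f n p)%:E <= B)%E -> (\int[mu2]_p (g p)%:E <= B)%E.
Proof.
move=> mf f0 fg fB.
have mf' n : measurable_fun setT (fun p => (f n p)%:E) by apply/measurable_EFinP.
have := @fatou _ _ R mu2 setT measurableT (fun n p => (f n p)%:E) mf'.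
move=> /(_ _)/le_trans; rewrite (_ : (\int[mu2]_p (g p)%:E)%E =
    (\int[mu2]_p limn_einf (fun n => (f n p)%:E))%E); last first.
  apply: eq_integral => p _.
  have h : ((f n p)%:E @[n --> \oo] --> (g p)%:E)%E.
    by apply/fine_cvgP; split; [exact: nearW|exact: fg].
  by rewrite is_cvg_limn_einfE ?(cvg_lim _ h)//; apply/cvg_ex; exists (g p)%:E.
apply; first by move=> n p _; rewrite lee_fin.
rewrite limn_einf_lim; apply: lime_le; first exact: is_cvg_einfs.
apply: nearW => n; apply: le_trans (fB n); apply: ereal_inf_lbound.
by exists n => //=.
Qed.

Variable phi : R -> R.
Hypothesis phi0 : forall q, 0 <= phi q.
Hypothesis mphi : measurable_fun setT (fun p => phi (sqmod p)).

Lemma integral_rotate (A : R[i] -> R) M k : (4 < M)%N -> (forall z, 0 <= A z) ->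
  (forall x, measurable_fun setT (fun p => A (x * to_complex p))) ->
  (\int[mu2]_p (A (unit_root M ^+ k * to_complex p) * phi (sqmod p))%:E =
   \int[mu2]_p (A (to_complex p) * phi (sqmod p))%:E)%E.
Proof.
move=> M4 A0 mA; elim: k => [|k IH].
  by apply: eq_integral => p _; rewrite expr0 mul1r.
rewrite -IH; pose t : R := pi *+ 2 / M%:R.
have M0 : (0 : R) < M%:R by rewrite ltr0n (leq_trans _ M4).
have t0 : 0 < cos t.
  apply: cos_gt0_pihalf; rewrite (@lt_trans _ _ 0) ?oppr_lt0 ?divr_gt0 ?pi_gt0//=.
    have -> : t = pi / 2 * (4 / M%:R) by rewrite /t -mulr_natr; field; rewrite gt_eqF.
    by rewrite gtr_pMr ?divr_gt0 ?pi_gt0// ltr_pdivrMr// mul1r ltr_nat.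
  by rewrite mulrn_wgt0 ?pi_gt0.
rewrite -(@integral_rotation _ (fun p => (A (unit_root M ^+ k * to_complex p) * phi (sqmod p))%:E)
   (cos t) (sin t)) ?gt_eqF ?cos2Dsin2//.
- apply: eq_integral => p _; congr EFin; congr (A _ * phi _).
    rewrite exprSr -mulrA; congr (_ * _).
    rewrite /unit_root /cexp/= expR0 !mul1r -/t /to_complex.
    by apply/eqP; rewrite eq_complex/=; apply/andP; split; apply/eqP; ring.
  by rewrite /sqmod/= -[LHS]mul1r -{1}(cos2Dsin2 t); ring.
- by apply/measurable_EFinP; exact: measurable_funM.
- by move=> p; rewrite lee_fin mulr_ge0.
Qed.

Lemma integral_average (A : R[i] -> R) M : (4 < M)%N -> (forall z, 0 <= A z) ->
  (forall x, measurable_fun setT (fun p => A (x * to_complex p))) ->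
  (\int[mu2]_p (M%:R^-1 * (\sum_(k < M) A (unit_root M ^+ k * to_complex p)) * phi (sqmod p))%:E =
   \int[mu2]_p (A (to_complex p) * phi (sqmod p))%:E)%E.
Proof.
move=> M4 A0 mA; set I := RHS.
have M0 : (0 : R) < M%:R by rewrite ltr0n (leq_trans _ M4).
have mA' k : measurable_fun setT (fun p =>
    (A (unit_root M ^+ k * to_complex p) * phi (sqmod p))%:E).
  by apply/measurable_EFinP; exact: measurable_funM.
have mk k : measurable_fun setT (fun p =>
    (M%:R^-1 * (A (unit_root M ^+ k * to_complex p) * phi (sqmod p)))%:E).
  by apply/measurable_EFinP; apply: measurable_funM => //; exact: measurable_funM.
transitivity (\int[mu2]_p (\sum_(k < M)
   (M%:R^-1 * (A (unit_root M ^+ k * to_complex p) * phi (sqmod p)))%:E))%E.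
  apply: eq_integral => p _; rewrite sumEFin; congr EFin.
  by rewrite -mulr_sumr -mulr_suml mulrA.
rewrite ge0_integral_sum//; first last.
- by move=> k p _; rewrite lee_fin !mulr_ge0// invr_ge0 ltW.
- by move=> k; exact: mk.
transitivity (\sum_(k < M) (M%:R^-1)%:E * I)%E.
  apply: eq_bigr => k _; under eq_integral do rewrite EFinM.
  rewrite ge0_integralZl//; first by rewrite integral_rotate.
  - exact: mA'.
  - by move=> p _; rewrite lee_fin mulr_ge0.
rewrite -ge0_sume_distrl; last by move=> k _; rewrite lee_fin invr_ge0 ltW.
by rewrite sumEFin sumr_const card_ord -[X in X%:E]mulr_natr mulVf ?gt_eqF ?mul1e.
Qed.

Variable m : nat -> R.
Hypothesis moment : forall j,
  (\int[mu2]_p (sqmod p ^+ j * phi (sqmod p))%:E = (m j)%:E)%E.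

Lemma integral_radial_sum (b : nat -> R) N : (forall j, 0 <= b j) ->
  (\int[mu2]_p ((\sum_(j < N) b j * sqmod p ^+ j) * phi (sqmod p))%:E =
   (\sum_(j < N) m j * b j)%:E)%E.
Proof.
move=> b0; have mkr j : measurable_fun setT (fun p => sqmod p ^+ j * phi (sqmod p)).
  apply: measurable_funM => //.
  by apply: measurable_funX; exact: measurable_sqmod.
have mk j : measurable_fun setT (fun p => (sqmod p ^+ j * phi (sqmod p))%:E).
  exact/measurable_EFinP.
have mkb j : measurable_fun setT (fun p => (b j * (sqmod p ^+ j * phi (sqmod p)))%:E).
  by apply/measurable_EFinP; exact: measurable_funM (mkr j).
transitivity (\int[mu2]_p (\sum_(j < N) (b j * (sqmod p ^+ j * phi (sqmod p)))%:E))%E.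
  apply: eq_integral => p _; rewrite mulr_suml -sumEFin; apply: eq_bigr => j _.
  by rewrite mulrA.
rewrite ge0_integral_sum//; first last.
- by move=> j p _; rewrite lee_fin !mulr_ge0 ?exprn_ge0 ?sqmod_ge0.
- by move=> j; exact: mkb.
rewrite -sumEFin; apply: eq_bigr => j _; under eq_integral do rewrite EFinM.
rewrite ge0_integralZl ?lee_fin//; first by rewrite moment -EFinM mulrC.
  exact: mk.
by move=> p _; rewrite lee_fin mulr_ge0 ?exprn_ge0 ?sqmod_ge0.
Qed.

Lemma ler_sum_ord (u : nat -> R) J N : (forall j, 0 <= u j) -> (J <= N)%N ->
  \sum_(j < J) u j <= \sum_(j < N) u j.
Proof.
move=> u0 JN; rewrite -(subnKC JN) big_split_ord/= lerDl.
by apply: sumr_ge0 => j _; exact: u0.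
Qed.

(** For polynomial partial sums the planar integral equals the weighted sum of squares; Fatou's
    lemma passes the bound to the limit. *)
Lemma parseval_le c G (B : R) : pser c G ->
  (forall N, \sum_(j < N) m j * normc (c j) ^+ 2 <= B) ->
  (\int[mu2]_p (normc (G (to_complex p)) ^+ 2 * phi (sqmod p))%:E <= B%:E)%E.
Proof.
move=> hG hB; pose P N z := \sum_(j < N) c j * z ^+ j.
have mP N x : measurable_fun setT (fun p => normc (P N (x * to_complex p)) ^+ 2).
  by apply: cmeas_sqr; exact: cmeas_poly.
apply: (@fatou_bound (fun N p => normc (P N (to_complex p)) ^+ 2 * phi (sqmod p))).
- move=> N; apply: measurable_funM => //.
  have := mP N 1; congr measurable_fun; apply/funext => p; by rewrite mul1r.
- by move=> N p; rewrite mulr_ge0 ?sqr_ge0.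
- by move=> p; apply: cvgM; [exact: pser_cvg|exact: cvg_cst].
(* N + 5 roots are enough both to separate the exponents below N and to exceed 4. *)
move=> N; rewrite -(@integral_average (fun z => normc (P N z) ^+ 2) (N + 5)).
- apply: le_trans (_ : (\sum_(j < N) m j * normc (c j) ^+ 2)%:E <= _)%E; last by rewrite lee_fin.
  rewrite -(@integral_radial_sum (fun j => normc (c j) ^+ 2)); last by move=> j; exact: sqr_ge0.
  rewrite le_eqVlt; apply/orP; left; apply/eqP; apply: eq_integral => p _.
  by rewrite discrete_parseval ?leq_addr ?addn_gt0 ?orbT// normc_to_complex.
- by rewrite addnC.
- by move=> z; exact: sqr_ge0.
- by move=> x; exact: mP.
Qed.

(** Each rotational average [Av n] has the same integral as |G|^2, and is at least the truncated
    radial sum [T] up to an error tending to 0. Capping it by [T] gives functions that converge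
    pointwise to [T], so Fatou's lemma applies. *)
Lemma parseval_ge c G J : pser c G ->
  ((\sum_(j < J) m j * normc (c j) ^+ 2)%:E <=
   \int[mu2]_p (normc (G (to_complex p)) ^+ 2 * phi (sqmod p))%:E)%E.
Proof.
move=> hG; pose A z := normc (G z) ^+ 2.
have mA x : measurable_fun setT (fun p => A (x * to_complex p)).
  exact: measurable_pser_sqr hG.
pose T p := \sum_(j < J) normc (c j) ^+ 2 * sqmod p ^+ j.
pose Av (n : nat) p := (n + J + 5)%:R^-1 *
  \sum_(k < n + J + 5) A (unit_root (n + J + 5) ^+ k * to_complex p).
rewrite -(@integral_radial_sum (fun j => normc (c j) ^+ 2)); last by move=> j; exact: sqr_ge0.
have Av0 n p : 0 <= Av n p.
  by rewrite mulr_ge0 ?invr_ge0// sumr_ge0// => k _; exact: sqr_ge0.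
have T0 p : 0 <= T p.
  by apply: sumr_ge0 => j _; rewrite mulr_ge0 ?sqr_ge0 ?exprn_ge0 ?sqmod_ge0.
have mAv n : measurable_fun setT (Av n).
  by apply: measurable_funM => //; apply: measurable_sum => k.
have mT : measurable_fun setT T.
  apply: measurable_sum => j; apply: measurable_funM => //.
  by apply: measurable_funX; exact: measurable_sqmod.
have mmin n : measurable_fun setT (fun p => Num.min (Av n p) (T p) * phi (sqmod p)).
  by apply: measurable_funM => //; exact: measurable_minr.
have mavg n : measurable_fun setT (fun p => Av n p * phi (sqmod p)).
  exact: measurable_funM.
have mminE n : measurable_fun setT (fun p => (Num.min (Av n p) (T p) * phi (sqmod p))%:E).
  exact/measurable_EFinP.
have mavgE n : measurable_fun setT (fun p => (Av n p * phi (sqmod p))%:E).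
  exact/measurable_EFinP.
apply: (@fatou_bound (fun n p => Num.min (Av n p) (T p) * phi (sqmod p))) => //.
- by move=> n p; rewrite mulr_ge0// le_min Av0 T0.
- move=> p; apply: cvgM; last exact: cvg_cst.
  have [K hK] := hG (normc (to_complex p)).
  have K0 : 0 <= K.
    by have := hK 0 (to_complex p) (lexx _); rewrite expr0 mulr1; exact/le_trans/normc_ge0.
  have e0 (n : nat) : 0 <= (2^-1 : R) ^+ n by rewrite exprn_ge0 ?invr_ge0.
  have e1 (n : nat) : (2^-1 : R) ^+ n <= 1.
    by rewrite exprn_ile1 ?invr_ge0// invf_le1// ler1n.
  (* On the circle through p, |G| <= K and the partial sum S is within d <= K 2^{-n} of G; hence
     |S|^2 - |G|^2 <= d (2 |G| + d) <= 3 K^2 2^{-n}. Discrete Parseval is exact for S. *)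
  have lb n : T p <= Av n p + 3 * K ^+ 2 * 2^-1 ^+ n.
    set M := (n + J + 5)%N.
    have M0 : (0 : R) < M%:R by rewrite ltr0n /M addn_gt0 orbT.
    have JM : (J <= M)%N by rewrite /M addnAC leq_addl.
    have nM : (n <= M)%N by rewrite /M -addnA leq_addr.
    apply: (@le_trans _ _ (\sum_(j < M) normc (c j) ^+ 2 * sqmod p ^+ j)).
      apply: (@ler_sum_ord (fun j => normc (c j) ^+ 2 * sqmod p ^+ j)) => // j.
      by rewrite mulr_ge0 ?sqr_ge0 ?exprn_ge0 ?sqmod_ge0.
    rewrite -normc_to_complex -(@discrete_parseval _ c M M)//; last by rewrite -(ltr0n R).
    have -> : Av n p + 3 * K ^+ 2 * 2^-1 ^+ n =
       M%:R^-1 * \sum_(k < M) (A (unit_root M ^+ k * to_complex p) + 3 * K ^+ 2 * 2^-1 ^+ n).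
      rewrite big_split/= mulrDr sumr_const card_ord -[X in _ = _ + _ * X]mulr_natl.
      by rewrite mulKf ?gt_eqF.
    rewrite ler_wpM2l ?invr_ge0 ?(ltW M0)//; apply: ler_sum => k _.
    set w := _ * _; have wz : normc w <= normc (to_complex p).
      by rewrite /w Normc.normcM normcX normc_unit_root expr1n mul1r.
    set S := \sum_(j < M) _; pose d := normc (G w - S).
    have dK : d <= K * 2^-1 ^+ n.
      apply: le_trans (hK M w wz) _; rewrite ler_wpM2l//.
      by rewrite -(subnKC nM) exprD ler_piMr.
    have d0 : 0 <= d by exact: normc_ge0.
    have a0 : 0 <= normc (G w) by exact: normc_ge0.
    have aK : normc (G w) <= K.
      by have := hK 0 w wz; rewrite big_ord0 subr0 expr0 mulr1.
    have Sad : normc S <= normc (G w) + d.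
      by rewrite [in normc S](_ : S = G w - (G w - S)); [exact: ler_normcB|ring].
    apply: (@le_trans _ _ ((normc (G w) + d) ^+ 2)).
      by rewrite lerXn2r ?nnegrE ?normc_ge0 ?addr_ge0.
    have -> : (normc (G w) + d) ^+ 2 = A w + d * (2 * normc (G w) + d) by rewrite /A; ring.
    rewrite lerD2l (_ : 3 * _ * _ = (K * 2^-1 ^+ n) * (3 * K)); last by ring.
    apply: ler_pM => //; first by rewrite addr_ge0 ?mulr_ge0.
    have : K * 2^-1 ^+ n <= K by rewrite ler_piMr.
    lra.
  have : 3 * K ^+ 2 * 2^-1 ^+ n @[n --> \oo] --> 3 * K ^+ 2 * 0.
    apply: cvgM; first exact: cvg_cst.
    by apply: cvg_expr; rewrite ger0_norm ?invr_ge0// invf_lt1// ltr1n.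
  rewrite mulr0 => /cvgr0_norm_le h0.
  apply/cvgrPdist_le => e ep; have := h0 _ ep; apply: filterS => n hn.
  apply: le_trans hn; apply: le_trans (ler_norm _).
  have := lb n; case: (leP (Av n p) (T p)) => [h|h] lbn.
    by rewrite -/(T p) ger0_norm ?subr_ge0//; lra.
  by rewrite subrr normr0 mulr_ge0 ?mulr_ge0 ?sqr_ge0.
move=> n; apply: (@le_trans _ _ (\int[mu2]_p (Av n p * phi (sqmod p))%:E)%E).
  apply: ge0_le_integral => //.
  - by move=> p _; rewrite lee_fin mulr_ge0// le_min Av0 T0.
  - exact: mminE.
  - exact: mavgE.
  - by move=> p _; rewrite lee_fin ler_wpM2r// ge_min lexx.
have M4 : (4 < n + J + 5)%N by rewrite addnC.
by rewrite integral_average// => z; exact: sqr_ge0.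
Qed.

End PlanarParseval.

(** * The two inclusions *)

Section AlmostEverywhere.
Context {R : realType}.
Local Notation mu := (@lebesgue_measure R).

Lemma ae_imply (P Q : R -> Prop) : (forall x, P x -> Q x) ->
  {ae mu, forall x, P x} -> {ae mu, forall x, Q x}.
Proof.
move=> PQ [A [mA A0 sA]]; exists A; split=> // x nQ.
by apply: sA => Px; apply: nQ; exact: PQ.
Qed.

Lemma ae_and (P Q : R -> Prop) : {ae mu, forall x, P x} ->
  {ae mu, forall x, Q x} -> {ae mu, forall x, P x /\ Q x}.
Proof.
move=> hP hQ; have := negligibleU hP hQ; apply: negligibleS => x /= nPQ.
by have [Px|nPx] := pselect (P x); [right=> Qx; exact: nPQ|left].
Qed.

End AlmostEverywhere.

Section RealCharacterization.
Context {R : realType}.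
Variables nu theta : R.
Hypothesis hnu : -1 < nu.
Hypothesis htheta : 1 < theta.
Variable l : nat -> {poly R}.
Hypothesis hl : orthonormal_laguerre nu l.
Local Notation mu := (@lebesgue_measure R).
Local Notation Rp := ([set` `]0%R, +oo[] : set R).
Implicit Types f g : R -> R.

Let fin := gamma0_fin hl.
Let pos := gamma0_gt0 hl.
Let mRp : measurable (Rp : set (measurableTypeR R)). Proof. exact: measurable_itv. Qed.

Definition laguerre_fourier f (k : nat) : R := wint nu (fun x => f x * (l k).[x]).

Lemma ae_eq_wint f g : measurable_fun Rp f -> measurable_fun Rp g ->
  {ae mu, forall x, 0 < x -> f x = g x} -> wint nu f = wint nu g.
Proof.
move=> mf mg fg; rewrite /wint /Rintegral; congr fine; apply: ae_eq_integral => //.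
- apply/measurable_EFinP; apply: measurable_funM => //; exact: measurable_laguerre_weight.
- apply/measurable_EFinP; apply: measurable_funM => //; exact: measurable_laguerre_weight.
- by apply: (ae_imply _ fg) => x fgx; rewrite /= in_itv/= andbT => /fgx ->.
Qed.

Lemma ae_eq_wintegrable_sqr f g : measurable_fun Rp f -> measurable_fun Rp g ->
  {ae mu, forall x, 0 < x -> f x = g x} ->
  wintegrable nu (fun x => g x ^+ 2) -> wintegrable nu (fun x => f x ^+ 2).
Proof.
move=> mf mg fg /(wintegrable_sqr nu mg) gi; apply/wintegrable_sqr => //.
apply: le_lt_trans gi; rewrite le_eqVlt; apply/orP; left; apply/eqP.
apply: ae_eq_integral => //.
- apply/measurable_EFinP; apply: measurable_funM; last exact: measurable_laguerre_weight.
  exact: measurable_funX.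
- apply/measurable_EFinP; apply: measurable_funM; last exact: measurable_laguerre_weight.
  exact: measurable_funX.
- by apply: (ae_imply _ fg) => x fgx; rewrite /= in_itv/= andbT => /fgx ->.
Qed.

(** The difference of the two functions has zero Laguerre coefficients, so it is orthogonal to all
    polynomials and vanishes by completeness. *)
Lemma laguerre_expansion f : measurable_fun Rp f ->
  wintegrable nu (fun x => f x ^+ 2) ->
  bounded_sums (fun k => theta ^+ k * laguerre_fourier f k ^+ 2) ->
  {ae mu, forall x, 0 < x -> f x = exp_series theta (synthesis theta l (laguerre_fourier f)) x}.
Proof.
move=> mf f2 bf; set g := synthesis _ _ _.
have fg : fock nu theta g := fock_synthesis hnu htheta hl bf.
have mg : measurable_fun Rp (exp_series theta g) by exact: (measurable_exp_series hnu htheta).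
have g2 := wintegrable_exp_series_sqr hnu htheta fin pos fg.
pose d x := f x - exp_series theta g x.
have md : measurable_fun Rp d by exact: measurable_funB.
have d2 : wintegrable nu (fun x => d x ^+ 2).
  have fgi := wintegrable_mul mf mg f2 g2.
  have := wintegrableD (wintegrableB f2 (wintegrableZ 2 fgi)) g2.
  by apply: eq_wintegrable => x _; rewrite /d; ring.
have ip (p : {poly R}) : wintegrable nu (fun x => d x * p.[x]).
  apply: wintegrable_mul => //; first exact: measurable_horner.
  exact: wintegrable_poly_sqr hl p.
have dl n : wint nu (fun x => d x * (l n).[x]) = 0.
  have i1 : wintegrable nu (fun x => f x * (l n).[x]).
    apply: wintegrable_mul => //; first exact: measurable_horner.
    exact: wintegrable_poly_sqr hl _.
  have i2 : wintegrable nu (fun x => exp_series theta g x * (l n).[x]).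
    apply: wintegrable_mul => //; first exact: measurable_horner.
    exact: wintegrable_poly_sqr hl _.
  rewrite (@eq_wint _ _ _ (fun x => f x * (l n).[x] - exp_series theta g x * (l n).[x])).
    by rewrite wintB// (wint_synthesis hnu htheta hl)// subrr.
  by move=> x _; rewrite mulrBl.
have dp (p : {poly R}) : wint nu (fun x => d x * p.[x]) = 0.
  have [c pE] := laguerre_basis hl (leqnn (size p)).
  rewrite (@eq_wint _ _ _ (fun x => \sum_(k < size p) c k * (d x * (l k).[x]))).
    rewrite (@wint_sum _ _ _ (fun k x => c k * (d x * (l k).[x]))); last first.
      by move=> k; exact: wintegrableZ.
    by rewrite big1// => k _; rewrite wintZ// dl mulr0.
  move=> x _; rewrite {1}pE horner_sum mulr_sumr; apply: eq_bigr => k _.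
  by rewrite hornerZ; ring.
apply: (ae_imply _ (laguerre_complete hnu fin md d2 dp)) => x dx x0.
by apply/eqP; rewrite -subr_eq0; apply/eqP; exact: dx.
Qed.

(** Bessel's inequality for g; equality almost everywhere leaves the coefficients unchanged. *)
Lemma laguerre_fourier_bounded f (g : nat -> R) : measurable_fun Rp f ->
  fock nu theta g -> {ae mu, forall x, 0 < x -> f x = exp_series theta g x} ->
  bounded_sums (fun k => theta ^+ k * laguerre_fourier f k ^+ 2).
Proof.
move=> mf fg fae; have [B hB] := fg.
have mg : measurable_fun Rp (exp_series theta g) by exact: (measurable_exp_series hnu htheta).
have C0 : 0 < (1 + rate theta) `^ (nu + 1).
  by rewrite powR_gt0// addr_gt0// rate_gt0.
exists (B / (1 + rate theta) `^ (nu + 1)) => N.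
rewrite ler_pdivlMr// mulrC; have := laguerre_bessel hnu htheta hl N hB.
apply: le_trans; rewrite ler_wpM2l ?(ltW C0)//; apply: ler_sum => k _.
rewrite le_eqVlt; apply/orP; left; apply/eqP; congr (_ * _ ^+ 2).
apply: ae_eq_wint; do ?[apply: measurable_funM => //; exact: measurable_horner].
by apply: (ae_imply _ fae) => x fx x0; rewrite fx.
Qed.

End RealCharacterization.

(** * The Macdonald weight and the weighted l^2 condition *)

Section MacdonaldWeight.
Context {R : realType}.
Variables nu theta : R.
Hypothesis hnu : -1 < nu.
Hypothesis htheta : 1 < theta.
Hypothesis gamma0_fin : gamma_moment nu 0 \is a fin_num.
Hypothesis gamma0_gt0 : (0 < gamma_moment nu 0)%E.
Local Notation mu := (@lebesgue_measure R).
Local Notation mu2 := (mu \x mu)%E.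
Local Notation normc := Normc.normc.
Local Notation a := (rate theta).

Definition radial_weight (q : R) : R :=
  Num.sqrt q `^ nu * besselK nu (2 * Num.sqrt theta * Num.sqrt q / (theta - 1)).

Lemma macdonald_weightE (p : R * R) : macdonald_weight theta nu (to_complex p) =
  expR (a * p.1) ^+ 2 * radial_weight (sqmod p).
Proof.
rewrite /macdonald_weight /radial_weight /to_complex /sqmod/= -mulrA.
congr (_ * _); rewrite -expRM_natr; congr expR.
by rewrite /rate; set b := _^-1; ring.
Qed.

Lemma besselK_ge0 (x : R) : 0 <= besselK nu x.
Proof.
apply: Rintegral_ge0 => t _; rewrite mulr_ge0 ?expR_ge0 ?cosh_ge0//.
Qed.

Lemma radial_weight_ge0 q : 0 <= radial_weight q.
Proof. by rewrite mulr_ge0 ?powR_ge0 ?besselK_ge0. Qed.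

(** With x = 2 sqrt(theta) |z| / (theta - 1), the product |z|^nu (2/x)^nu is ((theta - 1) /
    sqrt(theta))^nu; the 1/2 comes from the evenness of the integral for K_nu. *)
Definition weight_const : R := 2^-1 * ((theta - 1) / Num.sqrt theta) `^ nu.

Lemma weight_const_gt0 : 0 < weight_const.
Proof.
have := htheta => h.
rewrite mulr_gt0 ?invr_gt0// powR_gt0// divr_gt0 ?sqrtr_gt0 ?subr_gt0//.
exact: theta_gt0.
Qed.

Let beta0 : 0 < (radius theta)^-1.
Proof. by rewrite invr_gt0 radius_gt0. Qed.

(** The factor |z|^nu in the weight cancels the |z|^{-nu} produced by the Bessel function, leaving a
    pure mixture; its parameter x^2/4 is |z|^2 / [radius]. *)
Lemma radial_weight_mixture q : 0 < q ->
  ((radial_weight q)%:E = weight_const%:E * mixture nu ((radius theta)^-1 * q))%E.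
Proof.
move=> q0; have t1 : 0 < theta - 1 by rewrite subr_gt0.
have t0 : 0 < theta := theta_gt0 htheta.
have st : 0 < Num.sqrt theta by rewrite sqrtr_gt0.
have sq : 0 < Num.sqrt q by rewrite sqrtr_gt0.
pose x := 2 * Num.sqrt theta * Num.sqrt q / (theta - 1).
have x0 : 0 < x by rewrite divr_gt0// !mulr_gt0.
have xq : x ^+ 2 / 4 = (radius theta)^-1 * q.
  rewrite /x /radius expr_div_n !exprMn !sqr_sqrtr ?ltW//; field.
  by rewrite !gt_eqF.
rewrite /radial_weight EFinM besselK_mixture//; last first.
  by rewrite -/x xq; apply: mixture_lty => //; rewrite mulr_gt0.
rewrite -/x xq muleA -EFinM; congr (_%:E * _)%E.
rewrite mulrCA /weight_const; congr (_ * _).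
rewrite -powRM; [|exact: ltW|by rewrite ltW// divr_gt0]; congr (powR _ _).
by rewrite /x; field; rewrite !gt_eqF.
Qed.

(** Away from the origin measurability comes from the mixture; the origin is added as a measurable
    singleton. *)
Lemma measurable_radial_weight :
  measurable_fun setT (fun p : R * R => radial_weight (sqmod p)).
Proof.
have mO : measurable ([set (0, 0)] : set (R * R)) := measurable_origin.
rewrite -(setvU [set ((0, 0) : R * R)]); apply/measurable_funU => //.
  exact: measurableC.
split; last exact: measurable_fun_set1.
have mf : measurable_fun (~` [set ((0, 0) : R * R)])
    (fine \o (fun p : R * R => weight_const%:E * mixture nu ((radius theta)^-1 * sqmod p))%E).
  apply: measurable_funTS; apply: measurableT_comp => //.
  apply: emeasurable_funM => //; apply: measurable_mixture => //.
  by apply: measurable_funM => //; exact: measurable_sqmod.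
apply: eq_measurable_fun mf => p; rewrite inE/= => /eqP p0.
by rewrite -radial_weight_mixture// sqmod_gt0.
Qed.

(** The mixture parameter 1 / [radius] contributes [radius] to the power j + 1; one factor is kept
    here and the others belong to [fock_weight]. *)
Definition moment_const : R := weight_const * pi * radius theta.

Lemma moment_const_gt0 : 0 < moment_const.
Proof.
apply: mulr_gt0; last exact: radius_gt0.
by apply: mulr_gt0; [exact: weight_const_gt0|exact: pi_gt0].
Qed.

Lemma radial_weight_moment j :
  (\int[mu2]_p (sqmod p ^+ j * radial_weight (sqmod p))%:E =
   (moment_const * fock_weight nu theta j)%:E)%E.
Proof.
have msj : measurable_fun setT (fun p : R * R => sqmod p ^+ j).
  by apply: measurable_funX; exact: measurable_sqmod.
have mm : measurable_fun setT (fun p : R * R => 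
    ((sqmod p ^+ j)%:E * mixture nu ((radius theta)^-1 * sqmod p))%E).
  apply: emeasurable_funM; first exact/measurable_EFinP.
  by apply: measurable_mixture => //; apply: measurable_funM => //; exact: measurable_sqmod.
transitivity (\int[mu2]_p (weight_const%:E *
    ((sqmod p ^+ j)%:E * mixture nu ((radius theta)^-1 * sqmod p))))%E.
  apply: eq_integral_off_origin.
  - apply/measurable_EFinP; apply: measurable_funM => //; exact: measurable_radial_weight.
  - exact: emeasurable_funM.
  - move=> p /sqmod_gt0 p0; rewrite EFinM radial_weight_mixture//.
    by rewrite muleCA.
rewrite ge0_integralZl//; first last.
- by rewrite lee_fin ltW// weight_const_gt0.
- by move=> p _; rewrite mule_ge0 ?lee_fin ?exprn_ge0 ?sqmod_ge0 ?mixture_ge0.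
rewrite integral_mixture_moment// -EFinM; congr EFin.
rewrite /moment_const /fock_weight -exprVn invrK exprS; ring.
Qed.

Lemma area_integral_tilt (F : R[i] -> R[i]) :
  area_integral (fun z => normc (F z) ^+ 2 * macdonald_weight theta nu z) =
  (\int[mu2]_p (normc (F (to_complex p) * cexp (a%:C * to_complex p)) ^+ 2 *
     radial_weight (sqmod p))%:E)%E.
Proof.
apply: eq_integral => p _; congr EFin; rewrite macdonald_weightE mulrA; congr (_ * _).
rewrite Normc.normcM exprMn normc_cexp; congr (_ * expR _ ^+ 2).
by rewrite /= mul0r subr0.
Qed.

Lemma area_integral_lty_fock (F : R[i] -> R[i]) (c : nat -> R[i]) :
  pser c (fun z => F z * cexp (a%:C * z)) ->
  (area_integral (fun z => normc (F z) ^+ 2 * macdonald_weight theta nu z)%R < +oo)%E <->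
  bounded_sums (fun j => fock_weight nu theta j * normc (c j) ^+ 2).
Proof.
move=> hG; rewrite area_integral_tilt.
have mc := moment_const_gt0.
have sumE (N : nat) : \sum_(j < N) moment_const * fock_weight nu theta j * normc (c j) ^+ 2 =
    moment_const * \sum_(j < N) fock_weight nu theta j * normc (c j) ^+ 2.
  by rewrite mulr_sumr; apply: eq_bigr => j _; rewrite mulrA.
split=> [h|[B hB]].
  have fn : (\int[mu2]_p (normc (F (to_complex p) * cexp (a%:C * to_complex p)) ^+ 2 *
     radial_weight (sqmod p))%:E)%E \is a fin_num.
    rewrite ge0_fin_numE//; apply: integral_ge0 => p _.
    by rewrite lee_fin mulr_ge0 ?sqr_ge0 ?radial_weight_ge0.
  exists (fine (\int[mu2]_p (normc (F (to_complex p) * cexp (a%:C * to_complex p)) ^+ 2 *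
     radial_weight (sqmod p))%:E)%E / moment_const) => N.
  rewrite ler_pdivlMr// mulrC -sumE -lee_fin fineK//.
  exact: (@parseval_ge _ _ radial_weight_ge0 measurable_radial_weight _
    radial_weight_moment _ _ N hG).
apply: (@le_lt_trans _ _ (moment_const * B)%:E); last exact: ltry.
apply: (@parseval_le _ _ radial_weight_ge0 measurable_radial_weight _
    radial_weight_moment _ _ _ hG) => N.
by rewrite sumE ler_pM2l.
Qed.

Lemma bounded_sums_fock (c : nat -> R[i]) :
  bounded_sums (fun j => fock_weight nu theta j * normc (c j) ^+ 2) <->
  fock nu theta (fun j => complex.Re (c j)) /\ fock nu theta (fun j => complex.Im (c j)).
Proof.
have M0 j := ltW (fock_weight_gt0 hnu htheta gamma0_fin gamma0_gt0 j).
split=> [h|[hR hI]].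
  split; apply: bounded_sums_le h => j; rewrite ler_wpM2l// normc_sqr.
    by rewrite lerDl sqr_ge0.
  by rewrite lerDr sqr_ge0.
apply: bounded_sums_le (bounded_sumsD hR hI) => j.
by rewrite -mulrDr normc_sqr.
Qed.

(** By the arithmetic-geometric mean inequality, |c_j| r^j is at most M_j |c_j|^2 + r^{2j} / M_j,
    and both terms are bounded in j. *)
Lemma fock_growth (c : nat -> R[i]) :
  bounded_sums (fun j => fock_weight nu theta j * normc (c j) ^+ 2) -> growth c.
Proof.
move=> [B hB] r r0.
have [D hD] := evaluation_bounded hnu htheta gamma0_fin gamma0_gt0 r.
have M0 j := fock_weight_gt0 hnu htheta gamma0_fin gamma0_gt0 j.
exists (B + D) => j; have n0 := normc_ge0 (c j).
have h1 : fock_weight nu theta j * normc (c j) ^+ 2 <= B.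
  apply: le_trans (hB j.+1); rewrite big_ord_recr/= lerDr; apply: sumr_ge0 => k _.
  by rewrite mulr_ge0 ?sqr_ge0 ?ltW.
have h2 : r ^+ (2 * j) / fock_weight nu theta j <= D.
  apply: le_trans (hD j.+1); rewrite big_ord_recr/= lerDr; apply: sumr_ge0 => k _.
  by apply: divr_ge0; [exact: exprn_ge0|exact: ltW].
apply: le_trans (lerD h1 h2).
set M := fock_weight nu theta j in h1 h2 *; have Mj : 0 < M := M0 j.
have -> : r ^+ (2 * j) = (r ^+ j) ^+ 2 by rewrite mulnC exprM.
set y := r ^+ j; have y0 : 0 <= y by exact: exprn_ge0.
rewrite -(ler_pM2l Mj) mulrDr [M * (_ / M)]mulrC divfK ?gt_eqF//.
have := sqr_ge0 (M * normc (c j) - y); have := mulr_ge0 (mulr_ge0 (ltW Mj) n0) y0; nra.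
Qed.

Lemma pser_real (c : nat -> R[i]) G (x : R) : pser c G ->
  complex.Re (G x%:C) = limn (series (fun j => complex.Re (c j) * x ^+ j)) /\
  complex.Im (G x%:C) = limn (series (fun j => complex.Im (c j) * x ^+ j)).
Proof.
move=> /(_ `|x|)[K hK].
have h N : normc (G x%:C - \sum_(j < N) c j * x%:C ^+ j) <= K * 2^-1 ^+ N.
  by apply: hK; rewrite normc_real.
have h0 : K * 2^-1 ^+ N @[N --> \oo] --> (0 : R).
  rewrite -[X in _ --> X](mulr0 K); apply: cvgM; first exact: cvg_cst.
  by apply: cvg_expr; rewrite ger0_norm ?invr_ge0// invf_lt1// ltr1n.
move/cvgr0_norm_le: h0 => h0'.
have lims (u : nat -> R) (L : R) : (forall N, `|L - series u N| <= K * 2^-1 ^+ N) ->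
    L = limn (series u).
  move=> hu; apply/esym/cvg_lim => //; apply/cvgrPdist_le => e e0.
  have := h0' _ e0; apply: filterS => N; apply: le_trans.
  exact: le_trans (hu N) (ler_norm _).
have ReX (z : R[i]) j : complex.Re (z * x%:C ^+ j) = complex.Re z * x ^+ j.
  by rewrite -rmorphXn; case: z => ? ? /=; ring.
have ImX (z : R[i]) j : complex.Im (z * x%:C ^+ j) = complex.Im z * x ^+ j.
  by rewrite -rmorphXn; case: z => ? ? /=; ring.
have ReS N : complex.Re (\sum_(j < N) c j * x%:C ^+ j) =
    \sum_(j < N) complex.Re (c j) * x ^+ j.
  by rewrite raddf_sum; apply: eq_bigr => j _; exact: ReX.
have ImS N : complex.Im (\sum_(j < N) c j * x%:C ^+ j) =
    \sum_(j < N) complex.Im (c j) * x ^+ j.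
  by rewrite raddf_sum; apply: eq_bigr => j _; exact: ImX.
split; apply: lims => N; rewrite seriesEordf; apply: le_trans (h N).
  by rewrite -ReS -raddfB; exact: normc_Re.
by rewrite -ImS -raddfB; exact: normc_Im.
Qed.

Lemma tilted_pser_real (c : nat -> R[i]) F (x : R) :
  pser c (fun z => F z * cexp (a%:C * z)) ->
  complex.Re (F x%:C) = exp_series theta (fun j => complex.Re (c j)) x /\
  complex.Im (F x%:C) = exp_series theta (fun j => complex.Im (c j)) x.
Proof.
move=> hG; have [] := @pser_real _ _ x hG; rewrite -rmorphM/= cexp_real.
rewrite /exp_series; case: (F x%:C) => u v /= <- <-.
by rewrite !mulr0 subr0 add0r -!mulrA -expRD subrr expR0 !mulr1.
Qed.

End MacdonaldWeight.

(** * Complex-valued functions and the two implications *)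

Section ComplexLaguerre.
Context {R : realType}.
Variables nu theta : R.
Hypothesis hnu : -1 < nu.
Hypothesis htheta : 1 < theta.
Variable l : nat -> {poly R}.
Hypothesis hl : orthonormal_laguerre nu l.
Local Notation mu := (@lebesgue_measure R).
Local Notation Rp := ([set` `]0%R, +oo[] : set R).
Local Notation normc := Normc.normc.
Implicit Types f : R -> R[i].

Let mRp : measurable (Rp : set (measurableTypeR R)). Proof. exact: measurable_itv. Qed.

Lemma laguerre_coefE f k : laguerre_coef nu l f k =
  laguerre_fourier nu l (fun x => complex.Re (f x)) k +i*
  laguerre_fourier nu l (fun x => complex.Im (f x)) k.
Proof.
congr Complex; apply: eq_Rintegral => x _; case: (f x) => u v /=; ring.
Qed.

Lemma laguerre_L2P f : laguerre_L2 nu f <-> [/\ cmeasurable Rp f,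
  wintegrable nu (fun x => complex.Re (f x) ^+ 2) &
  wintegrable nu (fun x => complex.Im (f x) ^+ 2)].
Proof.
have W0 := @laguerre_weight_ge0 R nu.
split=> [[[mR mI] h]|[mf iR iI]].
  have bound (g : R -> R) : measurable_fun Rp g ->
      (forall x, g x ^+ 2 <= normc (f x) ^+ 2) -> wintegrable nu (fun x => g x ^+ 2).
    move=> mg gf; apply/wintegrable_sqr => //; apply: le_lt_trans h.
    have mn : measurable_fun Rp (fun x => normc (f x) ^+ 2).
      rewrite (_ : (fun x => _) = fun x => complex.Re (f x) ^+ 2 + complex.Im (f x) ^+ 2).
        by apply: measurable_funD; exact: measurable_funX.
      by apply/funext => x; rewrite normc_sqr.
    apply: ge0_le_integral => //.
    - by move=> x _; rewrite lee_fin mulr_ge0 ?sqr_ge0.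
    - apply/measurable_EFinP; apply: measurable_funM; last exact: measurable_laguerre_weight.
      exact: measurable_funX.
    - apply/measurable_EFinP; apply: measurable_funM => //; exact: measurable_laguerre_weight.
    - by move=> x _; rewrite lee_fin ler_wpM2r.
  by split=> //; apply: bound => // x; rewrite normc_sqr ?lerDl ?lerDr sqr_ge0.
split=> //; have := wint_EFin (wintegrableD iR iI).
under eq_integral do rewrite -normc_sqr.
by move=> ->; exact: ltry.
Qed.

Lemma laguerre_coef_summable f :
  (\sum_(0 <= k <oo) (normc (laguerre_coef nu l f k) ^+ 2 * theta ^+ k)%:E < +oo)%E <->
  bounded_sums (fun k => theta ^+ k * laguerre_fourier nu l (fun x => complex.Re (f x)) k ^+ 2) /\
  bounded_sums (fun k => theta ^+ k * laguerre_fourier nu l (fun x => complex.Im (f x)) k ^+ 2).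
Proof.
have t0 k : 0 <= theta ^+ k by rewrite exprn_ge0// ltW// theta_gt0.
rewrite nneseries_lty; last by move=> k; rewrite mulr_ge0 ?sqr_ge0.
split=> [h|[hR hI]].
  split; apply: bounded_sums_le h => k; rewrite mulrC ler_wpM2r// laguerre_coefE normc_sqr/=.
    by rewrite lerDl sqr_ge0.
  by rewrite lerDr sqr_ge0.
apply: bounded_sums_le (bounded_sumsD hR hI) => k.
by rewrite -mulrDr laguerre_coefE normc_sqr mulrC.
Qed.

(** Synthesise the real and imaginary coefficient sequences, sum the resulting power series to G and
    set F = G e^{-az}. The same sequence governs the planar integral of F and its values on the half
    line. *)
Lemma entire_extension f : laguerre_L2 nu f ->
  (\sum_(0 <= k <oo) (normc (laguerre_coef nu l f k) ^+ 2 * theta ^+ k)%:E < +oo)%E ->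
  exists F : R[i] -> R[i], [/\ entire F,
    (area_integral (fun z => (normc (F z) ^+ 2 * macdonald_weight theta nu z)%R) < +oo)%E &
    {ae mu, forall x, 0 < x -> f x = F x%:C}].
Proof.
move=> /laguerre_L2P[[mR mI] iR iI] /laguerre_coef_summable[bR bI].
have fin := gamma0_fin hl; have pos := gamma0_gt0 hl.
pose gR := synthesis theta l (laguerre_fourier nu l (fun x => complex.Re (f x))).
pose gI := synthesis theta l (laguerre_fourier nu l (fun x => complex.Im (f x))).
pose c (j : nat) := gR j +i* gI j.
have bc : bounded_sums (fun j => fock_weight nu theta j * normc (c j) ^+ 2).
  by apply/bounded_sums_fock => //; split; exact: fock_synthesis.
have gc : growth c := fock_growth hnu htheta fin pos bc.
have [G hG] := pser_exists gc.
pose a : R[i] := (rate theta)%:C.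
pose F z := G z * cexp (- a * z).
have hFG : pser c (fun z => F z * cexp (a * z)).
  rewrite (_ : (fun z => _) = G)//; apply/funext => z.
  by rewrite /F -mulrA mulNr cexpNM mulr1.
exists F; split.
- apply/entireP => z; apply: cdiffableM; last exact: cdiff_cexp.
  exact: pser_cdiffable gc hG z.
- by apply/(area_integral_lty_fock hnu htheta fin hFG).
- have eR := laguerre_expansion hnu htheta hl mR iR bR.
  have eI := laguerre_expansion hnu htheta hl mI iI bI.
  apply: (ae_imply _ (ae_and eR eI)) => x [hR hI] x0.
  have [FR FI] := tilted_pser_real x hFG.
  apply/eqP; rewrite eq_complex FR FI; apply/andP; split; apply/eqP.
    exact: hR.
  exact: hI.
Qed.

(** The planar integral places the Taylor coefficients of F(z) e^{az} in the weighted l^2.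
    Integrability of the kernel then gives the L^2 condition, and Bessel's inequality the
    summability. *)
Lemma entire_restriction f (F : R[i] -> R[i]) : cmeasurable Rp f -> entire F ->
  (area_integral (fun z => (normc (F z) ^+ 2 * macdonald_weight theta nu z)%R) < +oo)%E ->
  {ae mu, forall x, 0 < x -> f x = F x%:C} ->
  laguerre_L2 nu f /\
  (\sum_(0 <= k <oo) (normc (laguerre_coef nu l f k) ^+ 2 * theta ^+ k)%:E < +oo)%E.
Proof.
move=> [mR mI] /entireP hF hA fF.
have fin := gamma0_fin hl; have pos := gamma0_gt0 hl.
pose a : R[i] := (rate theta)%:C.
have dG z : cdiffable (fun z => F z * cexp (a * z)) z.
  by apply: cdiffableM; [exact: hF|exact: cdiff_cexp].
have hG := pser_taylor dG; set c := taylor_coef _ in hG.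
have /(bounded_sums_fock hnu htheta fin pos)[fR fI] :=
  proj1 (area_integral_lty_fock hnu htheta fin hG) hA.
have eR : {ae mu, forall x, 0 < x ->
    complex.Re (f x) = exp_series theta (fun j => complex.Re (c j)) x}.
  apply: (ae_imply _ fF) => x fx x0; rewrite fx//.
  by have [] := tilted_pser_real x hG.
have eI : {ae mu, forall x, 0 < x ->
    complex.Im (f x) = exp_series theta (fun j => complex.Im (c j)) x}.
  apply: (ae_imply _ fF) => x fx x0; rewrite fx//.
  by have [] := tilted_pser_real x hG.
split.
  apply/laguerre_L2P; split=> //.
    apply: (ae_eq_wintegrable_sqr mR _ eR).
      exact: (measurable_exp_series hnu htheta fin pos mRp fR).
    exact: wintegrable_exp_series_sqr.
  apply: (ae_eq_wintegrable_sqr mI _ eI).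
    exact: (measurable_exp_series hnu htheta fin pos mRp fI).
  exact: wintegrable_exp_series_sqr.
by apply/laguerre_coef_summable; split;
  [exact: laguerre_fourier_bounded fR eR|exact: laguerre_fourier_bounded fI eI].
Qed.

End ComplexLaguerre.

Theorem theorem2 (R : realType) (theta nu : R)
    (htheta : 1 < theta) (hnu : -1 < nu)
    (l : nat -> {poly R}) (hl : orthonormal_laguerre nu l) :
  [set f : R -> R[i] | laguerre_L2 nu f /\
     (\sum_(0 <= k <oo)
        (Normc.normc (laguerre_coef nu l f k) ^+ 2 * theta ^+ k)%:E < +oo)%E]
  = [set f : R -> R[i] | cmeasurable `]0, +oo[ f /\
     exists F : R[i] -> R[i],
       [/\ entire F,
           (area_integral
              (fun z => (Normc.normc (F z) ^+ 2 * macdonald_weight theta nu z)%R)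
              < +oo)%E
         & {ae @lebesgue_measure R, forall x : R, 0 < x -> f x = F x%:C}]].
Proof.
apply/seteqP; split=> f /= [].
  by move=> fL2 hf; split; [exact: (proj1 fL2)|exact: (entire_extension hnu htheta hl)].
by move=> mf [F [hF hA fF]]; exact: (entire_restriction hnu htheta hl mf hF hA fF).
Qed.
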